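(* Let $c>0$ and $B<3$ be fixed constants and let $m=m(n)$ satisfy $m(n)\in[cn,Bn]$ for all large $n$. Let $H_1,\ldots,H_l$ be fixed connected planar graphs each containing at most one cycle, and let $t$ be a fixed constant. Then there exist constants $\epsilon>0$ and $N$ such that for all $n\ge N$, $$\mathbf{P}\Big[\bigcap_{i=1}^{l}\big(P_{n,m}\text{ has at least } t \text{ components with an order-preserving isomorphism to } H_i\big)\Big]\ge\epsilon.$$
   Context: $\mathcal{P}(n,m)$ is the set of simple labelled planar graphs on vertex set $\{1,\ldots,n\}$ with exactly $m$ edges; $P_{n,m}$ is chosen uniformly at random from $\mathcal{P}(n,m)$. Each $H_i$ has vertex set $\{1,\ldots,|H_i|\}$. A component $C$ of a graph on $\{1,\ldots,n\}$ has an order-preserving isomorphism to $H$ (with $V(H)=\{1,\ldots,h\}$) if $|C|=h$ and the increasing bijection from $\{1,\ldots,h\}$ to $V(C)$ is an isomorphism between $H$ and $C$. *)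

(* Defs.v *)
From HB Require Import structures.
From mathcomp Require Import all_boot all_order all_algebra.
From mathcomp Require Import all_classical all_reals all_analysis.

Set Implicit Arguments.
Unset Strict Implicit.
Unset Printing Implicit Defensive.

Import Order.TTheory GRing.Theory Num.Theory.
Import numFieldNormedType.Exports.

(* A simple graph on T, given by its set of edges (unordered pairs of distinct
   vertices).  Labelled graphs on {1, ..., n} are taken on 'I_n, i.e. the labels
   are shifted to {0, ..., n-1}, which preserves their order. *)
Record sgraph (T : finType) := SGraph {
  edges : {set {set T}};
  edges_card2 : [forall e in edges, #|e| == 2] }.

HB.instance Definition _ (T : finType) := [isSub for @edges T].
HB.instance Definition _ (T : finType) := [Equality of sgraph T by <:].
HB.instance Definition _ (T : finType) := [Choice of sgraph T by <:].
HB.instance Definition _ (T : finType) := [Countable of sgraph T by <:].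
HB.instance Definition _ (T : finType) := [Finite of sgraph T by <:].

Definition adj (T : finType) (G : sgraph T) : rel T :=
  fun x y => [set x; y] \in edges G.

Definition connected_graph (T : finType) (G : sgraph T) : bool :=
  (0 < #|T|) && [forall x, forall y, connect (adj G) x y].

Definition components (T : finType) (G : sgraph T) : {set {set T}} :=
  equivalence_partition (connect (adj G)) [set: T].

(* A vertex sequence traversing a cycle of G. *)
Definition graph_cycle (T : finType) (G : sgraph T) (s : seq T) : bool :=
  (2 < size s) && ucycleb (adj G) s.

(* As a subgraph, a cycle does not depend on the starting point and direction of
   its traversals, hence cycles are compared through their edge sets. *)
Definition cycle_edges (T : finType) (s : seq T) : {set {set T}} :=
  [set [set x; next s x] | x in s].

Definition at_most_one_cycle (T : finType) (G : sgraph T) : Prop :=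
  forall s1 s2 : seq T, graph_cycle G s1 -> graph_cycle G s2 ->
    cycle_edges s1 = cycle_edges s2.

(* A drawing of G in the plane without crossings: pos places the vertices, and
   curve e, restricted to [0, 1], is the Jordan arc representing the edge e (its
   values outside [0, 1], or for e not an edge of G, are irrelevant). *)
Record plane_drawing (R : realType) (T : finType) (G : sgraph T)
    (pos : T -> R * R) (curve : {set T} -> R -> R * R) : Prop := PlaneDrawing {
  pos_inj : injective pos;
  curve_continuous : forall e, e \in edges G ->
    {within `[0%R, 1%R], continuous (curve e)}%classic;
  curve_inj : forall e, e \in edges G ->
    {in `[0, 1]%R &, injective (curve e)};
  curve_ends : forall e, e \in edges G ->
    exists x y, [/\ e = [set x; y], curve e 0%R = pos x & curve e 1%R = pos y];
  curve_avoids_vertices : forall e, e \in edges G ->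
    forall (t : R) (x : T), t \in `]0, 1[%R -> curve e t <> pos x;
  curves_disjoint : forall e e', e \in edges G -> e' \in edges G -> e != e' ->
    forall s t : R, s \in `]0, 1[%R -> t \in `]0, 1[%R ->
      curve e s <> curve e' t }.

Definition planar (R : realType) (T : finType) (G : sgraph T) : Prop :=
  exists (pos : T -> R * R) (curve : {set T} -> R -> R * R),
    plane_drawing G pos curve.

Definition planar_graphs (R : realType) (n m : nat) : {set sgraph 'I_n} :=
  [set G : sgraph 'I_n | `[< planar R G >] & #|edges G| == m].

(* P[A(P_{n,m})] for P_{n,m} uniform on planar_graphs R n m; it is 0 by
   convention if there is no such graph. *)
Definition planar_prob (R : realType) (n m : nat) (A : pred (sgraph 'I_n)) : R :=
  (#|[set G in planar_graphs R n m | A G]|%:R / #|planar_graphs R n m|%:R)%R.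

Arguments planar_prob R n m A : clear implicits.

(* The map f is the increasing bijection from 'I_h onto C; it exists if and only
   if #|C| = h, and is then unique. *)
Definition order_preserving_iso (n h : nat) (G : sgraph 'I_n) (H : sgraph 'I_h)
    (C : {set 'I_n}) : bool :=
  [exists f : {ffun 'I_h -> 'I_n},
    [&& [forall i : 'I_h, forall j : 'I_h, (i < j) ==> (f i < f j)],
        C == [set f i | i : 'I_h] &
        [forall i : 'I_h, forall j : 'I_h, adj G (f i) (f j) == adj H i j]]].

Definition num_components (n h : nat) (G : sgraph 'I_n) (H : sgraph 'I_h) : nat :=
  #|[set C in components G | order_preserving_iso G H C]|.

(* Main.v *)
(* Count pairs (G, W) of a planar graph G with m edges and a set W of k isolated
   vertices of G.  An edge-maximal planar graph has at least 3n - 6 edges, so when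
   m <= B n with B < 3 linearly many edges can be added to G away from W, while at
   most m + 1 can be deleted: up to a constant factor, there are at most as many
   pairs for (k, m) as for (k, m + 1).  Linearly many vertices v have degree at most
   5; contracting v into a neighbour of bounded degree turns v into a new vertex of
   W and can be undone in O(n) ways, and the v of degree 3, 4 or 5 all of whose
   neighbours have large degree are few, because in a bipartite planar graph the
   vertices of degree at least 3 on one side are at most twice as many as those on
   the other.  So there are at most as many pairs for (k, m) as for (k + 1, m - 1),
   up to a constant factor.  Iterating, W becomes large enough to carry the missing
   copies of the H_i, which need at most one edge per vertex as H_i is at most
   unicyclic.  Each of the steps changes the numbers of copies boundedly, hence
   only boundedly many positions are possible for the copies that were added.

   The planarity facts rest on a combinatorial description of the faces, obtained
   from a drawing by replacing vertices by connected sets of cells of a fine grid;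
   Euler's inequality then comes from counting even edge sets. *)
From HB Require Import structures.
From mathcomp Require Import all_boot all_order all_algebra.
From mathcomp Require Import all_classical all_reals all_analysis.
From mathcomp Require Import ring lra zify.
Require Import Defs.

Set Implicit Arguments.
Unset Strict Implicit.
Unset Printing Implicit Defensive.

Import Order.TTheory GRing.Theory Num.Theory.
Import numFieldNormedType.Exports.
Local Open Scope ring_scope.

(** * Drawings and contractions *)

(** Bounding the positions of the added copies fails for an [H_i] that is already frequent. The
    graphs are therefore sorted by the set [S] of those [i] with fewer than [t0] copies of [H_i].
    Copies are added for [i] in [S] only; the other numbers start at [t0] or more, far enough above
    [t] to survive all changes made on the way. These changes depend on [S], so [t0] is chosen large
    enough for all [S] at once.

    A contraction loses between one and five edges. Adding edges serves first to return to an exact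
    number of edges, and at the end to make up for copies that have fewer edges than vertices.

    The constants [B] and [c] enter only through integers [q] and [p] with [q * m + n <= 3 * q * n]
    and [n <= p * m], so that all counting takes place in the natural numbers.

    No form of the Jordan curve theorem is proved for the curves of a drawing. Its part is taken by
    a fact about grids, where every even edge set is the boundary of a set of unit squares. *)

(** The curve of an edge depends on the ordered pair of its ends and is reversed with it. It is
    continuous on the whole line, so that curves can be cut and reparametrised with no subspace
    topology. The target is any normed space, as contraction uses only balls and segments. *)
Record pdraw (R : realType) (W : normedModType R) (T : finType) (V : {set T})
    (e : rel T) (pos : T -> W) (g : T -> T -> R -> W) : Prop := PDraw {
  pd_sym : symmetric e;
  pd_irr : irreflexive e;
  pd_dom : forall x y, e x y -> x \in V;
  pd_inj : {in V &, injective pos};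
  pd_cont : forall x y, e x y -> continuous (g x y);
  pd_rev : forall x y t, e x y -> g y x t = g x y (1 - t);
  pd_0 : forall x y, e x y -> g x y 0 = pos x;
  pd_arc : forall x y, e x y -> {in `[0, 1] &, injective (g x y)};
  pd_avoid : forall x y z t, e x y -> z \in V -> t \in `]0, 1[ ->
    g x y t <> pos z;
  pd_disj : forall x y z w s t, e x y -> e z w ->
    [set x; y] != [set z; w] -> s \in `]0, 1[ -> t \in `]0, 1[ ->
    g x y s <> g z w t }.

Section Glue.
Variables (R : realType) (W : normedModType R).
Implicit Types (c : W) (g : R -> W).

Definition glue c g (tau t : R) : W :=
  c + (2 * Num.min t (1 / 2)) *: (g tau - c) +
  (g (tau + (2 * Num.max t (1 / 2) - 1) * (1 - tau)) - g tau).

Lemma glue_lo c g tau t : t <= 1 / 2 ->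
  glue c g tau t = c + (2 * t) *: (g tau - c).
Proof.
move=> t2; rewrite /glue min_l // max_r //.
have -> : 2 * (1 / 2) - 1 = 0 :> R by lra.
by rewrite mul0r addr0 subrr addr0.
Qed.

Lemma glue_hi c g tau t : 1 / 2 <= t ->
  glue c g tau t = g (tau + (2 * t - 1) * (1 - tau)).
Proof.
move=> t2; rewrite /glue min_r // max_l //.
have -> : 2 * (1 / 2) = 1 :> R by lra.
by rewrite scale1r [c + _]addrC subrK addrC subrK.
Qed.

Lemma glue_cont c g tau : continuous g -> continuous (glue c g tau).
Proof.
move=> gc t; rewrite /glue.
have cm : {for t, continuous (fun t : R => Num.min t (1 / 2))}.
  by apply: (@continuous_min R R id (cst _) t); [exact: cvg_id | exact: cvg_cst].
have cM : {for t, continuous (fun t : R => Num.max t (1 / 2))}.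
  by apply: (@continuous_max R R id (cst _) t); [exact: cvg_id | exact: cvg_cst].
apply: cvgD.
  apply: cvgD; first exact: cvg_cst.
  apply: cvgZr_tmp.
  by apply: cvgM; [exact: cvg_cst | exact: cm].
apply: cvgB; last exact: cvg_cst.
apply: (@continuous_comp _ _ _
   (fun t : R => tau + (2 * Num.max t (1 / 2) - 1) * (1 - tau)) g); last exact: gc.
apply: cvgD; first exact: cvg_cst.
apply: cvgM; last exact: cvg_cst.
apply: cvgB; last exact: cvg_cst.
by apply: cvgM; [exact: cvg_cst | exact: cM].
Qed.

(** [tau] is the last time in the compact set of times that [g] spends in the closed ball. A
    distance below [r] at [tau] would give a later such time by the intermediate value theorem. *)
Lemma last_exit c g (r : R) : continuous g ->
  `|g 0 - c| < r -> r < `|g 1 - c| ->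
  exists tau, [/\ tau \in `]0, 1[, `|g tau - c| = r &
    forall t, tau < t -> t <= 1 -> r < `|g t - c|].
Proof.
move=> gc g0 g1.
pose phi t : R := `|g t - c|.
have cphi : continuous phi.
  move=> t; apply: (@cvg_norm _ _ _ _ _ (fun t => g t - c)).
  by apply: cvgB; [exact: gc | exact: cvg_cst].
pose A : set R := (`[0, 1] `&` [set t | phi t <= r])%classic.
have cA : compact A.
  apply: subclosed_compact (@segment_compact R 0 1) _.
  - apply: closedI; first exact: interval_closed.
    apply: (closed_comp _ (@closed_le R r)) => x _; exact: cphi.
  - by move=> x [].
have A0 : (A !=set0)%classic.
  by exists 0; split => /=; [rewrite in_itv /= lexx ler01 | exact: ltW].
have [|tau] := @compact_EVT_max _ R id A A0 cA.
  by apply: continuous_subspaceT => x; exact: cvg_id.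
rewrite inE => -[/= tau01 ptau] tmax; exists tau.
have tl t : tau < t -> t <= 1 -> r < phi t.
  move=> tt t1; rewrite ltNge; apply/negP => pt.
  have := tmax t; rewrite inE => /(_ _) /= tle.
  suff : t <= tau by lra.
  apply: tle; split => //=; move: tau01; rewrite !in_itv /=; lra.
move: tau01; rewrite in_itv /= => /andP[tau0 tau1].
have taulr : phi tau = r.
  apply/eqP; rewrite eq_le ptau /=; rewrite leNgt; apply/negP => pl.
  have [||t] := @IVT R phi tau 1 r tau1.
  - by apply: continuous_subspaceT.
  - by rewrite ge_min le_max (ltW pl) (ltW g1) orbT.
  rewrite in_itv /= => /andP[t0 t1] ptr.
  have : tau < t.
    by rewrite lt_neqAle t0 andbT; apply/eqP => tt; move: pl; rewrite tt ptr ltxx.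
  by move=> /tl /(_ t1); rewrite ptr ltxx.
split => //.
rewrite in_itv /= !lt_neqAle tau0 tau1 !andbT; apply/andP; split; apply/eqP.
  by move=> tt; move: taulr g0; rewrite -tt /phi => ->; rewrite ltxx.
by move=> tt; move: taulr g1; rewrite tt /phi => ->; rewrite ltxx.
Qed.

End Glue.

(** The contraction of [S] into its vertex [a]. It is used for a pair, which contracts an edge, and
    for [S = {a}], where it gives back [e] and only the drawing changes. *)
Definition hub_rel (T : finType) (e : rel T) (S : {set T}) (a : T) : rel T :=
  fun x y =>
  if x == a then (y \notin S) && [exists s in S, e s y]
  else if y == a then (x \notin S) && [exists s in S, e s x]
  else [&& x \notin S, y \notin S & e x y].

Section Hub.
Variables (R : realType) (W : normedModType R) (T : finType).
Variables (V : {set T}) (e : rel T) (pos : T -> W) (g : T -> T -> R -> W).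
Variables (S : {set T}) (a : T) (c : W) (r : R).
Hypothesis dr : pdraw V e pos g.
Hypothesis aS : a \in S.
Hypothesis SV : S \subset V.
Hypothesis hin : forall x, x \in S -> `|pos x - c| < r.
Hypothesis hout : forall x, x \in V -> x \notin S -> r < `|pos x - c|.
Hypothesis hedge : forall x y (t : R), e x y -> x \notin S -> y \notin S ->
  t \in `[0, 1] -> r < `|g x y t - c|.

Let r0 : 0 < r. Proof. exact: le_lt_trans (hin aS). Qed.

(** After [tau] the edge stays outside the ball, so its tail can be joined to the centre by a radius
    without crossing itself. *)
Let spoke (u : T) (s : T) (tau : R) :=
  [/\ s \in S, e s u, tau \in `]0, 1[, `|g s u tau - c| = r &
     forall t, tau < t -> t <= 1 -> r < `|g s u t - c|].

Let exspoke u : u \notin S -> [exists s in S, e s u] ->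
  exists s tau, spoke u s tau.
Proof.
move=> uS /existsP[s /andP[sS su]]; exists s.
have us : e u s by rewrite (pd_sym dr).
have [||tau [tau01 taur taul]] := @last_exit R W c (g s u) r (pd_cont dr su).
- by rewrite (pd_0 dr su); exact: hin.
- have := pd_rev dr 0 us; rewrite (pd_rev dr 1 us) subr0 subrr => _.
  by rewrite (pd_0 dr us); apply: hout (pd_dom dr us) uS.
by exists tau.
Qed.

Section Spoke.
Variables (u s : T) (tau : R).
Hypothesis sp : spoke u s tau.
Hypothesis uS : u \notin S.
Let h := glue c (g s u) tau.

Let g1 : g s u 1 = pos u.
Proof.
case: sp => _ su _ _ _; have us : e u s by rewrite (pd_sym dr).
by rewrite (pd_rev dr 1 us) subrr (pd_0 dr us).
Qed.

Lemma spoke0 : h 0 = c.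
Proof. by rewrite /h glue_lo ?mulr0 ?scale0r ?addr0 //; lra. Qed.

Lemma spoke1 : h 1 = pos u.
Proof.
rewrite /h glue_hi; last lra.
have -> : tau + (2 * 1 - 1) * (1 - tau) = 1 by ring.
exact: g1.
Qed.

Lemma spoke_lo t : 0 <= t -> t <= 1 / 2 -> `|h t - c| = 2 * t * r.
Proof.
case: sp => _ _ _ taur _ t0 t2; rewrite /h glue_lo // [c + _]addrC addrK normrZ.
by rewrite taur ger0_norm //; lra.
Qed.

Lemma spoke_hiE t : 1 / 2 < t -> t < 1 ->
  exists2 t', t' \in `]tau, 1[ & h t = g s u t'.
Proof.
case: sp => _ _; rewrite in_itv /= => /andP[tau0 tau1] _ _ t2 t1.
exists (tau + (2 * t - 1) * (1 - tau)); last by rewrite /h glue_hi //; lra.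
rewrite in_itv /=; nra.
Qed.

Lemma spoke_hi t : 1 / 2 < t -> t <= 1 -> r < `|h t - c|.
Proof.
case: (sp) => _ su tau01 _ taul t2; rewrite le_eqVlt => /orP[/eqP->|t1].
  by rewrite spoke1; apply: hout uS; apply: (pd_dom dr (y := s)); rewrite (pd_sym dr).
have [t' ] := spoke_hiE t2 t1; rewrite in_itv /= => /andP[? ?] ->.
by apply: taul => //; exact: ltW.
Qed.

Lemma spoke_inj : {in `[0, 1] &, injective h}.
Proof.
case: (sp) => _ su; rewrite in_itv /= => /andP[tau0 tau1] taur taul.
suff H t t' : 0 <= t -> t <= t' -> t' <= 1 -> h t = h t' -> t = t'.
  move=> t t'; rewrite !in_itv /= => /andP[t0 t1] /andP[t0' t1'] E.
  case: (leP t t') => tt; first exact: H E.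
  by apply/esym; apply: H (esym E) => //; exact: ltW.
move=> t0 tt t1 E.
case: (leP t' (1 / 2)) => t2'.
  have t2 : t <= 1 / 2 by lra.
  have := congr1 (fun z => `|z - c|) E; rewrite /= spoke_lo // spoke_lo //; last lra.
  by move/(mulIf (lt0r_neq0 r0)); lra.
case: (leP t (1 / 2)) => t2.
  have := congr1 (fun z => `|z - c|) E; rewrite spoke_lo // => E2.
  have := spoke_hi t2' t1; rewrite -E2; have := r0; nra.
move: E; rewrite /h glue_hi ?(ltW t2) // glue_hi ?(ltW t2') // => /(pd_arc dr su).
rewrite !in_itv /= => /(_ _ _) E.
have : tau + (2 * t - 1) * (1 - tau) = tau + (2 * t' - 1) * (1 - tau).
  by apply: E; nra.
nra.
Qed.

Lemma spoke_avoid z t : z \in V -> z \notin S -> t \in `]0, 1[ -> h t <> pos z.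
Proof.
move=> zV zS; rewrite in_itv /= => /andP[t0 t1].
case: (leP t (1 / 2)) => t2.
  move=> /(congr1 (fun z => `|z - c|)); rewrite /= spoke_lo ?(ltW t0) // => E.
  by have := hout zV zS; rewrite -E; have := r0; nra.
have [t' + ->] := spoke_hiE t2 t1.
case: (sp) => _ su; rewrite !in_itv /= => /andP[tau0 tau1] _ _ /andP[t0' t1'].
by apply: (pd_avoid dr su zV); rewrite in_itv /=; lra.
Qed.

Lemma spoke_avoid_hub t : t \in `]0, 1[ -> h t <> c.
Proof.
rewrite in_itv /= => /andP[t0 t1].
case: (leP t (1 / 2)) => t2 /(congr1 (fun z => `|z - c|)).
  by rewrite /= spoke_lo ?(ltW t0) // subrr normr0; have := r0; nra.
by rewrite subrr normr0 => E; have := spoke_hi t2 (ltW t1); rewrite E; have := r0; lra.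
Qed.

Lemma spoke_disj x y t t' : e x y -> x \notin S -> y \notin S ->
  t \in `]0, 1[ -> t' \in `]0, 1[ -> h t <> g x y t'.
Proof.
move=> xy xS yS; rewrite !in_itv /= => /andP[t0 t1] /andP[t0' t1'].
case: (leP t (1 / 2)) => t2.
  move=> /(congr1 (fun z => `|z - c|)); rewrite /= spoke_lo ?(ltW t0) // => E.
  have := @hedge x y t' xy xS yS; rewrite -E in_itv /= => /(_ _) H.
  suff: r < 2 * t * r by have := r0; nra.
  by apply: H; lra.
have [t'' + ->] := spoke_hiE t2 t1.
case: (sp) => sS su; rewrite !in_itv /= => /andP[tau0 tau1] _ _ /andP[t0'' t1''].
apply: (pd_disj dr su xy); rewrite ?in_itv /= ?t0' ?t1' //; last lra.
apply/eqP => E; have := set21 s u; rewrite E !inE => /orP[/eqP|/eqP] E'.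
  by move: xS; rewrite -E' sS.
by move: yS; rewrite -E' sS.
Qed.

End Spoke.

Lemma spoke_disj2 u s tau u' s' tau' t t' :
  spoke u s tau -> spoke u' s' tau' -> u \notin S -> u' \notin S -> u != u' ->
  t \in `]0, 1[ -> t' \in `]0, 1[ ->
  glue c (g s u) tau t <> glue c (g s' u') tau' t'.
Proof.
move=> sp sp' uS uS' uu; rewrite !in_itv /= => /andP[t0 t1] /andP[t0' t1'].
have sne : [set s; u] != [set s'; u'].
  apply/eqP => E; have := set22 s u; rewrite E !inE => /orP[/eqP|/eqP] E'.
    by case: sp' => + _ _ _ _; rewrite -E' (negbTE uS).
  by rewrite E' eqxx in uu.
have [sS su] := sp; have [sS' su'] := sp'.
rewrite !in_itv /= => /andP[a0' a1'] r' _ /andP[a0 a1] r1 _ E.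
have En := congr1 (fun z => `|z - c|) E.
case: (leP t (1 / 2)) => t2; case: (leP t' (1 / 2)) => t2'.
(* Points of two radii at the same distance from [c] have the same parameter, so a common point
   would force the exit points of two distinct edges to coincide. *)
- move: En; rewrite (spoke_lo sp) ?(ltW t0) // (spoke_lo sp') ?(ltW t0') // => En.
  have tt : t = t' by move: En => /(mulIf (lt0r_neq0 r0)); lra.
  move: E; rewrite glue_lo // glue_lo // tt => /addrI.
  have t'2 : 2 * t' != 0 by rewrite mulf_neq0 //; apply: lt0r_neq0; lra.
  move=> /(scalerI t'2) /addIr.
  by apply: (pd_disj dr su su' sne); rewrite in_itv /=; lra.
- have := spoke_hi sp' uS' t2' (ltW t1'); rewrite -En (spoke_lo sp) ?(ltW t0) //; have := r0; nra.
- have := spoke_hi sp uS t2 (ltW t1); rewrite En (spoke_lo sp') ?(ltW t0') //; have := r0; nra.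
have [q + Eq] := spoke_hiE sp t2 t1; have [q' + Eq'] := spoke_hiE sp' t2' t1'.
rewrite !in_itv /= => ? ?; move: E; rewrite Eq Eq'.
by apply: (pd_disj dr su su' sne); rewrite in_itv /=; lra.
Qed.

(* Inside the ball every spoke is a radius, so norms to the centre separate the
   radial parts from everything that lies outside. *)
Lemma hub_draw : exists g', [/\
  pdraw (V :\: (S :\ a)) (hub_rel e S a)
    (fun x => if x == a then c else pos x) g',
  forall x y, x \notin S -> y \notin S -> g' x y = g x y &
  forall u, u \notin S -> [exists s in S, e s u] -> exists s tau,
    [/\ s \in S, e s u, tau \in `]0, 1[, `|g s u tau - c| = r &
        g' a u = glue c (g s u) tau]].
Proof.
have H u : exists p : T * R,
    u \notin S -> [exists s in S, e s u] -> spoke u p.1 p.2.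
  have [uS|] := boolP (u \notin S); last by exists (a, 0).
  have [eu|] := boolP [exists s in S, e s u]; last by exists (a, 0).
  by have [s [tau ?]] := exspoke uS eu; exists (s, tau).
have [sel selP] := choice H.
pose h u := glue c (g (sel u).1 u) (sel u).2.
pose g' x y := if (x \notin S) && (y \notin S) then g x y
  else if x == a then h y else (fun t => h x (1 - t)).
have ga u : g' a u = h u by rewrite /g' aS eqxx.
have au u : u \notin S -> (u == a) = false.
  by move=> uS; apply: contraNF uS => /eqP->.
have ga' u t : u \notin S -> g' u a t = h u (1 - t).
  by move=> uS; rewrite /g' aS uS /= au.
have hsym x y : hub_rel e S a x y -> hub_rel e S a y x.
  rewrite /hub_rel; case: (eqVneq x a) => [->|xa].
    by case: (eqVneq y a) => [->|ya]; rewrite // aS.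
  case: (eqVneq y a) => [_|ya] //.
  by rewrite (pd_sym dr) => /and3P[-> -> ->].
have hE x y : hub_rel e S a x y ->
   [\/ [/\ x \notin S, y \notin S & e x y],
       [/\ x = a, y \notin S & spoke y (sel y).1 (sel y).2] |
       [/\ y = a, x \notin S & spoke x (sel x).1 (sel x).2]].
  rewrite /hub_rel; case: (eqVneq x a) => [->|xa].
    by move=> /andP[yS ex]; constructor 2; split => //; exact: selP.
  case: (eqVneq y a) => [->|ya]; last by case/and3P; constructor 1.
  by move=> /andP[yS ex]; constructor 3; split => //; exact: selP.
(* the trace of an edge is that of an old edge or of a spoke *)
have hT x y (t : R) : hub_rel e S a x y -> t \in `]0, 1[ ->
   [/\ x \notin S, y \notin S, e x y & g' x y t = g x y t] \/
   exists u (t' : R), [/\ [set x; y] = [set a; u], u \notin S,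
      spoke u (sel u).1 (sel u).2, t' \in `]0, 1[ & g' x y t = h u t'].
  move=> /hE[[xS yS xy]|[-> yS sp]|[-> xS sp]] t01.
  - by left; split; rewrite /g' ?xS ?yS.
  - by right; exists y, t; rewrite ga.
  - right; exists x, (1 - t); rewrite ga' // finset.setUC; split => //.
    by move: t01; rewrite !in_itv /=; lra.
exists g'; split.
- split.
  + by move=> x y; apply/idP/idP => /hsym.
  + move=> x; apply/negP => /hE[[_ _]|[-> + _]|[-> + _]]; rewrite ?aS //.
    by rewrite (pd_irr dr).
  + move=> x y; rewrite !inE => /hE[[xS yS xy]|[-> _ _]|[_ xS [_ sx _ _ _]]].
    * by rewrite (negbTE xS) andbF (pd_dom dr xy).
    * by rewrite eqxx (fintype.subsetP SV).
    * by rewrite (negbTE xS) andbF (pd_dom dr (y := (sel x).1)) // (pd_sym dr).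
  + move=> x y; rewrite !inE.
    case: (eqVneq x a) => [->|xa]; case: (eqVneq y a) => [->|ya] //= Hx Hy.
    * move=> E; have /andP[yS yV] := Hy.
      by exfalso; have := hout yV yS; rewrite -E subrr normr0; have := r0; lra.
    * move=> E; have /andP[yS yV] := Hx.
      by exfalso; have := hout yV yS; rewrite E subrr normr0; have := r0; lra.
    * have /andP[xS xV] := Hx; have /andP[yS yV] := Hy.
      exact: (pd_inj dr).
  + move=> x y /hE[[xS yS xy]|[-> yS sp]|[-> xS sp]].
    * by rewrite /g' xS yS; exact: (pd_cont dr xy).
    * by rewrite ga; apply: glue_cont; case: sp => _ sy _ _ _; exact: (pd_cont dr sy).
    * have -> : g' x a = h x \o (fun t => 1 - t) by apply/funext => t; rewrite ga'.
      move=> t; apply: continuous_comp.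
        by apply: cvgB; [exact: cvg_cst | exact: cvg_id].
      by apply: glue_cont; case: sp => _ sy _ _ _; exact: (pd_cont dr sy).
  + move=> x y t /hE[[xS yS xy]|[-> yS sp]|[-> xS sp]].
    * by rewrite /g' xS yS /=; exact: (pd_rev dr t xy).
    * by rewrite ga ga'.
    * by rewrite ga ga' // opprB [1 + _]addrC subrK.
  + move=> x y /hE[[xS yS xy]|[-> yS sp]|[-> xS sp]].
    * by rewrite /g' xS yS /= au //; exact: (pd_0 dr xy).
    * by rewrite ga eqxx; exact: spoke0.
    * by rewrite ga' // subr0 au //; exact: spoke1 sp.
  + move=> x y /hE[[xS yS xy]|[-> yS sp]|[-> xS sp]].
    * by rewrite /g' xS yS /=; exact: (pd_arc dr xy).
    * by rewrite ga; exact: spoke_inj sp _.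
    * move=> t t' t01 t01'; rewrite !ga' // => E.
      suff: 1 - t = 1 - t' by lra.
      by apply: (spoke_inj sp xS _ _ E);
        move: t01 t01'; rewrite !in_itv /=; lra.
  + move=> x y z t xy zV t01.
    have zS : z != a -> z \in V /\ z \notin S.
      move: zV; rewrite !inE => + za; rewrite za /=.
      by move/andP=> [].
    case: (hT _ _ _ xy t01) => [[xS yS xy' ->]|[u [t' [_ uS sp t01' ->]]]].
      case: (eqVneq z a) => [_|/zS[zV' zS']]; last exact: (pd_avoid dr xy' zV' t01).
      move=> E; have := hedge (t := t) xy' xS yS; rewrite E subrr normr0.
      have := r0; move: t01; rewrite !in_itv /= => ? ? H1.
      suff: r < 0 by lra.
      by apply: H1; lra.
    case: (eqVneq z a) => [_|/zS[zV' zS']]; first exact: (spoke_avoid_hub sp).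
    exact: (spoke_avoid sp).
  + move=> x y z w s t xy zw ne s01 t01.
    case: (hT _ _ _ xy s01) => [[xS yS xy' ->]|[u [s' [E uS sp s01' ->]]]];
    case: (hT _ _ _ zw t01) => [[zS wS zw' ->]|[u' [t' [E' uS' sp' t01' ->]]]].
    * exact: (pd_disj dr xy' zw' ne s01 t01).
    * by move/esym; exact: (spoke_disj sp').
    * exact: (spoke_disj sp).
    * apply: (spoke_disj2 sp sp' uS uS' _ s01' t01').
      by apply: contraNneq ne => uu; rewrite E E' uu.
- by move=> x y xS yS; rewrite /g' xS yS.
- move=> u uS eu; have [? ? ? ? ?] := selP u uS eu.
  by exists (sel u).1, (sel u).2; rewrite ga.
Qed.

End Hub.

(** * Compactness estimates for curves, and the contraction of an edge *)

Section Distance.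
Variables (R : realType) (W : normedModType R).

Lemma curve_dist (f g : R -> W) (a b c d : R) : continuous f -> continuous g ->
  a <= b -> c <= d ->
  (forall s t, a <= s <= b -> c <= t <= d -> f s <> g t) ->
  exists2 r, 0 < r & forall s t, a <= s <= b -> c <= t <= d -> r < `|f s - g t|.
Proof.
move=> fc gc ab cd fg.
pose A : set (R * R) := (`[a, b] `*` `[c, d])%classic.
have cA : compact A by apply: compact_setX; exact: segment_compact.
have A0 : (A !=set0)%classic.
  by exists (a, c); split; rewrite /= in_itv /= lexx ?ab ?cd.
pose phi (p : R * R) : R := `|f p.1 - g p.2|.
have cphi : continuous phi.
  move=> p; apply: (@cvg_norm _ _ _ _ _ (fun p => f p.1 - g p.2)).
  apply: cvgB.
    by apply: (@continuous_comp _ _ _ fst f); [exact: cvg_fst | exact: fc].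
  by apply: (@continuous_comp _ _ _ snd g); [exact: cvg_snd | exact: gc].
have [|p] := @compact_EVT_min _ R phi A A0 cA.
  exact: continuous_subspaceT.
rewrite inE => -[]; rewrite /= !in_itv /= => p1 p2 pmin.
have p0 : 0 < phi p by rewrite normr_gt0 subr_eq0; apply/eqP; exact: fg.
exists (phi p / 2); first by lra.
move=> s t sab tcd; have /pmin : (s, t) \in A.
  by rewrite inE; split; rewrite /= in_itv.
by rewrite {2}/phi /=; lra.
Qed.

Lemma point_dist (f : R -> W) (p : W) : continuous f ->
  (forall t, 0 <= t <= 1 -> f t <> p) ->
  exists2 r, 0 < r & forall t, 0 <= t <= 1 -> r < `|f t - p|.
Proof.
move=> fc fp.
have [||||r r0 rP] := @curve_dist f (cst p) 0 1 0 1 fc.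
- by move=> x; exact: cvg_cst.
- exact: ler01.
- exact: ler01.
- by move=> s t s01 _; exact: fp.
exists r => // t t01; apply: (rP t 0 t01).
by rewrite lexx ler01.
Qed.

(** [eta] is the least distance of two parameters whose values are at least [eps] apart, a minimum
    over a compact set; if there are none, 1 serves. *)
Lemma unif_cont (f : R -> W) (eps : R) : continuous f -> 0 < eps ->
  exists2 eta, 0 < eta & forall s t, 0 <= s <= 1 -> 0 <= t <= 1 ->
    `|s - t| < eta -> `|f s - f t| < eps.
Proof.
move=> fc eps0.
pose phi (p : R * R) : R := `|f p.1 - f p.2|.
have cphi : continuous phi.
  move=> p; apply: (@cvg_norm _ _ _ _ _ (fun p => f p.1 - f p.2)).
  apply: cvgB.
    by apply: (@continuous_comp _ _ _ fst f); [exact: cvg_fst | exact: fc].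
  by apply: (@continuous_comp _ _ _ snd f); [exact: cvg_snd | exact: fc].
pose d (p : R * R) : R := `|p.1 - p.2|.
have cd : continuous d.
  move=> p; apply: (@cvg_norm _ _ _ _ _ (fun p : R * R => p.1 - p.2)).
  by apply: cvgB; [exact: cvg_fst | exact: cvg_snd].
pose A : set (R * R) :=
  ((`[0, 1] `*` `[0, 1]) `&` [set p | eps <= phi p])%classic.
have cA : compact A.
  apply: compact_closedI.
    by apply: compact_setX; exact: segment_compact.
  apply: (closed_comp _ (@closed_ge R eps)) => x _; exact: cphi.
have [A0|A0] := pselect (A !=set0)%classic; last first.
  exists 1 => // s t s01 t01 _; rewrite ltNge; apply/negP => H; apply: A0.
  by exists (s, t); split => //; split; rewrite /= in_itv.
have [|p] := @compact_EVT_min _ R d A A0 cA; first exact: continuous_subspaceT.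
rewrite inE => -[_ /= pe] pmin.
have d0 : 0 < d p.
  rewrite normr_gt0 subr_eq0; apply: contraTneq pe => E.
  by rewrite /phi E subrr normr0 -ltNge.
exists (d p) => // s t s01 t01 st; rewrite ltNge; apply/negP => H.
have /pmin : (s, t) \in A.
  by rewrite inE; split => //; split; rewrite /= in_itv.
by rewrite leNgt st.
Qed.

(** Merges the clearances found for single vertices, edges or pairs of them into one; by
    monotonicity their minimum works for all. *)
Lemma fin_radius (I : finType) (P : I -> R -> Prop) :
  (forall i r r', 0 < r -> r <= r' -> P i r' -> P i r) ->
  (forall i, exists2 r, 0 < r & P i r) -> exists2 r, 0 < r & forall i, P i r.
Proof.
move=> mono H; have /choice[f fP] : forall i, exists r, 0 < r /\ P i r.
  by move=> i; have [r] := H i; exists r.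
have [i0|noI] := pickP (mem I); last by exists 1 => // i; have := noI i.
pose r := \big[Num.min/f i0]_i f i.
have r0 : 0 < r.
  apply: (big_ind (fun x => 0 < x)) => [|x y x0 y0|i _]; first by case: (fP i0).
    by rewrite lt_min x0.
  by case: (fP i).
exists r => // k; have [_] := fP k; apply: mono => //.
exact: bigmin_le.
Qed.

End Distance.

Section Contract.
Variables (R : realType) (W : normedModType R) (T : finType).
Implicit Types (V : {set T}) (e : rel T) (pos : T -> W) (g : T -> T -> R -> W).

Lemma pd_1 V e pos g x y : pdraw V e pos g -> e x y -> g x y 1 = pos y.
Proof.
move=> dr xy; have yx : e y x by rewrite (pd_sym dr).
by rewrite (pd_rev dr 1 yx) subrr (pd_0 dr yx).
Qed.

Lemma pd_dom2 V e pos g x y : pdraw V e pos g -> e x y -> y \in V.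
Proof. by move=> dr; rewrite (pd_sym dr) => /(pd_dom dr). Qed.

Lemma pd_miss V e pos g x y z (t : R) : pdraw V e pos g -> e x y -> z \in V ->
  z != x -> z != y -> 0 <= t <= 1 -> g x y t <> pos z.
Proof.
move=> dr xy zV zx zy /andP[t0 t1].
move: t0; rewrite le_eqVlt => /orP[/eqP<-|t0].
  rewrite (pd_0 dr xy) => /(pd_inj dr (pd_dom dr xy) zV) E.
  by rewrite E eqxx in zx.
move: t1; rewrite le_eqVlt => /orP[/eqP->|t1].
  rewrite (pd_1 dr xy) => /(pd_inj dr (pd_dom2 dr xy) zV) E.
  by rewrite E eqxx in zy.
by apply: (pd_avoid dr xy zV); rewrite in_itv /= t0.
Qed.

(** Apart from [a], the ball meets only edges at [a], so [a] can be moved to its centre by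
    contracting [{a}]. The last conjunct records how the curves at [a] change, which the sliding of
    a vertex has to keep track of. *)
Lemma move_vertex V e pos g a (c : W) (r : R) : pdraw V e pos g -> a \in V ->
  `|pos a - c| < r ->
  (forall u, u \in V -> u != a -> r < `|pos u - c|) ->
  (forall x y (t : R), e x y -> x != a -> y != a -> 0 <= t <= 1 ->
     r < `|g x y t - c|) ->
  exists g', [/\ pdraw V e (fun x => if x == a then c else pos x) g',
    forall x y, x != a -> y != a -> g' x y = g x y &
    forall u, e a u -> exists tau, [/\ tau \in `]0, 1[,
      `|g a u tau - c| = r & g' a u = glue c (g a u) tau]].
Proof.
move=> dr aV ain aout aedge.
have [|||||g' [dr' g'E g'a]] :=
    @hub_draw R W T V e pos g [set a] a c r dr.
- by rewrite inE.
- by apply/fintype.subsetP => x; rewrite inE => /eqP->.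
- by move=> x; rewrite inE => /eqP->.
- by move=> x xV; rewrite inE; exact: aout.
- by move=> x y t xy; rewrite !finset.in_set1 in_itv; exact: aedge.
have exE u : [exists s in [set a], e s u] = e a u.
  apply/existsP/idP => [[s /andP[]]|au]; first by rewrite inE => /eqP->.
  by exists a; rewrite inE eqxx.
have eE : hub_rel e [set a] a = e.
  apply/funext => x; apply/funext => y; rewrite /hub_rel !exE !inE.
  case: (eqVneq x a) => [->|xa]; case: (eqVneq y a) => [->|ya] //=.
  - by rewrite (pd_irr dr).
  - by rewrite (pd_sym dr).
have VE : V :\: ([set a] :\ a) = V.
  by apply/setP => x; rewrite !inE andNb.
exists g'; split; first by rewrite -{1}eE -{1}VE.
  by move=> x y xa ya; apply: g'E; rewrite inE.
move=> u au; have [||s [tau []]] := g'a u.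
- by rewrite inE; apply: contraTneq au => ->; rewrite (pd_irr dr).
- by rewrite exE.
by rewrite inE => /eqP-> _ ? ? ?; exists tau.
Qed.

(* A vertex is slid along an edge: each step recentres it at the point where
   the edge leaves the current ball for the last time.  The radii strictly
   increase but stay below a bound, so that a uniformly positive part of the
   edge is consumed each time. *)
Lemma contract_draw V e pos g a v : pdraw V e pos g -> e a v ->
  exists pos' g', @pdraw R W T (V :\ v) (hub_rel e [set a; v] a) pos' g'.
Proof.
move=> dr av; pose ga := g a v.
have aV := pd_dom dr av; have vV := pd_dom2 dr av.
have gac : continuous ga := pd_cont dr av.
have anv : a != v by apply: contraTneq av => ->; rewrite (pd_irr dr).
(* The ball of radius [rho] about [v] meets nothing but [a], [v] and edges at them; once [a] is
   inside, the pair can be contracted. *)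
have [rho rho0 [rhoV rhoE]] : exists2 rho, 0 < rho &
    (forall u, u \in V -> u != a -> u != v -> rho < `|pos u - pos v|) /\
    (forall x y t, e x y -> x != a -> y != a -> x != v -> y != v ->
       0 <= t <= 1 -> rho < `|g x y t - pos v|).
  have [||r1 r10 r1P] := @fin_radius R T (fun u rho =>
      u \in V -> u != a -> u != v -> rho < `|pos u - pos v|).
  - by move=> u r r' _ rr H *; apply: le_lt_trans rr _; exact: H.
  - move=> u; have [uv|uv] := eqVneq u v; first by exists 1.
    have [uV|] := boolP (u \in V); last by exists 1.
    have p0 : 0 < `|pos u - pos v|.
      by rewrite normr_gt0 subr_eq0; apply: contra_neqN uv => /eqP /(pd_inj dr uV vV).
    by exists (`|pos u - pos v| / 2) => *; lra.
  have [||r2 r20 r2P] := @fin_radius R (T * T)%type (fun p rho =>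
      forall t, e p.1 p.2 -> p.1 != a -> p.2 != a -> p.1 != v -> p.2 != v ->
       0 <= t <= 1 -> rho < `|g p.1 p.2 t - pos v|).
  - by move=> u r r' _ rr H *; apply: le_lt_trans rr _; exact: H.
  - move=> [x y] /=; have [xy|] := boolP (e x y); last by exists 1.
    have [xv|xv] := eqVneq x v; first by exists 1.
    have [yv|yv] := eqVneq y v; first by exists 1.
    have [|r ? rP] := @point_dist R W (g x y) (pos v) (pd_cont dr xy).
      by move=> t; apply: (pd_miss dr xy vV); rewrite eq_sym.
    by exists r => // t *; exact: rP.
  exists (Num.min r1 r2); first by rewrite lt_min r10.
  split=> [u uV ua uv|x y t xy xa ya xv yv t01].
    by rewrite gt_min r1P.
  by rewrite gt_min (r2P (x, y)) // orbT.
(* After time [ss] the edge is so close to [v] that a point within [2 * r0 < rho / 2] of it lies in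
   the ball about [v]. *)
have [ss [ss0 ss1 ssP]] : exists ss : R, [/\ 0 < ss, ss < 1 &
    forall s, ss <= s -> s <= 1 -> `|ga s - pos v| < rho / 2].
  have [|eta eta0 etaP] := @unif_cont R W ga (rho / 2) gac; first lra.
  exists (1 - Num.min (1 / 2) (eta / 2)).
  have m0 : 0 < Num.min (1 / 2) (eta / 2) by rewrite lt_min; apply/andP; lra.
  have m1 : Num.min (1 / 2) (eta / 2) <= 1 / 2 by rewrite ge_min lexx.
  have m2 : Num.min (1 / 2) (eta / 2) <= eta / 2 by rewrite ge_min lexx orbT.
  split; [lra | lra | move=> s s0 s1].
  rewrite -(pd_1 dr av) -/ga; apply: etaP; try lra.
  by rewrite distrC ger0_norm; lra.
(* Up to time [ss] the edge keeps a distance above [2 * r0] from the other vertices, [v] included,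
   and from the edges not at [a], so balls of smaller radius about its points are admissible. *)
have [r0 r00 [r0rho r0V r0E]] : exists2 r0, 0 < r0 & [/\ 4 * r0 < rho,
    (forall u s, u \in V -> u != a -> 0 <= s <= ss -> 2 * r0 < `|pos u - ga s|) &
    (forall x y s t, e x y -> x != a -> y != a -> 0 <= s <= ss -> 0 <= t <= 1 ->
       2 * r0 < `|g x y t - ga s|)].
  have sub s : 0 <= s <= ss -> 0 <= s <= 1 by move=> ?; lra.
  have gaV s u : 0 <= s <= ss -> u \in V -> u != a -> ga s <> pos u.
    move=> s0 uV ua; have [->|uv] := eqVneq u v; last first.
      by apply: (pd_miss dr av uV) => //; exact: sub.
    have [s1|s1] := leP s 0.
      have -> : s = 0 by lra.
      by rewrite /ga (pd_0 dr av) => /(pd_inj dr aV vV) /eqP; rewrite (negbTE anv).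
    by apply: (pd_avoid dr av vV); rewrite in_itv /=; lra.
  have [||r1 r10 r1P] := @fin_radius R T (fun u r0 => forall s,
      u \in V -> u != a -> 0 <= s <= ss -> 2 * r0 < `|pos u - ga s|).
  - by move=> u r r' _ rr H s *; apply: le_lt_trans (H s _ _ _) => //; lra.
  - move=> u; have [uV|] := boolP (u \in V); last by exists 1.
    have [ua|ua] := eqVneq u a; first by exists 1.
    have [|||||r ? rP] := @curve_dist R W (cst (pos u)) ga 0 ss 0 ss.
    + by move=> x; exact: cvg_cst.
    + exact: gac.
    + lra.
    + lra.
    + by move=> s t _ t0 /esym; exact: gaV.
    by exists (r / 2) => [|s _ _ s0]; [lra | have := rP s s s0 s0; lra].
  have [||r2 r20 r2P] := @fin_radius R (T * T)%type (fun p r0 => forall s t,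
      e p.1 p.2 -> p.1 != a -> p.2 != a -> 0 <= s <= ss -> 0 <= t <= 1 ->
       2 * r0 < `|g p.1 p.2 t - ga s|).
  - by move=> u r r' _ rr H s t *; apply: le_lt_trans (H s t _ _ _ _ _) => //; lra.
  - move=> [x y] /=; have [xy|] := boolP (e x y); last by exists 1.
    have [xa|xa] := eqVneq x a; first by exists 1.
    have [ya|ya] := eqVneq y a; first by exists 1.
    have [|||r ? rP] := @curve_dist R W (g x y) ga 0 1 0 ss (pd_cont dr xy) gac.
    + lra.
    + lra.
    + move=> t s t01 s0; have [t1|t1] := leP t 0.
        have -> : t = 0 by lra.
        by rewrite (pd_0 dr xy) => /esym; apply: gaV => //; exact: (pd_dom dr xy).
      have [t2|t2] := leP 1 t.
        have -> : t = 1 by lra.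
        by rewrite (pd_1 dr xy) => /esym; apply: gaV => //; exact: (pd_dom2 dr xy).
      have [s1|s1] := leP s 0.
        have -> : s = 0 by lra.
        by rewrite /ga (pd_0 dr av); apply: (pd_miss dr xy aV); rewrite // eq_sym.
      apply: (pd_disj dr xy av); rewrite ?in_itv /=; try lra.
      apply/eqP => /setP /(_ a); rewrite !inE eqxx /=.
      by rewrite eq_sym (negbTE xa) eq_sym (negbTE ya).
    exists (r / 2) => [|s t _ _ _ s0 t0]; first lra.
    by have := rP t s t0 s0; lra.
  exists (Num.min (rho / 5) (Num.min r1 r2)).
    by rewrite !lt_min r10 r20 andbT; lra.
  have m1 : Num.min (rho / 5) (Num.min r1 r2) <= rho / 5 by rewrite ge_min lexx.
  have m2 : Num.min (rho / 5) (Num.min r1 r2) <= r1 by rewrite !ge_min lexx orbT.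
  have m3 : Num.min (rho / 5) (Num.min r1 r2) <= r2 by rewrite !ge_min lexx !orbT.
  split; first lra.
    by move=> u s uV ua s0; have := r1P u s uV ua s0; lra.
  by move=> x y s t xy xa ya s0 t0; have := r2P (x, y) s t xy xa ya s0 t0; lra.
have [eta eta0 etaP] := @unif_cont R W ga r0 gac r00.
(* State of the slide: the current edge runs straight from the moved [a] to [ga q] and then follows
   the original edge; nothing away from [a] has changed. *)
pose Inv (q : R) := exists pos' g', [/\ pdraw V e pos' g',
   forall x, x != a -> pos' x = pos x,
   forall x y, x != a -> y != a -> g' x y = g x y,
   g' a v = glue (pos' a) ga q &
   `|pos' a - ga q| < 2 * r0 /\ 0 < q < 1].
have step pos' g' c (r : R) : pdraw V e pos' g' ->
    (forall x, x != a -> pos' x = pos x) ->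
    (forall x y, x != a -> y != a -> g' x y = g x y) ->
    (exists2 s, 0 <= s <= ss & c = ga s) ->
    `|pos' a - c| < r -> r < 2 * r0 ->
  exists pos'' g'' tau, [/\ pdraw V e pos'' g'',
    (forall x, x != a -> pos'' x = pos x) /\
    (forall x y, x != a -> y != a -> g'' x y = g x y),
    pos'' a = c, (tau \in `]0, 1[) /\ (`|g' a v tau - c| = r) &
    g'' a v = glue c (g' a v) tau].
  move=> dr' posE gE [s s0 ->] ain rr.
  have [||g'' [dr'' g''E g''a]] := @move_vertex V e pos' g' a (ga s) r dr' aV ain.
  - by move=> u uV ua; rewrite posE //; apply: lt_trans rr _; exact: r0V.
  - by move=> x y t xy xa ya t0; rewrite gE //; apply: lt_trans rr _; exact: r0E.
  have [tau [tau01 taur E]] := g''a v av.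
  exists (fun x => if x == a then ga s else pos' x), g'', tau; split => //.
  - split=> [x xa|x y xa ya]; first by rewrite (negbTE xa) posE.
    by rewrite g''E // gE.
  - by rewrite eqxx.
have base : exists q, Inv q.
  have [|||pos' [g' [tau [dr' [posE gE] posa [tau01 taur] E]]]] :=
      step pos g (ga 0) r0 dr (fun x _ => erefl) (fun x y _ _ => erefl).
  - by exists 0 => //; lra.
  - by rewrite /ga (pd_0 dr av) subrr normr0.
  - lra.
  exists tau, pos', g'; split => //; first by rewrite posa.
  rewrite posa distrC taur; split; first lra.
  by move: tau01; rewrite in_itv.
have next q : Inv q -> q <= ss -> exists2 q', Inv q' & q + eta <= q'.
  move=> [pos' [g' [dr' posE gE g'av [pa /andP[q0 q1]]]]] qs.
  (* The mean lies strictly between the distance of [a] from the new centre and [2 * r0], as the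
     move requires. It is also at least [r0], which makes every step advance by [eta]. *)
  pose r := (`|pos' a - ga q| + 2 * r0) / 2.
  have [|||pos'' [g'' [tau [dr'' [posE' gE'] posa [tau01 taur] E]]]] :=
      step pos' g' (ga q) r dr' posE gE.
  - by exists q => //; lra.
  - by rewrite /r; lra.
  - by rewrite /r; lra.
  move: tau01; rewrite in_itv /= => /andP[tau0 tau1].
  (* On the straight part the distance from [ga q] is at most that of [a], hence below [r]; so the
     exit lies on the original edge, beyond [q]. *)
  have tau2 : 1 / 2 < tau.
    rewrite ltNge; apply/negP => tau2; move: taur; rewrite g'av glue_lo //.
    have -> : pos' a + (2 * tau) *: (ga q - pos' a) - ga q =
              (1 - 2 * tau) *: (pos' a - ga q).
      by rewrite scalerBl scale1r -[X in _ = _ - X]opprK -scalerN opprB opprK addrAC.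
    rewrite normrZ ger0_norm; last lra.
    have := normr_ge0 (pos' a - ga q); rewrite /r; nra.
  pose q' := q + (2 * tau - 1) * (1 - q).
  have tauE : glue (pos' a) ga q tau = ga q' by rewrite glue_hi // ltW.
  have q'q : q < q' by rewrite /q'; nra.
  have q'1 : q' < 1 by rewrite /q'; nra.
  move: taur; rewrite g'av tauE => taur.
  exists q'; last first.
    rewrite leNgt; apply/negP => qq.
    have := etaP q' q; rewrite taur ger0_norm; last lra.
    have := normr_ge0 (pos' a - ga q).
    have -> : r < r0 = false by apply/negbTE; rewrite -leNgt /r; have := normr_ge0 (pos' a - ga q); lra.
    by move=> _ H; suff: false by []; apply: H; lra.
  exists pos'', g''; split => //.
    rewrite E posa g'av; apply/funext => t; have [t2|t2] := leP t (1 / 2).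
      by rewrite (glue_lo _ _ _ t2) tauE (glue_lo _ _ _ t2).
    rewrite (glue_hi _ _ _ (ltW t2)) (glue_hi _ _ _ (ltW t2)) glue_hi; last nra.
    by congr ga; rewrite /q'; ring.
  rewrite posa distrC taur; split; last lra.
  by rewrite /r; lra.
have far n : exists2 q, Inv q & (ss < q) \/ (n%:R * eta <= q).
  elim: n => [|n [q Iq [sq|nq]]].
  - by have [q Iq] := base; exists q => //; right; rewrite mul0r; case: Iq => ? [? [_ _ _ _ [_ /andP[/ltW]]]].
  - by exists q => //; left.
  - have [qs|sq] := leP q ss; last by exists q => //; left.
    have [q' Iq' qq'] := next q Iq qs; exists q' => //; right.
    by rewrite -natr1 mulrDl mul1r; lra.
have [n nP] : exists n : nat, 1 <= n%:R * eta.
  exists (Num.bound eta^-1); rewrite -ler_pdivrMr // div1r ltW //.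
  by apply: le_lt_trans (archi_boundP _); [exact: lexx | rewrite invr_ge0 ltW].
have [q Iq sq] := far n.
have {}sq : ss < q.
  case: sq => // nq; case: Iq => ? [? [_ _ _ _ [_ /andP[_ q1]]]]; lra.
case: Iq => pos' [g' [dr' posE gE _ [pa /andP[q0 q1]]]].
have va : v != a by rewrite eq_sym.
have [|||||g'' [dr'' _ _]] :=
    @hub_draw R W T V e pos' g' [set a; v] a (pos v) rho dr'.
- by rewrite !inE eqxx.
- by apply/fintype.subsetP => x; rewrite !inE => /orP[] /eqP->.
- move=> x; rewrite !inE => /orP[] /eqP->; last by rewrite posE // subrr normr0.
  have := ler_distD (ga q) (pos' a) (pos v).
  by have := ssP q (ltW sq) (ltW q1); lra.
- move=> x xV; rewrite !inE negb_or => /andP[xa xv]; rewrite posE //.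
  exact: rhoV.
- move=> x y t xy; rewrite !finset.in_set2 !negb_or => /andP[xa xv] /andP[ya yv].
  by rewrite in_itv gE //; exact: rhoE.
have VE : V :\: ([set a; v] :\ a) = V :\ v.
  apply/setP => x; rewrite !inE; case: (eqVneq x v) => [->|xv] /=.
    by rewrite va orbT.
  by case: (x == a).
by exists (fun x => if x == a then pos v else pos' x), g''; rewrite -VE.
Qed.

End Contract.

(** * Planarity of relations *)

Definition rplanar (R : realType) (T : finType) (V : {set T}) (e : rel T) :=
  exists (pos : T -> R * R) (g : T -> T -> R -> R * R), pdraw V e pos g.

Section RelPlanar.
Variable R : realType.

(** Pulling a drawing back along [f] covers subgraphs, renamings and restrictions to part of the
    vertices alike. *)
Lemma rplanar_map (T T' : finType) (f : T' -> T) (V : {set T}) (V' : {set T'})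
    (e : rel T) (e' : rel T') :
  {in V' &, injective f} -> (forall x, x \in V' -> f x \in V) ->
  symmetric e' -> (forall x y, e' x y -> x \in V') ->
  (forall x y, e' x y -> e (f x) (f y)) ->
  rplanar R V e -> rplanar R V' e'.
Proof.
move=> finj fV sym' dom' ee' [pos [g dr]].
exists (pos \o f), (fun x y => g (f x) (f y)); split => //=.
- by move=> x; apply/negP => /ee'; rewrite (pd_irr dr).
- move=> x y xV yV /= /(pd_inj dr (fV _ xV) (fV _ yV)); exact: finj.
- by move=> x y /ee'; exact: pd_cont dr _ _.
- by move=> x y t /ee'; exact: (pd_rev dr).
- by move=> x y /ee'; exact: (pd_0 dr).
- by move=> x y /ee'; exact: (pd_arc dr).
- by move=> x y z t /ee' xy /fV zV; exact: (pd_avoid dr xy).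
- move=> x y z w s t xy zw ne.
  apply: (pd_disj dr (ee' _ _ xy) (ee' _ _ zw)).
  have [xV zV] := (dom' _ _ xy, dom' _ _ zw).
  have yV : y \in V' by apply: (dom' y x); rewrite sym'.
  have wV : w \in V' by apply: (dom' w z); rewrite sym'.
  have fE p q : p \in V' -> q \in V' -> (f p == f q) = (p == q).
    by move=> pV qV; apply/eqP/eqP => [/finj->|->].
  apply: contraNneq ne => /setP E.
  have := (E (f x), E (f y), E (f z), E (f w)).
  rewrite !inE !eqxx ?orbT /= !fE // => -[[[H1 H2] H3] H4].
  by rewrite finset.eqEsubset !finset.subUset !finset.sub1set !inE -H1 -H2 H3 H4.
Qed.

Lemma rplanar_sub (T : finType) (V : {set T}) (e e' : rel T) :
  symmetric e' -> (forall x y, e' x y -> e x y) ->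
  rplanar R V e -> rplanar R V e'.
Proof.
move=> sym' sub pl; have [pos [g dr]] := pl.
by apply: (@rplanar_map T T id V V e e') => // x y /sub /(pd_dom dr).
Qed.

Lemma rplanar_contract (T : finType) (V : {set T}) (e : rel T) a v :
  rplanar R V e -> e a v -> rplanar R (V :\ v) (hub_rel e [set a; v] a).
Proof. by move=> [pos [g dr]] av; exact: contract_draw dr av. Qed.

(** A retraction of the line onto [0, 1] compatible with reversal; composing with it makes a curve
    that is continuous within [0, 1] continuous everywhere. *)
Let clamp (t : R) := Num.max 0 (Num.min t 1).

Let clamp_id t : 0 <= t <= 1 -> clamp t = t.
Proof. by move=> /andP[t0 t1]; rewrite /clamp min_l // max_r. Qed.

Let clamp01 t : 0 <= clamp t <= 1.
Proof. by rewrite /clamp le_max lexx /= ge_max ler01 ge_min lexx orbT. Qed.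

Let clampB t : clamp (1 - t) = 1 - clamp t.
Proof.
have lo s : s <= 0 -> clamp s = 0.
  by move=> s0; rewrite /clamp min_l ?max_l //; lra.
have hi s : 1 <= s -> clamp s = 1.
  by move=> s1; rewrite /clamp min_r ?max_r //; lra.
have [t0|t0] := leP t 0; first by rewrite (lo t) // hi; lra.
have [t1|t1] := leP 1 t; first by rewrite (hi t) // lo; lra.
by rewrite !clamp_id //; lra.
Qed.

Let clamp_cont : continuous clamp.
Proof.
move=> t; apply: (@continuous_max R R (cst 0) (fun t => Num.min t 1) t).
  exact: cvg_cst.
by apply: (@continuous_min R R id (cst 1) t); [exact: cvg_id | exact: cvg_cst].
Qed.

Let clamp_comp (U : topologicalType) (f : R -> U) :
  {within `[0%R, 1%R], continuous f}%classic -> continuous (f \o clamp).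
Proof.
move/subspace_continuousP => fc t.
have c01 : `[0, 1]%classic (clamp t) by rewrite /= in_itv /= clamp01.
apply: (@cvg_comp _ _ _ clamp f _ _ _ _ (fc _ c01)) => B BW.
apply: (@filterS _ (nbhs t) _ _ _ _ (clamp_cont BW)) => s; apply.
suff : clamp s \in `[0, 1] by [].
by rewrite in_itv; exact: clamp01.
Qed.

Lemma planar_rplanar (T : finType) (G : sgraph T) :
  planar R G -> rplanar R [set: T] (adj G).
Proof.
move=> [pos [c [pinj ccont cinj cends cav cdisj]]].
have irr x : adj G x x = false.
  apply/negP => xx; have /forallP/(_ [set x; x]) := edges_card2 G.
  by rewrite [_ \in _]xx /= finset.setUid cards1.
have sym : symmetric (adj G) by move=> x y; rewrite /adj finset.setUC.
(* [plane_drawing] gives one curve for both directions; it is run forwards or backwards according to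
   the end at which it starts. *)
pose g x y t := if c [set x; y] 0 == pos x then c [set x; y] (clamp t)
                else c [set x; y] (1 - clamp t).
have ends x y : adj G x y ->
   (c [set x; y] 0 = pos x /\ c [set x; y] 1 = pos y) \/
   (c [set x; y] 0 = pos y /\ c [set x; y] 1 = pos x).
  move=> xy; have [z [w [E c0 c1]]] := cends _ xy.
  have := (set21 x y, set22 x y); rewrite {1 2}E !inE c0 c1.
  have nxy : x != y by apply: contraTneq xy => ->; rewrite irr.
  move=> [/orP[]/eqP Ex /orP[]/eqP Ey]; rewrite -?Ex -?Ey; [|by left|by right|].
    by rewrite Ex Ey eqxx in nxy.
  by rewrite Ex Ey eqxx in nxy.
have neq x y : adj G x y -> (pos y == pos x) = false.
  by move=> xy; apply/negP => /eqP/pinj E; rewrite E irr in xy.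
exists pos, g; split => //.
- by move=> x y _ _; exact: pinj.
- move=> x y xy; rewrite /g; case: (c [set x; y] 0 == pos x).
    exact: (clamp_comp (ccont _ xy)).
  move=> t; have -> : (fun t => c [set x; y] (1 - clamp t)) =
      (c [set x; y] \o clamp) \o (fun t => 1 - t).
    by apply/funext => s /=; rewrite clampB.
  apply: continuous_comp; last exact: (clamp_comp (ccont _ xy)).
  by apply: cvgB; [exact: cvg_cst | exact: cvg_id].
- move=> x y t xy; rewrite /g finset.setUC clampB subKr.
  by case: (ends _ _ xy) => -[-> _]; rewrite eqxx ?(eq_sym (pos x) (pos y)) neq.
- move=> x y xy; rewrite /g clamp_id ?lexx ?ler01 // subr0.
  by case: (ends _ _ xy) => -[-> ->]; rewrite ?eqxx ?neq.
- move=> x y xy t t' t01 t01'; rewrite /g.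
  move: (t01) (t01'); rewrite !in_itv /= => a0 a1; rewrite !clamp_id //.
  case: ifP => _; first exact: cinj.
  move=> /cinj E; suff: 1 - t = 1 - t' by lra.
  by apply: E => //; rewrite in_itv /=; lra.
- move=> x y z t xy _; rewrite in_itv /= => t01; rewrite /g clamp_id; last lra.
  by case: ifP => _; apply: cav => //; rewrite in_itv /=; lra.
- move=> x y z w s t xy zw ne; rewrite !in_itv /= => s01 t01.
  have s01' : 0 <= s <= 1 by lra.
  have t01' : 0 <= t <= 1 by lra.
  rewrite /g !clamp_id //.
  by case: ifP => _; case: ifP => _; apply: cdisj => //; rewrite in_itv /=; lra.
Qed.

Lemma rplanar_planar (T : finType) (G : sgraph T) :
  rplanar R [set: T] (adj G) -> planar R G.
Proof.
move=> [pos [g dr]].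
pose xy (E : {set T}) : option (T * T) := [pick p | E == [set p.1; p.2]].
have xyP E : E \in edges G ->
  exists x y, [/\ xy E = Some (x, y), E = [set x; y] & adj G x y].
  move=> EG; rewrite /xy; case: pickP => [[x y] /= /eqP E2|no].
    by exists x, y; split => //; rewrite /adj -E2.
  have /forallP/(_ E) := edges_card2 G; rewrite EG /=.
  move/cards2P => [x [y [_ E2]]].
  by have := no (x, y); rewrite /= E2 eqxx.
pose c E := if xy E is Some p then g p.1 p.2 else (fun=> 0).
exists pos, c; split.
- by move=> x y; apply: (pd_inj dr); rewrite !inE.
- move=> E /xyP[x [y [eE _ a]]]; rewrite /c eE /=.
  by apply: continuous_subspaceT; exact: (pd_cont dr a).
- by move=> E /xyP[x [y [eE _ a]]]; rewrite /c eE /=; exact: (pd_arc dr a).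
- move=> E /xyP[x [y [eE E2 a]]]; exists x, y; rewrite /c eE /= E2.
  by rewrite (pd_0 dr a) (pd_1 dr a).
- move=> E /xyP[x [y [eE _ a]]] t z t01; rewrite /c eE /=.
  by apply: (pd_avoid dr a) => //; rewrite inE.
- move=> E E' /xyP[x [y [eE E2 a]]] /xyP[x' [y' [eE' E2' a']]] ne s t.
  by rewrite /c eE eE' /=; apply: (pd_disj dr a a'); rewrite -E2 -E2'.
Qed.

Lemma pdraw_bounded (T : finType) (V : {set T}) (e : rel T) pos
    (g : T -> T -> R -> R * R) : pdraw V e pos g ->
  exists2 M, 0 < M & (forall x, `|pos x| <= M) /\
    (forall x y t, e x y -> 0 <= t <= 1 -> `|g x y t| <= M).
Proof.
move=> dr.
have bnd (I : finType) (P : I -> R -> Prop) :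
    (forall i r r', r <= r' -> P i r -> P i r') ->
    (forall i, exists r, P i r) -> exists r, forall i, P i r.
  move=> mono /choice[f fP]; exists (\big[Num.max/0]_i f i) => i.
  by apply: mono (fP i); exact: le_bigmax.
have [M2 M2P] : exists M, forall p : T * T, forall t, e p.1 p.2 ->
    0 <= t <= 1 -> `|g p.1 p.2 t| <= M.
  apply: bnd => [p r r' rr H t ? ?|[x y] /=].
    by apply: le_trans rr; exact: H.
  have [xy|] := boolP (e x y); last by exists 0.
  have [||t _ tP] := @EVT_max R (fun t => `|g x y t|) 0 1; first exact: ler01.
    apply: continuous_subspaceT => t.
    by apply: (@cvg_norm _ _ _ _ _ (g x y)); exact: (pd_cont dr xy).
  by exists `|g x y t| => s _ s01; apply: tP; rewrite in_itv.
have [M1 M1P] : exists M, forall x : T, `|pos x| <= M.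
  by apply: bnd => [x r r' rr H|x]; [exact: le_trans rr | exists `|pos x|].
exists (Num.max 1 (Num.max M1 M2)); first by rewrite lt_max ltr01.
split=> [x|x y t xy t01]; first by rewrite !le_max M1P orbT.
by rewrite !le_max (M2P (x, y)) // !orbT.
Qed.

(** Both drawings are bounded, so translating the second by a vector longer than the sum of the
    bounds separates them. *)
Lemma rplanar_union (T : finType) (V V' : {set T}) (e e' : rel T) :
  [disjoint V & V'] -> rplanar R V e -> rplanar R V' e' ->
  rplanar R (V :|: V') (fun x y => e x y || e' x y).
Proof.
move=> dis [pos [g dr]] [pos' [g' dr']].
have [M M0 [Mp Mg]] := pdraw_bounded dr.
have [M' M0' [Mp' Mg']] := pdraw_bounded dr'.
pose w : R * R := (M + M' + 1, 0).
have nw : `|w| = M + M' + 1.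
  by rewrite prod_normE /= normr0 max_l ?normr_ge0 // ger0_norm //; lra.
have far (p q : R * R) : `|p| <= M -> `|q| <= M' -> p <> q + w.
  move=> pM qM E; have : `|w| <= `|p| + `|q|.
    by rewrite -(normrN q); apply: le_trans (ler_normD _ _); rewrite E addrAC subrr add0r.
  by rewrite nw; lra.
have nV' x : x \in V -> x \in V' = false.
  by move=> xV; exact: (disjointFr dis xV).
have nV x : x \in V' -> x \in V = false.
  by move=> xV; exact: (disjointFl dis xV).
have eV x y : e x y -> (x \in V) * (y \in V).
  by move=> xy; split; [exact: (pd_dom dr xy) | exact: (pd_dom2 dr xy)].
have eV' x y : e' x y -> (x \in V') * (y \in V').
  by move=> xy; split; [exact: (pd_dom dr' xy) | exact: (pd_dom2 dr' xy)].
pose P x := if x \in V then pos x else pos' x + w.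
pose Q x y t := if x \in V then g x y t else g' x y t + w.
have QE x y t : e x y -> Q x y t = g x y t by move=> xy; rewrite /Q (eV _ _ xy).
have QE' x y t : e' x y -> Q x y t = g' x y t + w.
  by move=> xy; rewrite /Q nV // (eV' _ _ xy).
have o01 (t : R) : t \in `]0, 1[ -> 0 <= t <= 1 by rewrite in_itv /=; lra.
exists P, Q; split.
- by move=> x y; rewrite (pd_sym dr) (pd_sym dr').
- by move=> x; rewrite (pd_irr dr) (pd_irr dr').
- by move=> x y /orP[/eV|/eV'] H; rewrite inE !H ?orbT.
- move=> x y; rewrite !inE /P.
  case: (boolP (x \in V)) => xV /=; case: (boolP (y \in V)) => yV /= xV' yV'.
  + exact: (pd_inj dr).
  + by move=> /far [] //.
  + by move=> /esym /far [] //.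
  + by move=> /addIr; exact: (pd_inj dr').
- move=> x y /orP[xy|xy].
    have -> : Q x y = g x y by apply/funext => t; exact: QE.
    exact: (pd_cont dr xy).
  have -> : Q x y = (fun t => g' x y t + w) by apply/funext => t; exact: QE'.
  by move=> t; apply: cvgD; [exact: (pd_cont dr' xy) | exact: cvg_cst].
- move=> x y t /orP[xy|xy].
    by rewrite (QE _ _ _ xy) QE ?(pd_rev dr _ xy) // (pd_sym dr).
  by rewrite (QE' _ _ _ xy) QE' ?(pd_rev dr' _ xy) // (pd_sym dr').
- move=> x y /orP[xy|xy].
    by rewrite QE // (pd_0 dr xy) /P (eV _ _ xy).
  by rewrite QE' // (pd_0 dr' xy) /P nV // (eV' _ _ xy).
- move=> x y /orP[xy|xy] s t s01 t01.
    by rewrite !QE //; exact: (pd_arc dr xy).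
  by rewrite !QE' // => /addIr; exact: (pd_arc dr' xy).
- move=> x y z t /orP[xy|xy] + t01; rewrite inE /P.
  + rewrite QE //; case: ifP => [zV _|_ /= zV]; first exact: (pd_avoid dr xy).
    by apply: far => //; apply: Mg => //; exact: o01.
  + rewrite QE' //; case: ifP => [zV _ /esym|_ /= zV /addIr].
      by apply: far => //; apply: Mg' => //; exact: o01.
    exact: (pd_avoid dr' xy).
- move=> x y z u s t /orP[xy|xy] /orP[zu|zu] ne s01 t01.
  + by rewrite !QE //; exact: (pd_disj dr xy zu).
  + rewrite QE // QE' //.
    by apply: far; [apply: Mg | apply: Mg'] => //; exact: o01.
  + rewrite QE' // QE // => /esym.
    by apply: far; [apply: Mg | apply: Mg'] => //; exact: o01.
  + by rewrite !QE' // => /addIr; exact: (pd_disj dr' xy zu).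
Qed.

Lemma rplanar_discrete (T : finType) (V : {set T}) :
  rplanar R V (fun _ _ => false).
Proof.
exists (fun x => ((enum_rank x)%:R, 0)), (fun _ _ _ => 0); split => //.
by move=> x y _ _ [] /eqP; rewrite eqr_nat => /eqP/ord_inj/enum_rank_inj.
Qed.

(** The vertices missing from [V] carry no edges; they are added far away, as a disjoint union with
    a discrete graph. *)
Lemma rplanar_dom (T : finType) (V V' : {set T}) (e : rel T) :
  (forall x y, e x y -> x \in V') -> rplanar R V e -> rplanar R V' e.
Proof.
move=> dom pl; have [pos [g dr]] := pl.
have dis : [disjoint V & ~: V].
  by rewrite -setI_eq0 finset.setICr.
have := rplanar_union dis pl (rplanar_discrete (~: V)).
apply: (@rplanar_map T T id) => //; first by move=> x; rewrite !inE orbN.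
  exact: (pd_sym dr).
by move=> x y ->.
Qed.

End RelPlanar.

Lemma connect_map (T T' : finType) (r : rel T) (r' : rel T') (f : T -> T') x y :
  (forall u w, r u w -> connect r' (f u) (f w)) ->
  connect r x y -> connect r' (f x) (f y).
Proof.
move=> fr /connectP[p]; elim: p x => [|z p IH] x /=; first by move=> _ ->.
by move=> /andP[xz zp] yE; apply: connect_trans (fr _ _ xz) (IH _ zp yE).
Qed.

Lemma connect_closed (T : finType) (r : rel T) (P : pred T) x y :
  (forall u w, r u w -> P u -> P w) -> connect r x y -> P x -> P y.
Proof.
move=> H /connectP[p]; elim: p x => [|z p IH] x /=; first by move=> _ ->.
by move=> /andP[xz zp] yE Px; apply: IH zp yE _; exact: H xz Px.
Qed.

(** [lam] names the branch set of a vertex, and [None] marks deleted vertices. By induction on the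
    number of labelled vertices an edge inside a branch set is contracted; when there is none,
    branch sets are single vertices and a subgraph remains. *)
Lemma rplanar_minor (R : realType) (T T' : finType) (lam : T -> option T')
    (V : {set T}) (e : rel T) (V' : {set T'}) (e' : rel T') :
  symmetric e' -> irreflexive e' -> (forall x y, e' x y -> x \in V') ->
  (forall x, lam x -> x \in V) ->
  (forall y, y \in V' -> exists x, lam x = Some y) ->
  (forall x y, lam x -> lam x = lam y ->
    connect (fun u w => e u w && (lam u == lam w)) x y) ->
  (forall y z, e' y z -> exists x w,
    [/\ e x w, lam x = Some y & lam w = Some z]) ->
  rplanar R V e -> rplanar R V' e'.
Proof.
move=> sym' irr' dom'; move: {2}_.+1 (ltnSn #|[set x | lam x]|) => n.
elim: n => // n IH in lam V e *; rewrite ltnS => ln lamV lamS lamC lamE pl.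
have [pos [g dr]] := pl.
have [[a v] /= /and3P[av /eqP lav la]|no] :=
    pickP (fun p : T * T => [&& e p.1 p.2, lam p.1 == lam p.2 & lam p.1]).
  have anv : a != v by apply: contraTneq av => ->; rewrite (pd_irr dr).
  pose lam' x := if x == v then None else lam x.
  pose p x := if x == v then a else x.
  have lamp x : lam' (p x) = lam x.
    rewrite /lam' /p; case: (eqVneq x v) => [->|/negbTE->] //.
    by rewrite (negbTE anv).
  have pH x w : e x w -> (p x == p w) || hub_rel e [set a; v] a (p x) (p w).
    move=> xw; have [//|pxw] := eqVneq (p x) (p w); rewrite /hub_rel /= !inE.
    have pS x1 : (x1 \in [set a; v]) = (p x1 == a).
      by rewrite !inE /p; case: (eqVneq x1 v) => [->|]; rewrite ?eqxx ?orbT ?orbF.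
    have pn x1 : p x1 != a -> p x1 = x1.
      by rewrite /p; case: (eqVneq x1 v) => //; rewrite eqxx.
    have pnv x1 : p x1 != v.
      by rewrite /p; case: (eqVneq x1 v).
    have [xa|xa] := eqVneq (p x) a.
      have wa : p w != a by rewrite -xa eq_sym.
      rewrite (negbTE wa) (negbTE (pnv w)) /=; apply/existsP; exists x.
      by rewrite pS xa eqxx /= (pn w wa).
    have [wa|wa] := eqVneq (p w) a.
      rewrite (negbTE (pnv x)) /=; apply/existsP; exists w.
      by rewrite pS wa eqxx /= (pn x xa) (pd_sym dr).
    by rewrite (negbTE (pnv x)) (negbTE (pnv w)) /= (pn x xa) (pn w wa).
  apply: (IH lam' _ _ _ _ _ _ _ (rplanar_contract pl av)).
  - apply: leq_trans ln; apply: proper_card; apply/properP; split.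
      apply/fintype.subsetP => x; rewrite !inE /lam'.
      by case: (eqVneq x v).
    by exists v; rewrite !inE /lam' ?eqxx // -lav.
  - move=> x; rewrite !inE /lam'; case: (eqVneq x v) => // _ /=; exact: lamV.
  - by move=> y /lamS[x xy]; exists (p x); rewrite lamp.
  - move=> x y; rewrite /lam'; case: (eqVneq x v) => // xv; case: (eqVneq y v) => yv.
      by move=> lx E; rewrite E in lx.
    move=> lx lxy; have := lamC _ _ lx lxy.
    have px : p x = x by rewrite /p (negbTE xv).
    have py : p y = y by rewrite /p (negbTE yv).
    rewrite -{2}px -{2}py.
    apply: connect_map => u w /andP[uw /eqP luw].
    have /orP[/eqP->|H] := pH _ _ uw; first exact: connect0.
    by apply: connect1; rewrite H -!/(lam' _) !lamp luw eqxx.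
  - move=> y z yz; have [x [w [xw lx lw]]] := lamE _ _ yz.
    exists (p x), (p w); rewrite !lamp; split => //.
    have /orP[/eqP E|//] := pH _ _ xw.
    have := lamp x; rewrite E lamp lx lw => -[zy].
    by rewrite zy irr' in yz.
have inj x y : lam x -> lam x = lam y -> x = y.
  move=> lx lxy; have /connectP[[|z q] /=] := lamC _ _ lx lxy; first by [].
  by move=> /andP[/andP[xz xz'] _]; have := no (x, z); rewrite /= xz xz' lx.
have [t0 _|noT] := pickP (fun _ : T => true); last first.
  apply: (@rplanar_sub _ _ _ (fun _ _ => false)) => // [x y xy|].
    by have [t _] := lamS _ (dom' _ _ xy); have := noT t.
  exact: rplanar_discrete.
pose f y := odflt t0 [pick x | lam x == Some y].
have fP y : y \in V' -> lam (f y) = Some y.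
  move=> /lamS[x xy]; rewrite /f; case: pickP => [x' /eqP //|/(_ x)].
  by rewrite xy eqxx.
apply: (@rplanar_map _ _ _ f V V' e e') => //.
- by move=> x y /fP fx /fP fy E; move: fx; rewrite E fy => -[].
- by move=> x /fP fx; apply: lamV; rewrite fx.
- move=> y z yz; have [x [w [xw lx lw]]] := lamE _ _ yz.
  have yV := dom' _ _ yz; have zV : z \in V' by apply: (dom' z y); rewrite sym'.
  have -> : f y = x by apply: inj; rewrite (fP y yV) ?lx.
  by have -> : f z = w by apply: inj; rewrite (fP z zV) ?lw.
Qed.

(** * From drawings to grids *)

Definition near_nat (i j : nat) := (i <= j.+1)%N && (j <= i.+1)%N.

(** The grid with exactly one diagonal in each unit square, joining the two points whose coordinates
    have equal parity. On a doubled grid these diagonals join the centres of the old squares to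
    their corners. *)
Definition king (M : nat) : rel ('I_M * 'I_M) := fun p q =>
  [&& p != q, near_nat p.1 q.1, near_nat p.2 q.2 &
      (p.1 != q.1) && (p.2 != q.2) ==> (odd p.1 == odd p.2)].

Lemma unordered (a c a' c' : nat) : minn a c = minn a' c' ->
  maxn a c = maxn a' c' -> (a = a' /\ c = c') \/ (a = c' /\ c = a').
Proof. lia. Qed.

Lemma king_parity n (b d : 'I_n) : near_nat b d -> b != d -> odd b <> odd d.
Proof.
rewrite /near_nat -val_eqE /= => /andP[bd db] ne.
have [->|->] : b = d.+1 :> nat \/ d = b.+1 :> nat by lia.
  by rewrite oddS; case: (odd d).
by rewrite oddS; case: (odd b).
Qed.

Section King.
Variable R : realType.

Let co (i j : nat) (t : R) : R := i%:R + t * (j%:R - i%:R).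

(** Along an edge a coordinate is either a constant lattice value or strictly between two
    consecutive ones, so an inner point determines the unordered pair of end values. *)
Let coE i j i' j' (s t : R) : near_nat i j -> near_nat i' j' ->
  0 < s < 1 -> 0 < t < 1 -> co i j s = co i' j' t ->
  (minn i j = minn i' j') /\ (maxn i j = maxn i' j').
Proof.
have bnd a b (u : R) : near_nat a b -> 0 < u < 1 ->
    (a = b /\ co a b u = (minn a b)%:R) \/
    (maxn a b = (minn a b).+1 /\
     ((minn a b)%:R < co a b u) && (co a b u < (minn a b).+1%:R)).
  rewrite /near_nat /co => /andP[ab ba] u01.
  case: (ltngtP a b) => [lt|lt|<-].
  - right; have -> : b = a.+1 by lia.
    by split; [lia | rewrite -natr1; nra].
  - right; have -> : a = b.+1 by lia.
    by split; [lia | rewrite -natr1; nra].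
  - by left; rewrite subrr mulr0 addr0; split => //; congr (_ %:R); lia.
move=> n n' s01 t01 E.
case: (bnd _ _ _ n s01) => [[e1 E1]|[e1 /andP[l1 u1]]];
case: (bnd _ _ _ n' t01) => [[e2 E2]|[e2 /andP[l2 u2]]].
- by move: E; rewrite E1 E2 => /eqP; rewrite eqr_nat => /eqP; lia.
- by move: l2 u2; rewrite -E E1 !ltr_nat; lia.
- by move: l1 u1; rewrite E E2 !ltr_nat; lia.
- have := lt_trans l1; rewrite E => /(_ _ u2); rewrite ltr_nat => a1.
  have := lt_trans l2; rewrite -E => /(_ _ u1); rewrite ltr_nat => a2.
  lia.
Qed.

Lemma king_planar M : rplanar R [set: 'I_M * 'I_M] (@king M).
Proof.
exists (fun p : 'I_M * 'I_M => (p.1%:R, p.2%:R)),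
  (fun (p q : 'I_M * 'I_M) t => (co p.1 q.1 t, co p.2 q.2 t)).
have cont (a b : R) : continuous (fun t : R => a + t * b).
  move=> t; apply: cvgD; first exact: cvg_cst.
  by apply: cvgM; [exact: cvg_id | exact: cvg_cst].
have near_sym i j : near_nat i j = near_nat j i by rewrite /near_nat andbC.
split.
- suff H (p q : 'I_M * 'I_M) : king p q -> king q p by move=> p q; apply/idP/idP; exact: H.
  rewrite /king => /and4P[ne n1 n2 d]; apply/and4P; split.
  - by rewrite eq_sym.
  - by rewrite near_sym.
  - by rewrite near_sym.
  apply/implyP => /andP[d1 d2]; move: n1 n2 d.
  rewrite (eq_sym p.1) d1 (eq_sym p.2) d2 /near_nat /=.
  by move: d1 d2; rewrite -!val_eqE /=; lia.
- by move=> p; rewrite /king eqxx.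
- by move=> p q; rewrite inE.
- move=> [a b] [c d] _ _ [] /eqP; rewrite eqr_nat => /eqP/val_inj -> /eqP.
  by rewrite eqr_nat => /eqP/val_inj ->.
- move=> p q _ t.
  apply: (@cvg_pair _ _ _ (nbhs t) (nbhs (co p.1 q.1 t)) (nbhs (co p.2 q.2 t))
    _ _ _ (co p.1 q.1) (co p.2 q.2)); exact: cont.
- by move=> p q t _; rewrite /co; congr pair; ring.
- by move=> p q _; rewrite /co !mul0r !addr0.
- move=> [a b] [c d]; rewrite /king => /and4P[ne _ _ _] s t _ _ /= [].
  have inj (i j : nat) : i != j -> co i j s = co i j t -> s = t.
    move=> ij /addrI; apply: mulIf; rewrite subr_eq0 eqr_nat eq_sym; exact: ij.
  have [ac|ac] := eqVneq a c; last by move=> + _; exact: inj.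
  have [bd|bd] := eqVneq b d; last by move=> _; exact: inj.
  by rewrite ac bd eqxx in ne.
- move=> [a b] [c d] [z w] t; rewrite /king => /and4P[ne n1 n2 _] _; rewrite in_itv /= => t01 [] E1 E2.
  have nn i : near_nat i i by rewrite /near_nat leqnSn.
  have cc (i : nat) : co i i t = i%:R by rewrite /co subrr mulr0 addr0.
  rewrite -!cc in E1 E2.
  have /= [] := coE n1 (nn z) t01 t01 E1; have /= [] := coE n2 (nn w) t01 t01 E2.
  rewrite !minnn !maxnn => m1 m2 m3 m4.
  move/negP: ne; apply; apply/eqP; congr pair; apply: val_inj => /=; lia.
- move=> [a b] [c d] [a' b'] [c' d'] s t; rewrite /king => /and4P[ne /= n1 n2 p1] /and4P[ne' /= n1' n2' p2].
  move=> /eqP neq; rewrite !in_itv /= => s01 t01 [] E1 E2; apply: neq.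
  have [] := coE n1 n1' s01 t01 E1; have [] := coE n2 n2' s01 t01 E2.
  move=> m1 m2 m3 m4.
  have [[-> ->]|[-> ->]] : ((a, b) = (a', b') /\ (c, d) = (c', d')) \/
         ((a, b) = (c', d') /\ (c, d) = (a', b')); last 2 first.
  - by [].
  - by rewrite finset.setUC.
  have ordE n (i j : 'I_n) : i = j :> nat -> i = j by exact: val_inj.
  (* In each coordinate the two edges have the same ends. In the mixed cases they would be the two
     diagonals of one square, which parity excludes. *)
  have [[/ordE ? /ordE ?]|[/ordE ? /ordE ?]] := unordered m3 m4;
    have [[/ordE ? /ordE ?]|[/ordE ? /ordE ?]] := unordered m1 m2; subst.
  - by left.
  - have [<-|ac] := eqVneq a' c'; first by right.
    have [<-|bd] := eqVneq d' b'; first by left.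
    by case: (king_parity n2 bd); move: p1 p2; rewrite ac bd (eq_sym b') bd /= => /eqP <- /eqP <-.
  - have [<-|ac] := eqVneq c' a'; first by left.
    have [<-|bd] := eqVneq b' d'; first by right.
    by case: (king_parity n1 ac); move: p1 p2; rewrite ac bd (eq_sym a') ac /= => /eqP -> /eqP ->.
  - by right.
Qed.

End King.

(** * Grid models of drawings *)

Definition near1 (i j : nat) := (i == j.+1) || (j == i.+1).

Definition gadj (N : nat) : rel ('I_N * 'I_N) := fun p q =>
  ((p.1 == q.1) && near1 p.2 q.2) || ((p.2 == q.2) && near1 p.1 q.1).

Lemma gadj_sym N : symmetric (@gadj N).
Proof.
by move=> p q; rewrite /gadj /near1 !(eq_sym q.1) !(eq_sym q.2)
  (orbC (val p.2 == _)) (orbC (val p.1 == _)).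
Qed.

(** A step towards [q] in one coordinate stays in the product of the two convex sets and lowers the
    sum of the coordinate distances. *)
Lemma box_connect N (P Q : pred nat) (p q : 'I_N * 'I_N) :
  (forall i k j, (i <= k <= j)%N -> P i -> P j -> P k) ->
  (forall i k j, (i <= k <= j)%N -> Q i -> Q j -> Q k) ->
  P p.1 -> Q p.2 -> P q.1 -> Q q.2 ->
  connect (fun u w : 'I_N * 'I_N =>
    [&& gadj u w, P u.1, Q u.2, P w.1 & Q w.2]) p q.
Proof.
move=> cP cQ + + Pq Qq.
pose d (p : 'I_N * 'I_N) :=
  ((p.1 - q.1) + (q.1 - p.1) + (p.2 - q.2) + (q.2 - p.2))%N.
have [n] := ubnP (d p); elim: n p => // n IH p; rewrite ltnS => dn Pp Qp.
have step p' : gadj p p' -> P p'.1 -> Q p'.2 -> (d p' < d p)%N ->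
    connect (fun u w : 'I_N * 'I_N =>
    [&& gadj u w, P u.1, Q u.2, P w.1 & Q w.2]) p q.
  move=> pp' Pp' Qp' dd; apply: connect_trans (IH p' _ Pp' Qp'); last lia.
  by apply: connect1; rewrite pp' Pp Qp Pp' Qp'.
have [lt|lt|e1] := ltngtP p.1 q.1.
- have b : (p.1.+1 < N)%N by have := ltn_ord q.1; lia.
  apply: (step (Ordinal b, p.2)) => //=.
  + by rewrite /gadj /near1 /= !eqxx !orbT.
  + by apply: cP Pp Pq; lia.
  + by rewrite /d /=; lia.
- have b : (p.1.-1 < N)%N by have := ltn_ord p.1; lia.
  apply: (step (Ordinal b, p.2)) => //=.
  + by rewrite /gadj /near1 /= prednK ?eqxx ?orbT //; lia.
  + by apply: cP Pq Pp; lia.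
  + by rewrite /d /=; lia.
have [lt|lt|e2] := ltngtP p.2 q.2.
- have b : (p.2.+1 < N)%N by have := ltn_ord q.2; lia.
  apply: (step (p.1, Ordinal b)) => //=.
  + by rewrite /gadj /near1 /= !eqxx !orbT.
  + by apply: cQ Qp Qq; lia.
  + by rewrite /d /=; lia.
- have b : (p.2.-1 < N)%N by have := ltn_ord p.2; lia.
  apply: (step (p.1, Ordinal b)) => //=.
  + by rewrite /gadj /near1 /= prednK ?eqxx ?orbT //; lia.
  + by apply: cQ Qq Qp; lia.
  + by rewrite /d /=; lia.
have -> : p = q.
  by rewrite (surjective_pairing p) (surjective_pairing q); congr pair; apply: val_inj.
exact: connect0.
Qed.

(** The graph as a minor of the grid. Row and column 0 stay free, so that every labelled point has a
    left and a lower neighbour, as the parity arguments on squares require. *)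
Record grid_model (T : finType) (V : {set T}) (e : rel T) (N : nat)
    (lam : 'I_N * 'I_N -> option T) : Prop := GridModel {
  gm_in : forall p x, lam p = Some x -> x \in V;
  gm_pos : forall p, lam p -> (0 < p.1)%N /\ (0 < p.2)%N;
  gm_ex : forall x, x \in V -> exists p, lam p = Some x;
  gm_conn : forall p q, lam p -> lam p = lam q ->
    connect (fun u w => gadj u w && (lam u == lam w)) p q;
  gm_edge : forall x y, e x y -> exists p q,
    [/\ gadj p q, lam p = Some x & lam q = Some y] }.

Section Discretize.
Variables (R : realType) (T : finType) (V : {set T}) (e : rel T).
Variables (pos : T -> R * R) (g : T -> T -> R -> R * R).
Hypothesis dr : pdraw V e pos g.

(** Near its ends an edge may come close to other edges, so the clearance [r2] is asked only at
    distance at least [r1 / 2] from the ends; there the parameter stays in a compact part of the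
    open unit interval. *)
Lemma radii : exists r1 r2 : R, [/\ 0 < r1, 0 < r2,
  forall x y, x \in V -> y \in V -> x != y -> 2 * r1 < `|pos x - pos y|,
  forall x y z t, e x y -> z \in V -> z != x -> z != y -> 0 <= t <= 1 ->
    2 * r1 < `|g x y t - pos z| &
  forall x y z w s t, e x y -> e z w -> [set x; y] != [set z; w] ->
    0 <= s <= 1 -> 0 <= t <= 1 ->
    r1 / 2 <= `|g x y s - pos x| -> r1 / 2 <= `|g x y s - pos y| ->
    r2 < `|g x y s - g z w t| ].
Proof.
have [||a a0 aP] := @fin_radius R (T * T)%type (fun p r =>
   p.1 \in V -> p.2 \in V -> p.1 != p.2 -> 2 * r < `|pos p.1 - pos p.2|).
- by move=> p r r' _ rr H h1 h2 h3; have := H h1 h2 h3; lra.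
- move=> [x y] /=; have [xV|] := boolP (x \in V); last by exists 1.
  have [yV|] := boolP (y \in V); last by exists 1.
  have [xy|xy] := eqVneq x y; first by exists 1.
  have p0 : 0 < `|pos x - pos y|.
    by rewrite normr_gt0 subr_eq0; apply: contra_neqN xy => /eqP /(pd_inj dr xV yV).
  by exists (`|pos x - pos y| / 3) => *; lra.
have [||b b0 bP] := @fin_radius R (T * T * T)%type (fun p r => forall t,
   e p.1.1 p.1.2 -> p.2 \in V -> p.2 != p.1.1 -> p.2 != p.1.2 -> 0 <= t <= 1 ->
    2 * r < `|g p.1.1 p.1.2 t - pos p.2|).
- by move=> p r r' _ rr H t h1 h2 h3 h4 h5; have := H t h1 h2 h3 h4 h5; lra.
- move=> [[x y] z] /=; have [xy|] := boolP (e x y); last by exists 1.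
  have [zV|] := boolP (z \in V); last by exists 1.
  have [zx|zx] := eqVneq z x; first by exists 1.
  have [zy|zy] := eqVneq z y; first by exists 1.
  have [|r r0 rP] := @point_dist R _ (g x y) (pos z) (pd_cont dr xy).
    by move=> t; exact: (pd_miss dr xy).
  exists (r / 2) => [|t _ _ _ _ t01]; first lra.
  by have := rP t t01; lra.
pose r1 := Num.min a b.
have r10 : 0 < r1 by rewrite lt_min a0.
have r1a : r1 <= a by rewrite ge_min lexx.
have r1b : r1 <= b by rewrite ge_min lexx orbT.
have [||c c0 cP] := @fin_radius R (T * T * (T * T))%type (fun p r => forall s t,
   e p.1.1 p.1.2 -> e p.2.1 p.2.2 -> [set p.1.1; p.1.2] != [set p.2.1; p.2.2] ->
   0 <= s <= 1 -> 0 <= t <= 1 ->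
   r1 / 2 <= `|g p.1.1 p.1.2 s - pos p.1.1| ->
   r1 / 2 <= `|g p.1.1 p.1.2 s - pos p.1.2| ->
   r < `|g p.1.1 p.1.2 s - g p.2.1 p.2.2 t|).
- move=> p r r' _ rr H s t h1 h2 h3 h4 h5 h6 h7.
  exact: le_lt_trans rr (H s t h1 h2 h3 h4 h5 h6 h7).
- move=> [[x y] [z w]] /=; have [xy|] := boolP (e x y); last by exists 1.
  have [zw|] := boolP (e z w); last by exists 1.
  have [E|ne] := eqVneq [set x; y] [set z; w]; first by exists 1.
  have [|eta eta0 etaP] := @unif_cont R _ (g x y) (r1 / 2) (pd_cont dr xy); first lra.
  pose sg := Num.min (eta / 2) (1 / 3).
  have sg0 : 0 < sg by rewrite lt_min; apply/andP; split; lra.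
  have sg1 : sg <= 1 / 3 by rewrite ge_min lexx orbT.
  have sg2 : sg <= eta / 2 by rewrite ge_min lexx.
  have [|||r r0 rP] := @curve_dist R _ (g x y) (g z w) sg (1 - sg) 0 1
     (pd_cont dr xy) (pd_cont dr zw).
  + lra.
  + exact: ler01.
  + move=> s t s01 t01.
    have so : s \in `]0, 1[ by rewrite in_itv /=; lra.
    have [t0|t0] := leP t 0.
      have -> : t = 0 by lra.
      by rewrite (pd_0 dr zw); apply: (pd_avoid dr xy (pd_dom dr zw)).
    have [t1|t1] := leP 1 t.
      have -> : t = 1 by lra.
      by rewrite (pd_1 dr zw); apply: (pd_avoid dr xy (pd_dom2 dr zw)).
    by apply: (pd_disj dr xy zw ne so); rewrite in_itv /=; lra.
  exists r => // s t _ _ _ s01 t01 dx dy; apply: rP => //.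
  apply/andP; split; rewrite leNgt; apply/negP => ss.
    move: dx; rewrite leNgt => /negP; apply.
    rewrite -(pd_0 dr xy); apply: etaP => //; first by rewrite lexx ler01.
    by rewrite subr0 ger0_norm; lra.
  move: dy; rewrite leNgt => /negP; apply.
  rewrite -(pd_1 dr xy); apply: etaP => //; first by rewrite lexx ler01.
  by rewrite distrC ger0_norm; lra.
exists r1, c; split => //.
- by move=> x y xV yV xy; have := aP (x, y) xV yV xy => /=; lra.
- by move=> x y z t xy zV zx zy t01; have := bP (x, y, z) t xy zV zx zy t01 => /=; lra.
- by move=> x y z w s t; exact: (cP (x, y, (z, w)) s t).
Qed.

Lemma prod_norm_le (u : R * R) d : (`|u| <= d) = (`|u.1| <= d) && (`|u.2| <= d).
Proof. by rewrite prod_normE ge_max. Qed.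

Lemma prod_norm_lt (u : R * R) d : (`|u| < d) = (`|u.1| < d) && (`|u.2| < d).
Proof. by rewrite prod_normE gt_max. Qed.

Lemma truncn_near (x y : R) : 0 <= x -> 0 <= y -> `|x - y| < 1 ->
  Num.truncn x = Num.truncn y \/ near1 (Num.truncn x) (Num.truncn y).
Proof.
move=> x0 y0 xy; have /andP[x1 x2] := truncn_itv x0.
have /andP[y1 y2] := truncn_itv y0.
move: xy; rewrite ltr_norml => /andP[xy1 xy2].
rewrite -natr1 in x2; rewrite -natr1 in y2.
have : (Num.truncn x < (Num.truncn y).+2)%N.
  by rewrite -(ltr_nat R) -natr1 -natr1; lra.
have : (Num.truncn y < (Num.truncn x).+2)%N.
  by rewrite -(ltr_nat R) -natr1 -natr1; lra.
by rewrite /near1 => *; case: (ltngtP (Num.truncn x) (Num.truncn y)) => ?; [right|right|left]; lia.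
Qed.

(* Vertices become squares of side [2 r1]; the part of an edge outside these
   squares becomes a set of lattice points owned by one of its ends. *)
Lemma discretize : exists N lam, @grid_model T V e N lam.
Proof.
have [r1 [r2 [r10 r20 distV distE distD]]] := radii.
have [M M0 [Mp Mg]] := pdraw_bounded dr.
(* Lattice points of an edge lie within [2 * h] of its curve. With [h <= r1 / 8], curve points near
   a lattice point outside all squares are at least [r1 / 2] from the vertices; with [h <= r2 / 8],
   such a lattice point is near one edge only. *)
pose h := Num.min (r1 / 8) (r2 / 8).
have h0 : 0 < h by rewrite lt_min; apply/andP; split; lra.
have h1 : h <= r1 / 8 by rewrite ge_min lexx.
have h2 : h <= r2 / 8 by rewrite ge_min lexx orbT.
(* The surplus [2 * r1] puts index 0 farther than [r1] from the drawing, hence out of every branch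
   set. *)
pose A := M + 2 * r1.
pose n0 := (Num.truncn ((M + A) / h)).+1; pose N := n0.+1.
pose a (i : nat) := i%:R * h - A.
pose pt (p : 'I_N * 'I_N) : R * R := (a p.1, a p.2).
pose ix (x : R) := Num.truncn ((x + A) / h).
pose fl (z : R * R) : 'I_N * 'I_N := (@inord n0 (ix z.1), @inord n0 (ix z.2)).
have ixP x : `|x| <= M -> `|a (ix x) - x| <= h /\ @inord n0 (ix x) = ix x :> nat.
  rewrite ler_norml => xM; have x0 : 0 <= (x + A) / h.
    by apply: divr_ge0; rewrite /A; lra.
  have /andP[l u] := truncn_itv x0; split; last first.
    rewrite inordK //; apply: (@leq_ltn_trans (Num.truncn ((M + A) / h))).
      by apply: le_truncn; rewrite ler_pM2r ?invr_gt0 //; lra.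
    exact: leqnSn.
  rewrite ler_pdivlMr // -/(ix x) in l.
  rewrite ltr_pdivrMr // -/(ix x) -natr1 mulrDl mul1r in u.
  by rewrite /a ler_norml; lra.
have comp (z : R * R) : `|z| <= M -> `|z.1| <= M /\ `|z.2| <= M.
  by rewrite prod_norm_le => /andP.
have flP z : `|z| <= M -> `|pt (fl z) - z| <= h.
  move=> /comp[z1 z2]; rewrite prod_norm_le /= /pt /fl /=.
  by have [? ->] := ixP _ z1; have [? ->] := ixP _ z2; apply/andP.
have fln (x y : R) : `|x| <= M -> `|y| <= M -> `|x - y| < h ->
    ix x = ix y \/ near1 (ix x) (ix y).
  rewrite !ler_norml => xM yM xy; apply: truncn_near.
  - by apply: divr_ge0; rewrite /A; lra.
  - by apply: divr_ge0; rewrite /A; lra.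
  rewrite -mulrBl opprD addrACA subrr addr0 normrM (gtr0_norm (x := h^-1)) ?invr_gt0 //.
  by rewrite ltr_pdivrMr // mul1r.
pose inA x (p : 'I_N * 'I_N) := (x \in V) && (`|pt p - pos x| <= r1).
pose allA p := [exists x, inA x p].
pose inN x y (p : 'I_N * 'I_N) :=
  `[< exists2 t, 0 <= t <= 1 & `|pt p - g x y t| <= 2 * h >].
(* Grid steps in the tube around the edge, outside all squares; [inC] collects what they reach from
   the square of the first end. *)
pose rN x y : rel ('I_N * 'I_N) := fun u w => [&& gadj u w, inN x y w & ~~ allA w].
pose inC x y p := ~~ allA p && [exists u, inA x u && connect (rN x y) u p].
(* The end of smaller rank owns the edge, so that only one direction of it is traced. *)
pose own x y := e x y && (enum_rank x < enum_rank y)%N.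
pose lam p : option T := if [pick x | inA x p] is Some x then Some x else
  if [pick q : T * T | own q.1 q.2 && inC q.1 q.2 p] is Some q then Some q.1 else None.
have Auniq x y p : inA x p -> inA y p -> x = y.
  move=> /andP[xV xp] /andP[yV yp]; have [//|xy] := eqVneq x y; exfalso.
  have := distV _ _ xV yV xy; have := ler_distD (pt p) (pos x) (pos y).
  by rewrite (distrC (pos x) (pt p)); lra.
have CN x y p : inC x y p -> inN x y p.
  move=> /andP[np /existsP[u /andP[uA up]]].
  have : (u == p) || inN x y p; last first.
    case/orP => // /eqP E; move/negP: np; case; apply/existsP; exists x.
    by rewrite -E.
  apply: (connect_closed (P := fun w => (u == w) || inN x y w) _ up); last by rewrite eqxx.
  by move=> b w /and3P[_ -> _] _; rewrite orbT.
have NA x y p : e x y -> inN x y p -> forall z, inA z p -> (z == x) || (z == y).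
  move=> xy /asboolP[t t01 tp] z /andP[zV zp].
  apply: contraT; rewrite negb_or => /andP[zx zy].
  have := distE x y z t xy zV zx zy t01; have := ler_distD (pt p) (g x y t) (pos z).
  by rewrite (distrC (g x y t) (pt p)); lra.
have Cuniq x y z w p : own x y -> own z w -> inC x y p -> inC z w p -> x = z.
  move=> /andP[xy rxy] /andP[zw rzw] C1 C2.
  have [E|ne] := eqVneq [set x; y] [set z; w].
    have := (set21 x y, set22 x y); rewrite {1 2}E !inE.
    case=> /orP[] /eqP Ex /orP[] /eqP Ey //.
      by move: rxy; rewrite Ex Ey => rr; have := ltn_trans rr rzw; rewrite ltnn.
    by move: rxy; rewrite Ex Ey ltnn.
  have /asboolP[s s01 sp] := CN _ _ _ C1; have /asboolP[t t01 tp] := CN _ _ _ C2.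
  move: C1 => /andP[/existsPn nA _]; exfalso.
  have far u : u \in V -> r1 / 2 <= `|g x y s - pos u|.
    move=> uV; have := nA u; rewrite /inA uV /= -ltNge.
    by have := ler_distD (g x y s) (pt p) (pos u); lra.
  have := distD x y z w s t xy zw ne s01 t01 (far _ (pd_dom dr xy)) (far _ (pd_dom2 dr xy)).
  have := ler_distD (pt p) (g x y s) (g z w t).
  by rewrite (distrC (g x y s) (pt p)); lra.
have lamA x p : inA x p -> lam p = Some x.
  move=> xp; rewrite /lam; case: pickP => [y yp|/(_ x)]; last by rewrite xp.
  by rewrite (Auniq _ _ _ xp yp).
have lamC x y p : own x y -> inC x y p -> lam p = Some x.
  move=> xy C; rewrite /lam; case: pickP => [z zp|_].
    by case/andP: C => /existsPn/(_ z); rewrite zp.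
  case: pickP => [[z w] /= /andP[zw C']|/(_ (x, y)) /=]; last by rewrite xy C.
  by rewrite (Cuniq _ _ _ _ _ xy zw C C').
have lamP p x : lam p = Some x -> inA x p \/ exists2 y, own x y & inC x y p.
  rewrite /lam; case: pickP => [z zp [<-]|_]; first by left.
  by case: pickP => [[z w] /= /andP[zw C] [<-]|//]; right; exists w.
have fl0 x : x \in V -> inA x (fl (pos x)).
  by move=> xV; rewrite /inA xV; have := flP _ (Mp x); lra.
pose fr : rel ('I_N * 'I_N) := fun u w => gadj u w && (lam u == lam w).
have fr_sym : symmetric fr by move=> u w; rewrite /fr gadj_sym eq_sym.
have connA x p q : inA x p -> inA x q -> connect fr p q.
  move=> pA qA; have [xV] := andP pA.
  rewrite prod_norm_le /= => /andP[p1 p2].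
  have [_] := andP qA; rewrite prod_norm_le /= => /andP[q1 q2].
  have conv (b : R) i k j : (i <= k <= j)%N ->
      `|a i - b| <= r1 -> `|a j - b| <= r1 -> `|a k - b| <= r1.
    rewrite /a !ler_norml => /andP[]; rewrite -!(ler_nat R) => ik kj.
    have : i%:R * h <= k%:R * h by rewrite ler_pM2r.
    have : k%:R * h <= j%:R * h by rewrite ler_pM2r.
    lra.
  have := @box_connect N (fun i => `|a i - (pos x).1| <= r1)
     (fun i => `|a i - (pos x).2| <= r1) p q (conv _) (conv _) p1 p2 q1 q2.
  apply: connect_sub => u w /and5P[uw u1 u2 w1 w2]; apply: connect1.
  have uA : inA x u by rewrite /inA xV prod_norm_le /= u1 u2.
  have wA : inA x w by rewrite /inA xV prod_norm_le /= w1 w2.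
  by rewrite /fr uw (lamA _ _ uA) (lamA _ _ wA) eqxx.
have connC x y p : own x y -> inC x y p ->
    exists2 u, inA x u & connect fr u p.
  move=> xy /andP[_ /existsP[u /andP[uA up]]]; exists u => //.
  suff : (lam p == Some x) && connect (rN x y) u p && connect fr u p by case/andP.
  apply: (connect_closed (P := fun w => (lam w == Some x) &&
     connect (rN x y) u w && connect fr u w) _ up); last first.
    by rewrite (lamA _ _ uA) eqxx !connect0.
  move=> b w bw /andP[/andP[/eqP lb ub] fb].
  have uw : connect (rN x y) u w by apply: connect_trans ub (connect1 bw).
  case/and3P: (bw) => gbw _ nw.
  have lw : lam w = Some x.
    by apply: lamC xy _; rewrite /inC nw; apply/existsP; exists u; rewrite uA.
  rewrite lw eqxx uw /=; apply: connect_trans fb (connect1 _).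
  by rewrite /fr gbw lb lw /=.
have connO x p : lam p = Some x -> connect fr (fl (pos x)) p.
  move=> lp; have [pA|[y xy C]] := lamP _ _ lp.
    apply: (connA x) => //; apply: fl0; by case/andP: pA.
  have [u uA up] := connC _ _ _ xy C; apply: connect_trans up.
  apply: (connA x) => //; apply: fl0; by case/andP: uA.
have edgeO x y : own x y -> exists p q, [/\ gadj p q, lam p = Some x & lam q = Some y].
  move=> oxy; have [xy _] := andP oxy.
  have [//|no] := pselect (exists p q, [/\ gadj p q, lam p = Some x & lam q = Some y]).
  (* If no grid step led from label [x] to label [y], then [P] would propagate along the curve up to
     the cell of [pos y]. *)
  exfalso; pose P u := inA x u || inC x y u.
  have Pstep u w : P u -> gadj u w -> inN x y w -> P w.
    move=> Pu uw wN; rewrite /P; have [wA|nA] := boolP (allA w); last first.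
      apply/orP; right; rewrite /inC nA /=; apply/existsP.
      have rw : rN x y u w by rewrite /rN uw wN nA.
      case/orP: Pu => [uA|/andP[_ /existsP[v /andP[vA vu]]]].
        by exists u; rewrite uA connect1.
      by exists v; rewrite vA; apply: connect_trans vu (connect1 rw).
    case/existsP: wA => z zA; have /orP[/eqP E|/eqP E] := NA _ _ _ xy wN z zA.
      by rewrite -E zA.
    case: no; exists u, w; split => //; last by rewrite (lamA _ _ zA) E.
    by case/orP: Pu => [/lamA //|/(lamC _ _ _ oxy)].
  have [eta eta0 etaP] := @unif_cont R _ (g x y) h (pd_cont dr xy) h0.
  have Pmove s t : 0 <= s <= 1 -> 0 <= t <= 1 -> `|s - t| < eta ->
      P (fl (g x y s)) -> P (fl (g x y t)).
    move=> s01 t01 st Ps.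
    have [zs1 zs2] := comp _ (Mg _ _ _ xy s01); have [zt1 zt2] := comp _ (Mg _ _ _ xy t01).
    have := etaP s t s01 t01 st; rewrite prod_norm_lt /= => /andP[d1 d2].
    (* Neighbouring cells on the curve may differ in both coordinates; [m] splits this into two grid
       steps. *)
    pose m : 'I_N * 'I_N := ((fl (g x y t)).1, (fl (g x y s)).2).
    have [as1 es1] := ixP _ zs1; have [as2 es2] := ixP _ zs2.
    have [at1 et1] := ixP _ zt1; have [at2 et2] := ixP _ zt2.
    have mN : inN x y m.
      apply/asboolP; exists s => //; rewrite prod_norm_le /= et1 es2.
      apply/andP; split; last by lra.
      have := ler_distD (g x y t).1 (a (ix (g x y t).1)) (g x y s).1.
      by rewrite (distrC (g x y t).1 (g x y s).1); lra.
    have tN : inN x y (fl (g x y t)).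
      by apply/asboolP; exists t => //; have := flP _ (Mg _ _ _ xy t01); lra.
    have Pm : P m.
      have [E|n1] := fln _ _ zs1 zt1 d1.
        have -> // : m = fl (g x y s) by rewrite /m /fl /= E.
      apply: (Pstep _ _ Ps) => //; rewrite /gadj /= eqxx /= es1 et1 n1.
      by rewrite orbT.
    have [E|n2] := fln _ _ zs2 zt2 d2.
      have -> // : fl (g x y t) = m by rewrite /m /fl /= E.
    by apply: (Pstep _ _ Pm) => //; rewrite /gadj /= eqxx /= es2 et2 n2.
  have Pall n s : 0 <= s <= 1 -> s <= n%:R * (eta / 2) -> P (fl (g x y s)).
    elim: n s => [|n IH] s s01 sn.
      have -> : s = 0 by rewrite mul0r in sn; lra.
      by rewrite (pd_0 dr xy) /P fl0 // (pd_dom dr xy).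
    have [s2|s2] := leP s (eta / 2).
      apply: (Pmove 0) => //; first by rewrite lexx ler01.
        by rewrite sub0r normrN ger0_norm; lra.
      by rewrite (pd_0 dr xy) /P fl0 // (pd_dom dr xy).
    apply: (Pmove (s - eta / 2)) => //; first lra.
      by rewrite distrC opprB addrC subrK ger0_norm; lra.
    by apply: IH; [lra | move: sn; rewrite -natr1 mulrDl mul1r; lra].
  have [n nP] : exists n : nat, 1 <= n%:R * (eta / 2).
    have e2 : 0 < eta / 2 by lra.
    exists (Num.bound (eta / 2)^-1); rewrite -ler_pdivrMr // div1r ltW //.
    by apply: le_lt_trans (archi_boundP _); [exact: lexx | rewrite invr_ge0 ltW].
  have yV := pd_dom2 dr xy.
  have := Pall n 1; rewrite lexx ler01 => /(_ isT nP); rewrite (pd_1 dr xy).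
  case/orP => [xA|/andP[/existsPn/(_ y)]]; last by rewrite fl0.
  have := Auniq _ _ _ xA (fl0 _ yV) => E.
  by move: xy; rewrite E (pd_irr dr).
exists N, lam; split.
- move=> p x /lamP[/andP[] //|[y /andP[xy _] _]]; exact: (pd_dom dr xy).
- move=> p ip; have [x lp] : exists x, lam p = Some x.
    by case: (lam p) ip => [x|//]; exists x.
  have close : exists2 z : R * R, `|z| <= M & `|pt p - z| <= r1.
    have [/andP[_ ?]|[y /andP[xy _] C]] := lamP _ _ lp; first by exists (pos x).
    have /asboolP[t t01 tp] := CN _ _ _ C.
    by exists (g x y t); [exact: Mg | lra].
  case: close => z /comp[z1 z2]; rewrite prod_norm_le /= => /andP[p1 p2].
  have pos0 (i : nat) b : `|b| <= M -> `|a i - b| <= r1 -> (0 < i)%N.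
    rewrite lt0n => bM; apply: contraTneq => ->; rewrite /a mul0r -ltNge.
    rewrite add0r -opprD normrN; move: bM; rewrite ler_norml => bM.
    by rewrite ger0_norm /A; lra.
  by split; [exact: pos0 z1 p1 | exact: pos0 z2 p2].
- by move=> x xV; exists (fl (pos x)); apply: lamA; exact: fl0.
- move=> p q ip; have [x lp] : exists x, lam p = Some x.
    by case: (lam p) ip => [x|//]; exists x.
  rewrite lp => /esym lq.
  apply: connect_trans (connO _ _ lq); rewrite sym_connect_sym //.
  exact: connO.
- move=> x y xy; have [lt|lt|E] := ltngtP (enum_rank x) (enum_rank y).
  + by apply: edgeO; rewrite /own xy.
  + have [|p [q [pq lp lq]]] := edgeO y x; first by rewrite /own (pd_sym dr) xy.
    by exists q, p; rewrite gadj_sym.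
  + have : x = y by apply: enum_rank_inj; exact: ord_inj.
    by move=> E'; move: xy; rewrite E' (pd_irr dr).
Qed.

End Discretize.

(** * Even edge sets and faces *)

Definition symd {T : finType} (A B : {set T}) := [set x | (x \in A) (+) (x \in B)].

Lemma in_symd (T : finType) (A B : {set T}) x :
  (x \in symd A B) = (x \in A) (+) (x \in B).
Proof. by rewrite inE. Qed.

Lemma symdA (T : finType) : associative (@symd T).
Proof. by move=> A B C; apply/setP => x; rewrite !in_symd addbA. Qed.

Lemma symdC (T : finType) : commutative (@symd T).
Proof. by move=> A B; apply/setP => x; rewrite !in_symd addbC. Qed.

Lemma symd0 (T : finType) : right_id finset.set0 (@symd T).
Proof. by move=> A; apply/setP => x; rewrite in_symd inE addbF. Qed.

Lemma symdd (T : finType) (A : {set T}) : symd A A = finset.set0.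
Proof. by apply/setP => x; rewrite in_symd inE addbb. Qed.

Lemma symdK (T : finType) (B : {set T}) : involutive (fun A => symd A B).
Proof. by move=> A; rewrite -symdA symdd symd0. Qed.

Lemma symd_eq0 (T : finType) (A B : {set T}) : symd A B = finset.set0 -> A = B.
Proof.
move=> /setP E; apply/setP => x; move: (E x); rewrite in_symd inE.
by case: (x \in A); case: (x \in B).
Qed.

(* [inc e] is the set of ends of the edge [e]; [odds z] is the boundary of [z]
   over the field with two elements. *)
Section Odds.
Variables (V E : finType) (inc : E -> {set V}).
Implicit Types z : {set E}.

Definition odds z : {set V} := [set x | \big[addb/false]_(e in z) (x \in inc e)].

Lemma in_odds z x : (x \in odds z) = \big[addb/false]_(e in z) (x \in inc e).
Proof. by rewrite inE. Qed.

Lemma in_oddsE z x :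
  (x \in odds z) = \big[addb/false]_e ((e \in z) && (x \in inc e)).
Proof.
rewrite in_odds big_mkcond; apply: eq_bigr => e _.
by case: (e \in z).
Qed.

Lemma odds_symd z z' : odds (symd z z') = symd (odds z) (odds z').
Proof.
apply/setP => x; rewrite in_symd !in_oddsE -big_split /=.
by apply: eq_bigr => e _; rewrite in_symd andb_addl.
Qed.

Lemma odds0 : odds finset.set0 = finset.set0.
Proof.
by apply/setP => x; rewrite in_oddsE inE big1 // => e _; rewrite inE.
Qed.

Lemma odds1 e : odds [set e] = inc e.
Proof. by apply/setP => x; rewrite in_odds big_set1. Qed.

Variables (r : rel V) (K : {set E}).
Hypothesis rK : forall u w, r u w ->
  exists2 e, e \in K & inc e = symd [set u] [set w].

Lemma symd_sub z z' : z \subset K -> z' \subset K -> symd z z' \subset K.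
Proof.
move=> /fintype.subsetP zK /fintype.subsetP zK'; apply/fintype.subsetP => e.
by rewrite in_symd; have := (zK e, zK' e); case: (e \in z); case: (e \in z') => -[] //=; auto.
Qed.

Lemma path_join u w : connect r u w ->
  exists2 J : {set E}, J \subset K & odds J = symd [set u] [set w].
Proof.
move=> /connectP[p]; elim: p u => [|z p IH] u /=.
  by move=> _ ->; exists finset.set0; rewrite ?finset.sub0set // odds0 symdd.
move=> /andP[/rK[e eK ie] /IH zp] /zp[J JK oJ].
exists (symd [set e] J); first by rewrite symd_sub // finset.sub1set.
by rewrite odds_symd odds1 ie oJ symdA symdK.
Qed.

(** Each [w] in [A] is joined to its root by a path and the paths are added up: a T-join in which a
    root counts with the parity of its multiplicity. *)
Lemma root_join (rt : V -> V) (A : {set V}) :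
  (forall w, w \in A -> connect r w (rt w)) ->
  exists2 J : {set E}, J \subset K & forall x,
   (x \in odds J) = (x \in A) (+) \big[addb/false]_(w in A) (rt w == x).
Proof.
have [n] := ubnP #|A|; elim: n A => // n IH A; rewrite ltnS => An Art.
have [->|[w wA]] := set_0Vmem A.
  exists finset.set0; first exact: finset.sub0set.
  by move=> x; rewrite odds0 !inE big_set0.
have [|v|J JK oJ] := IH (A :\ w).
- by apply: leq_trans An; rewrite [#|A|](cardsD1 w) wA.
- by rewrite !inE => /andP[_]; exact: Art.
have [J' JK' oJ'] := path_join (Art w wA).
exists (symd J J'); first exact: symd_sub.
move=> x; rewrite odds_symd in_symd oJ oJ' in_symd !inE.
rewrite [in RHS](big_setD1 w) //= (eq_sym x (rt w)).
have [->|xw] := eqVneq x w; rewrite ?wA /=.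
  by case: (\big[_/_]_(_ in _) _); case: (_ == _).
by case: (x \in A); case: (\big[_/_]_(_ in _) _); case: (_ == _).
Qed.

End Odds.

(** [None] is an apex joined to all of [A]. Planarity of the cone is the combinatorial form of the
    statement that the vertices of [A] lie on a common face. *)
Definition cone_rel (T : finType) (G : sgraph T) (A : {set T}) : rel (option T) :=
  fun a b => match a, b with
  | Some x, Some y => adj G x y
  | Some x, None | None, Some x => x \in A
  | None, None => false
  end.

(* [l E] and [r E] are the faces on the two sides of [E], and [Vt phi] the set of
   vertices incident with the face [phi]. *)
Record face_structure (R : realType) (T : finType) (G : sgraph T) (Phi : finType)
    (l r : {set T} -> Phi) (Vt : Phi -> {set T}) : Prop := FaceStructure {
  fc_span : forall z : {set {set T}}, z \subset edges G -> odds id z = finset.set0 ->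
    exists S : {set Phi},
      forall E, E \in edges G -> (E \in z) = (l E \in S) (+) (r E \in S);
  fc_even : forall S : {set Phi},
    odds id [set E in edges G | (l E \in S) (+) (r E \in S)] = finset.set0;
  fc_ends : forall E x, E \in edges G -> x \in E -> (x \in Vt (l E)) && (x \in Vt (r E));
  fc_vert : forall x, exists phi, x \in Vt phi;
  fc_cone : forall phi, rplanar R [set: option T] (cone_rel G (Vt phi));
  fc_conn : forall S : {set Phi},
    (forall E, E \in edges G -> (l E \in S) = (r E \in S)) ->
    S = finset.set0 \/ S = [set: Phi] }.

Lemma adj_symm (T : finType) (G : sgraph T) : symmetric (adj G).
Proof. by move=> x y; rewrite /adj finset.setUC. Qed.

Lemma adj_irrefl (T : finType) (G : sgraph T) : irreflexive (adj G).
Proof.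
move=> x; apply/negP => xx; have /forallP/(_ [set x; x]) := edges_card2 G.
by rewrite [_ \in _]xx finset.setUid cards1.
Qed.

(** * Faces of a grid model *)

Section GridFaces.
Variables (R : realType) (T : finType) (G : sgraph T) (N : nat).
Variable lam : 'I_N * 'I_N -> option T.
Hypothesis gm : grid_model [set: T] (adj G) lam.

Local Notation GV := ('I_N * 'I_N)%type.
(* [(true, p)] is the horizontal grid edge starting at [p], [(false, p)] the
   vertical one; a unit square is named by its lower left corner. *)
Local Notation Cd := (bool * GV)%type.

Let gshift (d : bool) (p q : GV) :=
  if d then (q.1 == p.1.+1 :> nat) && (q.2 == p.2)
  else (q.1 == p.1) && (q.2 == p.2.+1 :> nat).

Let ends (c : Cd) (p q : GV) := (p == c.2) && gshift c.1 c.2 q.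

(** An edge that leaves the grid at its far border has no second end and keeps its starting point
    only. *)
Let inc (c : Cd) : {set GV} := [set p | (p == c.2) (+) gshift c.1 c.2 p].

Let opred (i : 'I_N) : 'I_N := Ordinal (leq_ltn_trans (leq_pred i) (ltn_ord i)).

(** The square across [c] from the square [c.2]. On row or column 0 the predecessor is truncated and
    the two sides agree, so such border edges belong to no boundary. *)
Let sideB (c : Cd) : GV :=
  if c.1 then (c.2.1, opred c.2.2) else (opred c.2.1, c.2.2).

Lemma gshift_inj d p q q' : gshift d p q -> gshift d p q' -> q = q'.
Proof.
case: q q' => [a b] [a' b']; rewrite /gshift; case: d => /= /andP[/eqP e1 /eqP e2];
  move=> /andP[/eqP e3 /eqP e4]; congr pair; apply: val_inj; rewrite /=; congruence.
Qed.

Lemma ends_inc c p q : ends c p q -> inc c = symd [set p] [set q].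
Proof.
move=> /andP[/eqP-> cq]; apply/setP => x; rewrite !inE; congr (_ (+) _).
by apply/idP/eqP => [/gshift_inj/(_ cq)|->].
Qed.

Lemma gadj_ends p q : gadj p q -> exists c, ends c p q || ends c q p.
Proof.
case/orP => /andP[/eqP E /orP[/eqP n|/eqP n]].
- by exists (false, q); rewrite /ends /gshift /= E n !eqxx orbT.
- by exists (false, p); rewrite /ends /gshift /= E n !eqxx.
- by exists (true, q); rewrite /ends /gshift /= E n !eqxx orbT.
- by exists (true, p); rewrite /ends /gshift /= E n !eqxx.
Qed.

Lemma big_pick (I : finType) (f g : pred I) a : (forall q, g q = (q == a)) ->
  \big[addb/false]_q (f q && g q) = f a.
Proof.
move=> ga; rewrite (bigD1 a) //= ga eqxx andbT big1 ?addbF // => q /negbTE qa.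
by rewrite ga qa andbF.
Qed.

Lemma big_pick_in (I : finType) (X : {set I}) a :
  \big[addb/false]_(x in X) (x == a) = (a \in X).
Proof.
rewrite big_mkcond -[RHS](@big_pick _ (fun x => x \in X) (fun x => x == a) a) //.
Qed.

Lemma four_edges (f : pred Cd) (p : GV) : (0 < p.1)%N -> (0 < p.2)%N ->
  \big[addb/false]_c (f c && (p \in inc c)) =
  (f (true, p) (+) f (false, p)) (+)
  (f (true, (opred p.1, p.2)) (+) f (false, (p.1, opred p.2))).
Proof.
move=> p1 p2.
under eq_bigr do rewrite inE andb_addr.
rewrite big_split /=; congr (_ (+) _).
  transitivity (\big[addb/false]_d \big[addb/false]_q (f (d, q) && (p == q))).
    by rewrite pair_bigA /=; apply: eq_bigr => -[].
  rewrite big_bool.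
  by congr (_ (+) _); apply: (@big_pick _ (fun q => f (_, q))) => q; rewrite eq_sym.
transitivity (\big[addb/false]_d \big[addb/false]_q (f (d, q) && gshift d q p)).
  by rewrite pair_bigA /=; apply: eq_bigr => -[].
rewrite big_bool.
congr (_ (+) _); apply: (@big_pick _ (fun q => f (_, q))) => -[a b];
  rewrite /gshift /= -pair_eqE /= /pair_eq /= -!val_eqE /= ; case: p p1 p2 => u v /= u0 v0.
  by rewrite (eq_sym (val v)); congr (_ && _); apply/eqP/eqP; lia.
by rewrite (eq_sym (val u)); congr (_ && _); apply/eqP/eqP; lia.
Qed.

Lemma sum_ends (X : {set GV}) c p q : ends c p q ->
  \big[addb/false]_(x in X) (x \in inc c) = (p \in X) (+) (q \in X).
Proof.
move=> /ends_inc ->; under eq_bigr do rewrite in_symd !inE.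
by rewrite big_split /= !big_pick_in.
Qed.

Lemma sum_odds (X : {set GV}) (z : {set Cd}) :
  \big[addb/false]_(x in X) (x \in odds inc z) =
  \big[addb/false]_(c in z) \big[addb/false]_(x in X) (x \in inc c).
Proof.
rewrite exchange_big /=; apply: eq_bigr => x _; exact: in_odds.
Qed.

Let bd (S : {set GV}) : {set Cd} := [set c | (c.2 \in S) (+) (sideB c \in S)].

(** Each of the four squares around [p] is bordered by two of the four edges at [p]. *)
Lemma bd_even S (p : GV) : (0 < p.1)%N -> (0 < p.2)%N -> p \notin odds inc (bd S).
Proof.
case: p => a b /= a0 b0.
rewrite in_oddsE (four_edges (mem (bd S)) (p := (a, b)) a0 b0) /= !inE /sideB /=.
by case: ((a, b) \in S); case: ((a, opred b) \in S);
  case: ((opred a, b) \in S); case: ((opred a, opred b) \in S).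
Qed.

(** Ray casting: a square is in [S] if an odd number of vertical edges of [z] lie in its row on its
    left, its own left side included. Vertical edges are right by definition, horizontal ones by
    induction along the row, using the evenness of [z] at each point. *)
Lemma grid_homology (z : {set Cd}) : odds inc z = finset.set0 ->
  (forall c, c \in z -> (0 < c.2.1)%N && (0 < c.2.2)%N) ->
  exists S, bd S = z.
Proof.
move=> z0 zpos.
pose F (i j : 'I_N) := \big[addb/false]_(k < N | (k <= i)%N) ((false, (k, j)) \in z).
have zF d i j : (d, (i, j)) \in z -> (0 < i)%N && (0 < j)%N by move=> /zpos.
have FS (i j : 'I_N) : (0 < i)%N -> F i j = F (opred i) j (+) ((false, (i, j)) \in z).
  move=> i0; rewrite /F (bigD1 i) //= addbC; congr (_ (+) _); apply: eq_bigl => k.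
  by rewrite -val_eqE /=; lia.
have F0 (i j : 'I_N) : i = 0%N :> nat -> F i j = false.
  move=> i0; rewrite /F big1 // => k; rewrite i0 leqn0 => /eqP k0.
  by apply: contraTF isT => /zF; rewrite k0.
have FH n (i j : 'I_N) : i = n :> nat -> (0 < j)%N ->
    F i j (+) F i (opred j) = ((true, (i, j)) \in z).
  elim: n i => [|n IH] i iE j0.
    rewrite !F0 //; apply/esym; apply: contraTF isT => /zF; by rewrite iE.
  have i0 : (0 < i)%N by rewrite iE.
  rewrite (FS i j i0) (FS i (opred j) i0); have := IH (opred i); rewrite /= iE => /(_ erefl j0) H.
  have /setP/(_ (i, j)) := z0; rewrite in_oddsE (four_edges (mem z)) //= inE.
  move: H; case: (F (opred i) j); case: (F (opred i) (opred j)) => /= <-;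
  case: ((false, (i, j)) \in z); case: ((true, (i, j)) \in z);
  by case: ((false, (i, opred j)) \in z).
exists [set s | F s.1 s.2]; apply/setP => -[d [i j]]; rewrite !inE /sideB /=.
have zero (k : 'I_N) : k = 0%N :> nat -> opred k = k.
  by move=> k0; apply: val_inj; rewrite /= k0.
case: d => /=.
  have [j0|] := posnP j; last exact: FH.
  rewrite zero // addbb; apply/esym; apply: contraTF isT => /zF.
  by rewrite j0 andbF.
have [i0|i0] := posnP i.
  rewrite zero // addbb; apply/esym; apply: contraTF isT => /zF.
  by rewrite i0.
by rewrite (FS i j i0); case: (F _ _); case: (_ \in z).
Qed.

(** Crossing edges leads from every square down to the corner square, and membership in [S] never
    changes on the way. *)
Lemma squares_connected (S : {set GV}) : bd S = finset.set0 ->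
  S = finset.set0 \/ S = [set: GV].
Proof.
move=> S0; have step c : (c.2 \in S) = (sideB c \in S).
  have /setP/(_ c) := S0; rewrite !inE.
  by case: (c.2 \in S); case: (sideB c \in S).
have all0 n (p q : GV) : (p.1 + p.2 + (q.1 + q.2) <= n)%N -> (p \in S) = (q \in S).
  elim: n p q => [|n IH] p q pq.
    by congr (_ \in S); case: p q pq => [a b] [c d] /= pq; congr pair; apply: val_inj => /=; lia.
  have down (u : GV) : (0 < u.1 + u.2)%N ->
      exists2 w : GV, (w.1 + w.2 < u.1 + u.2)%N & (u \in S) = (w \in S).
    move=> u0; have [u1|u1] := posnP u.1.
      by exists (sideB (true, u)); [rewrite /sideB /=; lia | exact: (step (true, u))].
    by exists (sideB (false, u)); [rewrite /sideB /=; lia | exact: (step (false, u))].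
  have [p0|/down[w wp ->]] := posnP (p.1 + p.2)%N; last by apply: IH; lia.
  have [q0|/down[w wp ->]] := posnP (q.1 + q.2)%N; last by apply: IH; lia.
  by apply: IH; lia.
have [->|[p pS]] := set_0Vmem S; first by left.
by right; apply/setP => q; rewrite inE -(all0 _ p q (leqnn _)).
Qed.

Let rk (K : {set Cd}) : rel GV := fun u w =>
  [exists c in K, ends c u w || ends c w u].

Lemma rk_sym K : symmetric (rk K).
Proof.
by move=> u w; apply: eq_existsb => c; rewrite orbC.
Qed.

Lemma rkP (K : {set Cd}) u w : rk K u w -> exists2 c, c \in K & inc c = symd [set u] [set w].
Proof.
move=> /existsP[c /andP[cK /orP[/ends_inc|/ends_inc] E]]; exists c => //.
by rewrite symdC.
Qed.

(** Handshake on the component of [u]: it has an even number of odd points, hence contains [w]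
    too. *)
Lemma odds_connect (z : {set Cd}) u w :
  (forall c, c \in z -> exists p q, ends c p q) ->
  odds inc z = symd [set u] [set w] -> connect (rk z) u w.
Proof.
move=> ze zo; pose C := [set x | connect (rk z) u x].
have := sum_odds C z; rewrite [RHS]big1 => [|c cz]; last first.
  have [p [q cpq]] := ze c cz; rewrite (sum_ends _ cpq) !inE.
  have pq : rk z p q by apply/existsP; exists c; rewrite cz cpq.
  have -> : connect (rk z) u p = connect (rk z) u q; last by rewrite addbb.
  apply/idP/idP => H; apply: connect_trans H (connect1 _) => //.
  by rewrite rk_sym.
rewrite zo; under eq_bigr do rewrite in_symd !inE.
by rewrite big_split /= !big_pick_in !inE connect0; case: connect.
Qed.

Let fibc (c : Cd) := [exists p, exists q, [&& ends c p q, isSome (lam p) & lam p == lam q]].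

Let spans (K : {set Cd}) := (K \subset [set c | fibc c]) &&
  [forall p, forall q, isSome (lam p) && (lam p == lam q) ==> connect (rk K) p q].

(** A minimal set of edges connecting every branch set contains no nonempty even set: the rest of
    such a set would join the ends of any edge in it, and that edge could be dropped. *)
Lemma exists_forest : exists K0 : {set Cd}, [/\ K0 \subset [set c | fibc c],
   (forall p q, lam p -> lam p = lam q -> connect (rk K0) p q) &
   (forall z : {set Cd}, z \subset K0 -> odds inc z = finset.set0 -> z = finset.set0)].
Proof.
have ex : exists K, spans K.
  exists [set c | fibc c]; rewrite /spans subxx /=.
  apply/forallP => p; apply/forallP => q; apply/implyP => /andP[lp /eqP pq].
  have : connect (fun u w => gadj u w && (lam u == lam w)) p q by apply: gm_conn gm _ _ lp pq.
  move=> H; suff : (lam q == lam p) && connect (rk [set c | fibc c]) p q by case/andP.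
  apply: (connect_closed (P := fun w => (lam w == lam p) &&
     connect (rk [set c | fibc c]) p w) _ H); last by rewrite eqxx connect0.
  move=> u w /andP[/gadj_ends[c cuw] /eqP luw] /andP[/eqP lu pu].
  rewrite -luw lu eqxx /=; apply: connect_trans pu (connect1 _).
  apply/existsP; exists c; rewrite inE cuw andbT /fibc.
  case/orP: cuw => cuw; apply/existsP.
    by exists u; apply/existsP; exists w; rewrite cuw lu lp -luw lu eqxx.
  by exists w; apply/existsP; exists u; rewrite cuw -luw lu lp eqxx.
have [K0 /minsetP[/andP[sub /forallP con] min]] := ex_minset ex.
exists K0; split => //.
  move=> p q lp pq; have /forallP/(_ q)/implyP := con p; apply.
  by apply/andP; split; [exact: lp | exact/eqP].
move=> z zK z0; apply/eqP; apply: contraT => /set0Pn[c cz].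
have cK : c \in K0 by apply: (fintype.subsetP zK).
have : K0 :\ c = K0.
  apply: min; last exact: subD1set.
  apply/andP; split; first exact: fintype.subset_trans (subD1set _ _) sub.
  apply/forallP => p; apply/forallP => q; apply/implyP => pq.
  have /forallP/(_ q) := con p; rewrite pq /=; apply: connect_sub => u w.
  move=> /existsP[c' /andP[c'K cuw]].
  have [E|ne] := eqVneq c' c; last first.
    by apply: connect1; apply/existsP; exists c'; rewrite !inE ne c'K.
  have iE : inc c = symd [set u] [set w].
    by rewrite -E; case/orP: cuw => /ends_inc // ->; rewrite symdC.
  have zD : z :\ c = symd z [set c].
    apply/setP => x; rewrite !inE; have [->|] := eqVneq x c; first by rewrite cz.
    by rewrite addbF.
  have : connect (rk (z :\ c)) u w.
    apply: odds_connect => [x|].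
      rewrite !inE => /andP[_ /(fintype.subsetP zK)/(fintype.subsetP sub)].
      by rewrite inE => /existsP[a /existsP[b /and3P[? _ _]]]; exists a, b.
    by rewrite zD odds_symd z0 odds1 iE symdC symd0.
  apply: connect_sub => a b /existsP[x /andP[]]; rewrite !inE => /andP[xc xz] xab.
  apply: connect1; apply/existsP; exists x; rewrite !inE xc xab andbT.
  exact: (fintype.subsetP zK).
by move/setP/(_ c); rewrite !inE eqxx cK.
Qed.

Lemma exists_kappa (c0 : Cd) : exists kap : {set T} -> Cd, forall E, E \in edges G ->
  exists p q x y, [/\ ends (kap E) p q, lam p = Some x, lam q = Some y, x != y &
                     E = [set x; y]].
Proof.
have H E : exists c : Cd, E \in edges G ->
    exists p q x y, [/\ ends c p q, lam p = Some x, lam q = Some y, x != y &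
                     E = [set x; y]].
  have [EG|] := boolP (E \in edges G); last by exists c0.
  have /forallP/(_ E) := edges_card2 G; rewrite EG /= => /cards2P[x [y [xy EE]]].
  have [|p [q [pq lp lq]]] := gm_edge gm (x := x) (y := y); first by rewrite /adj -EE.
  have [c /orP[cpq|cqp]] := gadj_ends pq; exists c => _.
    by exists p, q, x, y.
  by exists q, p, y, x; rewrite eq_sym finset.setUC.
by have [kap kapP] := choice H; exists kap.
Qed.


Let dblP (b : bool) (i : 'I_N) : (b + i.*2 < N.*2)%N.
Proof. by have := ltn_ord i; case: b; lia. Qed.

Let dbl (b : bool) (i : 'I_N) : 'I_(N.*2) := Ordinal (dblP b i).

(* A point of the refined lattice: a vertex (false, false), a horizontal or
   vertical edge, or a square (true, true) of the coarse grid. *)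
Local Notation X := ((bool * bool) * GV)%type.

Let emb (u : X) := (dbl u.1.1 u.2.1, dbl u.1.2 u.2.2).
Let eX : rel X := fun u w => king (emb u) (emb w).
Let vx (p : GV) : X := ((false, false), p).
Let cx (c : Cd) : X := ((c.1, ~~ c.1), c.2).
Let sx (s : GV) : X := ((true, true), s).

Lemma king_sym M : symmetric (@king M).
Proof.
by have [pos [g dr]] := king_planar R M; exact: (pd_sym dr).
Qed.

Lemma eX_planar : rplanar R [set: X] eX.
Proof.
have [pos [g dr]] := king_planar R N.*2.
apply: (@rplanar_map R _ _ emb [set: 'I_(N.*2) * 'I_(N.*2)] [set: X] (@king N.*2) eX) => //.
- move=> [[a b] [i j]] [[a' b'] [i' j']] _ _ [] /= E1 E2.
  have [-> ->] : a = a' /\ i = i' by split; [|apply: val_inj => /=]; move: E1; case: a; case: a'; lia.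
  by have [-> ->] : b = b' /\ j = j' by split; [|apply: val_inj => /=]; move: E2; case: b; case: b'; lia.
- by move=> u w; exact: king_sym.
by exists pos, g.
Qed.

Let corner (p s : GV) :=
  ((s.1 == p.1) || (s.1 == opred p.1)) && ((s.2 == p.2) || (s.2 == opred p.2)).

Lemma eX_corner p s : corner p s -> eX (vx p) (sx s).
Proof.
case: p s => [a b] [i j]; rewrite /corner /eX /king /near_nat -pair_eqE /pair_eq -!val_eqE /=.
rewrite !add0n !add1n /= !odd_double implybT andbT; lia.
Qed.

Lemma eX_ends c p q : ends c p q -> eX (vx p) (cx c) && eX (vx q) (cx c).
Proof.
case: c => [d [i j]]; case: p q => [a b] [a' b']; rewrite /ends /gshift /eX /king /near_nat.
rewrite -!pair_eqE /pair_eq -!val_eqE /=.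
by case: d => /=; rewrite !add0n !add1n /= !odd_double; lia.
Qed.

Lemma eX_sides c : eX (cx c) (sx c.2) && eX (cx c) (sx (sideB c)).
Proof.
case: c => [d [i j]]; rewrite /sideB /eX /king /near_nat.
rewrite -!pair_eqE /pair_eq -!val_eqE /=.
by case: d => /=; rewrite !add0n !add1n /= !odd_double; lia.
Qed.

Lemma corner_sides c p q : ends c p q ->
  [&& corner p c.2, corner p (sideB c), corner q c.2 & corner q (sideB c)].
Proof.
case: c => [d [i j]]; case: p q => [a b] [a' b']; rewrite /ends /gshift /corner /sideB.
by rewrite -!pair_eqE /pair_eq -!val_eqE /=; case: d => /=; rewrite -?val_eqE /=; lia.
Qed.

#[local] Opaque connect.

(** Faces are the classes of squares under crossing grid edges outside [K], where [K] consists of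
    spanning trees of the branch sets and one grid edge for each edge of [G]. Even edge sets of [G]
    lift to even subsets of [K], and these bound unions of classes. *)
Lemma grid_faces (x0 : T) : exists (Phi : finType) (l r : {set T} -> Phi) Vt,
  face_structure R G l r Vt.
Proof.
have [K0 [K0f K0c K0z]] := exists_forest.
have [p0 _] := gm_ex gm (finset.in_setT x0).
have [kap kapP] := exists_kappa (true, p0).
pose K := K0 :|: [set kap E | E in edges G].
pose rr : rel GV := fun s s' => [exists c, (c \notin K) &&
  (((s == c.2) && (s' == sideB c)) || ((s' == c.2) && (s == sideB c)))].
have rr_sym : symmetric rr by move=> s s'; apply: eq_existsb => c; rewrite orbC.
have csym : connect_sym rr by exact: sym_connect_sym.
pose Phi : finType := {s : GV | roots rr s}.
pose reg s : Phi := exist _ (fingraph.root rr s) (roots_root csym s).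
have regE s s' : (reg s == reg s') = connect rr s s'.
  by rewrite -val_eqE /= root_connect.
have regV (phi : Phi) : reg (val phi) = phi.
  by apply: val_inj; rewrite /=; apply/eqP; exact: (valP phi).
have regK c : c \notin K -> reg c.2 = reg (sideB c).
  move=> cK; apply/eqP; rewrite regE; apply: connect1; apply/existsP; exists c.
  by rewrite cK !eqxx.
pose l E := reg (kap E).2; pose r E := reg (sideB (kap E)).
pose Vt (phi : Phi) := [set x | [exists p, [exists s,
   [&& lam p == Some x, corner p s & reg s == phi]]]].
have endsU c p q p' q' : ends c p q -> ends c p' q' -> p = p' /\ q = q'.
  by move=> /andP[/eqP-> cq] /andP[/eqP-> cq']; split=> //; exact: gshift_inj cq cq'.
have K0E c : c \in K0 -> exists p q, [/\ ends c p q, lam p & lam p = lam q].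
  move=> /(fintype.subsetP K0f); rewrite inE => /existsP[p /existsP[q /and3P[? ? /eqP ?]]].
  by exists p, q.
have kapK0 E : E \in edges G -> kap E \notin K0.
  move=> /kapP[p [q [x [y [cpq lp lq xy _]]]]]; apply/negP => /K0E[p' [q' [cpq' _]]].
  have [<- <-] := endsU _ _ _ _ _ cpq cpq'; rewrite lp lq => -[E'].
  by rewrite E' eqxx in xy.
have kapK E : E \in edges G -> kap E \in K.
  by move=> EG; rewrite !inE imset_f ?orbT.
have kapI : {in edges G &, injective kap}.
  move=> E E' /kapP[p [q [x [y [cpq lp lq _ EE]]]]] /kapP[p' [q' [x' [y' [cpq' lp' lq' _ EE']]]]] E2.
  move: cpq'; rewrite -E2 => cpq'; have [e1 e2] := endsU _ _ _ _ _ cpq cpq'.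
  by rewrite EE EE'; move: lp' lq'; rewrite -e1 -e2 lp lq => -[->] [->].
have KE c : c \in K -> exists p q, [/\ ends c p q, lam p & lam q].
  rewrite inE => /orP[/K0E[p [q [? lp lpq]]]|/imsetP[E /kapP[p [q [x [y [? lp lq _ _]]]]] ->]].
    by exists p, q; rewrite -lpq.
  by exists p, q; rewrite lp lq.
have Kpos c : c \in K -> (0 < c.2.1)%N && (0 < c.2.2)%N.
  by move=> /KE[p [q [/andP[/eqP-> _] /(gm_pos gm)[-> ->] _]]].
pose hat (S : {set Phi}) := [set s : GV | reg s \in S].
have bdK S c : c \in bd (hat S) -> c \in K.
  by apply: contraTT => cK; rewrite !inE (regK _ cK) addbb.
have kapbd S E : (kap E \in bd (hat S)) = (l E \in S) (+) (r E \in S).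
  by rewrite !inE.
have sumK0 t c : c \in K0 -> \big[addb/false]_(w in [set w | lam w == Some t]) (w \in inc c) = false.
  by move=> /K0E[p [q [cpq lp lpq]]]; rewrite (sum_ends _ cpq) !inE lpq addbb.
have sumkap t E : E \in edges G ->
    \big[addb/false]_(w in [set w | lam w == Some t]) (w \in inc (kap E)) = (t \in E).
  move=> /kapP[p [q [x [y [cpq lp lq xy EE]]]]].
  rewrite (sum_ends _ cpq) EE !inE lp lq.
  rewrite !(inj_eq Some_inj) (eq_sym x) (eq_sym y).
  by case: (eqVneq t x) => [->|]; [rewrite (negbTE xy) | case: (t == y)].
have sumim (z : {set {set T}}) t : z \subset edges G ->
    \big[addb/false]_(c in [set kap E | E in z])
       \big[addb/false]_(w in [set w | lam w == Some t]) (w \in inc c) = (t \in odds id z).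
  move=> zE; rewrite big_imset /=; last first.
    by move=> E E' Ez Ez'; apply: kapI; exact: (fintype.subsetP zE).
  rewrite in_odds; apply: eq_bigr => E Ez; apply: sumkap; exact: (fintype.subsetP zE).
exists Phi, l, r, Vt; split.
(* In each branch set the lift [zk] is odd at an even number of points; joining them to a root
   inside the tree makes it even on the grid. *)
- move=> z zE z0; pose zk := [set kap E | E in z]; pose A := odds inc zk.
  pose rt (w : GV) : GV := if [pick p | lam p == lam w] is Some p then p else p0.
  have rtl w : lam (rt w) = lam w.
    by rewrite /rt; case: pickP => [p /eqP|/(_ w)]; rewrite ?eqxx.
  have rtE w w' : lam w = lam w' -> rt w = rt w' by move=> E; rewrite /rt E.
  have Alab w : w \in A -> lam w.
    apply: contraTT => lw; rewrite in_odds big1 // => c /imsetP[E Ez ->].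
    have [p [q [x [y [cpq lp lq _ _]]]]] := kapP _ (fintype.subsetP zE _ Ez).
    rewrite (ends_inc cpq) in_symd !inE.
    have [E1|_] := eqVneq w p; first by rewrite E1 lp in lw.
    by have [E1|_] := eqVneq w q; first by rewrite E1 lq in lw.
  have [w wA|J JK0 oJ] := root_join (@rkP K0) (rt := rt) (A := A).
    by apply: K0c; rewrite ?rtl // Alab.
  have oJA : odds inc J = A.
    apply/setP => x; rewrite oJ.
    (* A root is hit once for each odd point of its branch set, an even number of times. *)
    suff -> : \big[addb/false]_(w in A) (rt w == x) = false by rewrite addbF.
    have [[t lx]|lx] : (exists t, lam x = Some t) \/ lam x = None.
    - by case: (lam x) => [t|]; [left; exists t | right].
    - have [xx|xx] := eqVneq (rt x) x; last first.
        rewrite big1 // => w _; apply/negbTE; apply: contraNneq xx => E.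
        by apply/eqP; rewrite -E; apply: rtE; rewrite rtl.
      have : \big[addb/false]_(w in [set w | lam w == Some t]) (w \in A) = false.
        by rewrite sum_odds sumim // z0 inE.
      rewrite big_mkcond /= => H; rewrite -[RHS]H [LHS]big_mkcond; apply: eq_bigr => w _.
      have -> : (w \in [set w | lam w == Some t]) = (lam w == Some t) by rewrite inE.
      case wA: (w \in A); last by case: ifP.
      have -> : (rt w == x) = (lam w == Some t).
        apply/eqP/eqP => [E1|lw]; first by rewrite -lx -E1 rtl.
        by rewrite -xx; apply: rtE; rewrite lw lx.
      by case: ifP.
    - rewrite big1 // => w wA; apply/negbTE; apply: contraTneq (Alab w wA) => E.
      by rewrite -rtl E lx.
  pose hz := symd zk J.
  have zkK c : c \in zk -> c \in K.
    by move=> /imsetP[E Ez ->]; apply: kapK; exact: (fintype.subsetP zE).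
  have hzK c : c \in hz -> c \in K.
    rewrite in_symd; case ck: (c \in zk); first by move=> _; exact: zkK.
    by move=> /(fintype.subsetP JK0) cK0; rewrite inE cK0.
  have [||S0 bdS0] := @grid_homology hz.
  - by rewrite odds_symd oJA symdd.
  - by move=> c /hzK /Kpos.
  have S0rr s s' : rr s s' -> (s \in S0) = (s' \in S0).
    move=> /existsP[c /andP[cK cs]].
    have : c \notin bd S0 by rewrite bdS0; apply: contra cK; exact: hzK.
    rewrite inE; case/orP: cs => /andP[/eqP-> /eqP->];
      by case: (c.2 \in S0); case: (sideB c \in S0).
  have S0reg s : (val (reg s) \in S0) = (s \in S0).
    apply/eqP; rewrite /=.
    apply: (connect_closed (P := fun u => (u \in S0) == (s \in S0)) _ (connect_root rr s)) => //.
    by move=> u w /S0rr ->.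
  exists [set phi | val phi \in S0] => E EG; rewrite !inE !S0reg.
  have -> : ((kap E).2 \in S0) (+) (sideB (kap E) \in S0) = (kap E \in hz).
    by rewrite -bdS0 inE.
  have kJ : kap E \in J = false.
    by apply/negbTE; apply: contra (kapK0 E EG); exact: (fintype.subsetP JK0).
  rewrite in_symd kJ addbF; apply/idP/imsetP => [Ez|[E' Ez' /kapI EE]]; first by exists E.
  by rewrite EE //; exact: (fintype.subsetP zE).
(* Summed over a branch set, tree edges contribute nothing, so the even boundary of [hat S] yields
   the parity at [t] of the bounding edges of [G]. *)
- move=> S; apply/setP => t; rewrite [RHS]finset.in_set0.
  rewrite -sumim; last by apply/fintype.subsetP => E; rewrite inE => /andP[].
  set D := [set kap E | E in _].
  have Dbd : D = bd (hat S) :&: D.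
    apply/esym/finset.setIidPr/fintype.subsetP => c /imsetP[E + ->].
    by rewrite inE kapbd => /andP[].
  have L0 : \big[addb/false]_(w in [set w | lam w == Some t])
      (w \in odds inc (bd (hat S))) = false.
    rewrite big1 // => w; rewrite inE => /eqP lw; apply/negbTE.
    by have [|w1 w2] := gm_pos gm (p := w); [rewrite lw | exact: bd_even].
  have := sum_odds [set w | lam w == Some t] (bd (hat S)).
  rewrite L0 => /esym; rewrite (big_setID D) /= -Dbd.
  rewrite [X in _ (+) X]big1 ?addbF // => c.
  rewrite inE => /andP[cD cbd]; apply: sumK0.
  have := bdK _ _ cbd; rewrite inE => /orP[//|/imsetP[E EG Ec]].
  by case/negP: cD; apply/imsetP; exists E; rewrite // inE EG -kapbd -Ec.
- move=> E x EG; have [p [q [a [b [cpq lp lq _ EE]]]]] := kapP _ EG.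
  have /and4P[c1 c2 c3 c4] := corner_sides cpq.
  rewrite EE !inE -EE => /orP[]/eqP->; apply/andP; split; apply/existsP.
  + by exists p; apply/existsP; exists (kap E).2; rewrite lp c1 !eqxx.
  + by exists p; apply/existsP; exists (sideB (kap E)); rewrite lp c2 !eqxx.
  + by exists q; apply/existsP; exists (kap E).2; rewrite lq c3 !eqxx.
  + by exists q; apply/existsP; exists (sideB (kap E)); rewrite lq c4 !eqxx.
- move=> x; have [p lp] := gm_ex gm (finset.in_setT x); exists (reg p).
  rewrite inE; apply/existsP; exists p; apply/existsP; exists p.
  by rewrite lp /corner !eqxx.
- move=> phi.
  (* The cone is a minor of the refined grid: an edge of [K] joins the branch set of its starting
     point, while the squares of [phi] and the edges between them form the branch set of the
     apex. *)
  pose mu (u : X) : option (option T) :=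
    if u.1 == (false, false) then omap Some (lam u.2) else
    if (u.1 != (true, true)) && ((u.1.1, u.2) \in K) then omap Some (lam u.2) else
    if reg u.2 == phi then Some None else None.
  have muV p : mu (vx p) = omap Some (lam p) by [].
  have muS s : mu (sx s) = if reg s == phi then Some None else None by [].
  have muC c : mu (cx c) = if c \in K then omap Some (lam c.2) else
      if reg c.2 == phi then Some None else None.
    by rewrite /mu; case: c => -[] q.
  have shape u : [\/ exists p, u = vx p, exists c, u = cx c | exists s, u = sx s].
    case: u => -[[] []] p; [constructor 3; by exists p | constructor 2 | constructor 2 |
      constructor 1; by exists p]; [by exists (true, p) | by exists (false, p)].
  clearbody mu.
  pose rh : rel X := fun u w => eX u w && (mu u == mu w).
  have rhE u w : rh u w = eX u w && (mu u == mu w) by [].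
  clearbody rh.
  have eXs u w : eX u w = eX w u by exact: king_sym.
  have rhs : connect_sym rh.
    apply: sym_connect_sym => u w; rewrite !rhE (eXs u w) (eq_sym (mu u)).
    exact: erefl.
  have rh1 u w : eX u w -> mu u = mu w -> connect rh u w.
    by move=> uw E; apply: connect1; rewrite rhE uw E /=.
  have conV p q : lam p -> lam p = lam q -> connect rh (vx p) (vx q).
    move=> lp pq; have := K0c _ _ lp pq.
    apply: connect_map => u w /existsP[c /andP[cK0 cuw]].
    have [p' [q' [cpq lp' lpq]]] := K0E _ cK0.
    have cK : c \in K by rewrite inE cK0.
    have main : connect rh (vx p') (vx q').
      have /andP[e1 e2] := eX_ends cpq; have /andP[/eqP cp _] := cpq.
      apply: (connect_trans (y := cx c)); first by apply: rh1; rewrite // muC cK -cp.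
      by rewrite rhs; apply: rh1; rewrite // muC cK -cp muV lpq.
    case/orP: cuw => cuw; have [-> ->] := endsU _ _ _ _ _ cuw cpq; first exact: main.
    by rewrite rhs; exact: main.
  have conS s s' : reg s = phi -> reg s = reg s' -> connect rh (sx s) (sx s').
    move=> sp /eqP; rewrite regE => ss'.
    suff : (reg s' == phi) && connect rh (sx s) (sx s') by case/andP.
    apply: (connect_closed (P := fun w => (reg w == phi) && connect rh (sx s) (sx w)) _ ss');
      last by rewrite sp eqxx connect0.
    move=> u w uw /andP[/eqP up su].
    have wp : reg w = phi by rewrite -up; apply/esym/eqP; rewrite regE connect1.
    rewrite wp eqxx /=; apply: connect_trans su _.
    case/existsP: uw => c /andP[cK cs]; have /andP[e1 e2] := eX_sides c.
    have cr := regK _ cK.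
    have main : connect rh (sx c.2) (sx (sideB c)) -> connect rh (sx u) (sx w).
      by case/orP: cs => /andP[/eqP-> /eqP->] //; rewrite rhs.
    apply: main.
    have rp : reg c.2 = phi by case/orP: cs => /andP[/eqP E1 /eqP E2]; rewrite -?E1 // -E2.
    apply: (connect_trans (y := cx c)).
      by rewrite rhs; apply: rh1; rewrite // muC (negbTE cK) muS.
    by apply: rh1; rewrite // muC (negbTE cK) muS -cr rp eqxx.
  have omapS (o : option T) x : omap Some o = Some (Some x) -> o = Some x.
    by case: o => [y|] //= [->].
  have toV u x : mu u = Some (Some x) -> exists2 p, lam p = Some x & connect rh u (vx p).
    case: (shape u) => [[p ->]|[c ->]|[s ->]].
    + by rewrite muV => /omapS lp; exists p; [exact: lp | exact: connect0].
    + rewrite muC; case cK: (c \in K); last by case: (reg c.2 == phi).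
      have [p [q [cpq _ _]]] := KE _ cK; have /andP[/eqP cp _] := cpq.
      move=> /omapS lc; have /andP[e1 _] := eX_ends cpq.
      exists c.2; first exact: lc.
      rewrite -cp rhs; apply: rh1; first exact: e1.
      by rewrite muC cK muV cp.
    + by rewrite muS; case: (reg s == phi).
  have toS u : mu u = Some None -> exists2 s, reg s = phi & connect rh u (sx s).
    case: (shape u) => [[p ->]|[c ->]|[s ->]].
    + by rewrite muV; case: (lam p) => [y|] /= E; discriminate E.
    + rewrite muC; case cK: (c \in K); first by case: (lam c.2).
      case: eqP => // cp _; exists c.2 => //; have /andP[e1 _] := eX_sides c.
      by apply: rh1; rewrite // muC cK muS.
    + by rewrite muS; case: eqP => // sp _; exists s; rewrite ?connect0.
  apply: (@rplanar_minor R X _ mu [set: X] eX) => //.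
  + move=> [x|] [y|] //=; exact: adj_symm.
  + by move=> [x|] //=; exact: adj_irrefl.
  + move=> [x|] _; last by exists (sx (val phi)); rewrite muS regV eqxx.
    by have [p lp] := gm_ex gm (finset.in_setT x); exists (vx p); rewrite muV lp.
  + move=> u w; rewrite -(eq_connect rhE).
    case mu1: (mu u) => [[x|]|//] _ /esym mu2.
      have [p lp up] := toV _ _ mu1; have [q lq wq] := toV _ _ mu2.
      apply: connect_trans up _; rewrite rhs; apply: connect_trans wq _.
      by apply: conV; rewrite lq.
    have [s ss us] := toS _ mu1; have [s' ss' ws] := toS _ mu2.
    apply: connect_trans us _; rewrite rhs; apply: connect_trans ws _.
    by apply: conS; rewrite ss'.
  + have cone1 x : x \in Vt phi -> exists u w,
        [/\ eX u w, mu u = Some (Some x) & mu w = Some None].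
      rewrite inE => /existsP[p /existsP[s /and3P[/eqP lp ps /eqP sp]]].
      by exists (vx p), (sx s); rewrite eX_corner // muV lp muS sp eqxx.
    move=> [x|] [y|] //=.
    * move=> xy; have [p [q [a [b [cpq lp lq ab E]]]]] := kapP _ xy.
      have /andP[e1 e2] := eX_ends cpq; have /andP[/eqP cp _] := cpq.
      have m1 : mu (cx (kap [set x; y])) = Some (Some a) by rewrite muC kapK // -cp lp.
      have m2 : mu (vx q) = Some (Some b) by rewrite muV lq.
      have := (set21 x y, set22 x y); rewrite {1 2}E !inE.
      have nxy : x != y by apply: contraTneq xy => ->; rewrite adj_irrefl.
      case=> /orP[]/eqP Ex /orP[]/eqP Ey; subst.
      - by rewrite eqxx in nxy.
      - by exists (cx (kap [set a; b])), (vx q); rewrite eXs.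
      - by exists (vx q), (cx (kap [set b; a])).
      - by rewrite eqxx in nxy.
    * exact: cone1.
    * by move=> /cone1[u [w [uw mu1 mu2]]]; exists w, u; rewrite eXs.
  + exact: eX_planar.
(* If [S] separates the sides of no edge of [G], the boundary of [hat S] is an even subset of the
   forest, hence empty. *)
- move=> S SE; have bdK0 c : c \in bd (hat S) -> c \in K0.
    move=> cb; have := bdK _ _ cb; rewrite inE => /orP[//|/imsetP[E EG Ec]].
    by move: cb; rewrite Ec kapbd SE // addbb.
  have bd0 : bd (hat S) = finset.set0.
    apply: K0z; first by apply/fintype.subsetP.
    apply/setP => p; rewrite [RHS]finset.in_set0.
    move Elp : (lam p) => o; case: o Elp => [x|] lp.
      by apply/negbTE; have [|? ?] := gm_pos gm (p := p); [rewrite lp | exact: bd_even].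
    rewrite in_odds big1 // => c /bdK0/K0E[a [b [cab la lab]]].
    rewrite (ends_inc cab) in_symd !inE.
    have [E1|_] := eqVneq p a; first by rewrite -E1 lp in la.
    by have [E1|_] := eqVneq p b; first by rewrite lab -E1 lp in la.
  have [h0|h1] := squares_connected bd0; [left|right]; apply/setP => phi.
    by have /setP/(_ (val phi)) := h0; rewrite !inE regV.
  by have /setP/(_ (val phi)) := h1; rewrite !inE regV.
Qed.

#[local] Transparent connect.

End GridFaces.

Lemma planar_faces (R : realType) (T : finType) (G : sgraph T) (x0 : T) : planar R G ->
  exists (Phi : finType) (l r : {set T} -> Phi) Vt, face_structure R G l r Vt.
Proof.
move=> /planar_rplanar[pos [g dr]]; have [N [lam gm]] := discretize dr.
exact: grid_faces gm x0.
Qed.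

(** * Euler's inequality and its consequences *)

Lemma sum_eq1 (I : finType) (i : I) : (\sum_j (i == j) = 1)%N.
Proof.
by rewrite (bigD1 i) //= eqxx big1 // => j /negbTE ji; rewrite eq_sym ji.
Qed.

Section CycleSpace.
Variables (T : finType) (G : sgraph T).

Definition cycles : {set {set {set T}}} :=
  [set z : {set {set T}} | (z \subset edges G) && (odds id z == finset.set0)].

Lemma edge_card E : E \in edges G -> #|E| = 2%N.
Proof. by move=> EG; have /forallP/(_ E) := edges_card2 G; rewrite EG => /eqP. Qed.

Lemma edge_ends E : E \in edges G -> exists x y, x != y /\ E = [set x; y].
Proof. by move=> /edge_card/eqP/cards2P. Qed.

Lemma adj_sym : symmetric (adj G).
Proof. by move=> x y; rewrite /adj finset.setUC. Qed.

Lemma adj_irr : irreflexive (adj G).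
Proof.
move=> x; apply/negP => xx; have := edge_card xx.
by rewrite finset.setUid cards1.
Qed.

Lemma set2_symd (x y : T) : x != y -> [set x; y] = symd [set x] [set y].
Proof.
move=> xy; apply/setP => z; rewrite !inE.
by case: (eqVneq z x) => [->|]; [rewrite (negbTE xy) | case: (z == y)].
Qed.

Lemma odds_total (z : {set {set T}}) : z \subset edges G ->
  \big[addb/false]_x (x \in odds id z) = false.
Proof.
move=> /fintype.subsetP zE; under eq_bigr do rewrite in_odds.
rewrite exchange_big big1 //= => E /zE/edge_card E2.
transitivity (odd #|E|); last by rewrite E2.
rewrite -sum1_card (big_morph odd oddD (erefl : odd 0 = false)).
by rewrite [RHS]big_mkcond; apply: eq_bigr => x _; case: (x \in E).
Qed.

Lemma odds_sub1 (z : {set {set T}}) x : z \subset edges G -> odds id z :\ x = finset.set0 ->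
  odds id z = finset.set0.
Proof.
move=> zE zx; have := odds_total zE; rewrite (bigD1 x) //= big1 => [|y yx].
  rewrite addbF => xz; apply/setP => y; rewrite finset.in_set0.
  have [->//|yx] := eqVneq y x; have /setP/(_ y) := zx.
  by rewrite finset.in_setD1 finset.in_set0 yx.
by have /setP/(_ y) := zx; rewrite finset.in_setD1 finset.in_set0 yx.
Qed.

(** Rank and nullity over the field with two elements: an edge set is recovered from its boundary
    and its difference to a fixed set with that boundary. As boundaries have even size, the part
    away from [x0] suffices. *)
Lemma cycles_lower (V : {set T}) x0 : x0 \in V ->
  (forall E, E \in edges G -> E \subset V) ->
  (2 ^ #|edges G| <= #|cycles| * 2 ^ #|V|.-1)%N.
Proof.
move=> xV EV.
pose b (z : {set {set T}}) := odds id z :\ x0.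
pose rep (A : {set T}) : {set {set T}} := if [pick z : {set {set T}} | (z \subset edges G) && (b z == A)] is Some z then z
              else finset.set0.
have repP (z : {set {set T}}) : z \subset edges G -> (rep (b z) \subset edges G) && (b (rep (b z)) == b z).
  by move=> zE; rewrite /rep; case: pickP => [//|/(_ z)]; rewrite zE eqxx.
pose f (z : {set {set T}}) := (symd z (rep (b z)), b z).
have finj : {in powerset (edges G) &, injective f}.
  move=> z z' _ _ [+ bz]; rewrite bz => /(congr1 (fun A => symd A (rep (b z')))).
  by rewrite !symdK.
rewrite -card_powerset -(card_in_imset finj).
have -> : #|V|.-1 = #|V :\ x0| by rewrite [#|V|](cardsD1 x0) xV.
rewrite -card_powerset -cardsX; apply: subset_leq_card.
apply/fintype.subsetP => p /imsetP[z]; rewrite powersetE => zE ->.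
have /andP[rE /eqP rb] := repP z zE.
rewrite finset.in_setX /= powersetE; apply/andP; split.
  rewrite inE symd_sub //=; apply/eqP; apply: (odds_sub1 (x := x0)); first exact: symd_sub.
  rewrite odds_symd; apply/setP => y; have /setP/(_ y) := rb; rewrite !inE.
  by case: (y == x0) => //= ->; rewrite addbb.
apply/fintype.subsetP => y; rewrite !inE => /andP[-> yz] /=.
have : [exists E in z, y \in E].
  apply: contraTT yz => /existsPn no; rewrite big1 // => E Ez.
  by apply: negbTE; have := no E; rewrite Ez.
move=> /existsP[E /andP[Ez yE]].
by apply: (fintype.subsetP (EV E _)) => //; exact: (fintype.subsetP zE).
Qed.

Lemma cycle_deg z E x : z \in cycles -> E \in z -> x \in E ->
  exists2 F, F \in z :\ E & x \in F.
Proof.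
rewrite inE => /andP[zE /eqP z0] Ez xE.
have : [exists F in z :\ E, x \in F].
  apply: contraT => /existsPn no.
  have /setP/(_ x) := z0; rewrite !inE (big_setD1 E) //= xE big1 //= => F Fz.
  by apply: negbTE; have := no F; rewrite Fz.
by move=> /existsP[F /andP[? ?]]; exists F.
Qed.

Lemma cycles_ge3 z : z \in cycles -> z != finset.set0 -> (3 <= #|z|)%N.
Proof.
move=> zc /set0Pn[E Ez]; have zE : z \subset edges G by move: zc; rewrite inE => /andP[].
have [x [y [xy EE]]] := edge_ends (fintype.subsetP zE _ Ez).
have xE : x \in E by rewrite EE set21.
have yE : y \in E by rewrite EE set22.
have [F Fz xF] := cycle_deg zc Ez xE.
have [H Hz yH] := cycle_deg zc Ez yE.
have [FE Fz'] : F != E /\ F \in z by move: Fz; rewrite !inE => /andP[].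
have [HE Hz'] : H != E /\ H \in z by move: Hz; rewrite !inE => /andP[].
have FH : F != H.
  apply: contraNneq FE => FH; rewrite eq_sym eqEcard.
  rewrite (edge_card (fintype.subsetP zE _ Ez)) (edge_card (fintype.subsetP zE _ Fz')).
  by rewrite leqnn andbT EE finset.subUset !finset.sub1set xF FH.
rewrite (cardsD1 E) Ez (cardsD1 F) Fz (cardsD1 H) !inE eq_sym FH HE Hz'.
by [].
Qed.

Section Faces.
Variables (R : realType) (Phi : finType) (l r : {set T} -> Phi) (Vt : Phi -> {set T}).
Hypothesis fs : face_structure R G l r Vt.

Definition fbd (S : {set Phi}) : {set {set T}} :=
  [set E in edges G | (l E \in S) (+) (r E \in S)].

Lemma fbd_cycle S : fbd S \in cycles.
Proof.
rewrite inE (fc_even fs) eqxx andbT; apply/fintype.subsetP => E.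
by rewrite inE => /andP[].
Qed.

Lemma cycleE z : z \in cycles -> exists S, z = fbd S.
Proof.
rewrite inE => /andP[zE /eqP z0]; have [S SP] := fc_span fs zE z0.
exists S; apply/setP => E; rewrite inE.
have [EG|EG] /= := boolP (E \in edges G); first exact: SP.
by apply: negbTE; apply: contra EG; exact: (fintype.subsetP zE).
Qed.

Let Phi1 := [set phi | fbd [set phi] != finset.set0].

Lemma two_sided E : E \in edges G -> l E != r E -> (l E \in Phi1) && (r E \in Phi1).
Proof.
move=> EG lr; rewrite !inE; apply/andP; split; apply/set0Pn; exists E;
  by rewrite !inE EG eqxx ?(eq_sym (r E)) (negbTE lr).
Qed.

(** A set of faces and its complement have the same boundary, so [phi0] can be avoided; faces with
    empty boundary are left out. *)
Lemma cycles_upper : (exists2 z, z \in cycles & z != finset.set0) ->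
  (0 < #|Phi1|)%N /\ (#|cycles| <= 2 ^ #|Phi1|.-1)%N.
Proof.
move=> [z zc z0].
have [phi0 p0] : exists phi, phi \in Phi1.
  have [S zS] := cycleE zc; case/set0Pn: z0 => E; rewrite zS inE => /andP[EG].
  have [->|lr _] := eqVneq (l E) (r E); first by rewrite addbb.
  by exists (l E); case/andP: (two_sided EG lr).
split; first by apply/card_gt0P; exists phi0.
have -> : #|Phi1|.-1 = #|Phi1 :\ phi0| by rewrite [#|Phi1|](cardsD1 phi0) p0.
rewrite -card_powerset; apply: leq_trans (leq_imset_card fbd _).
apply: subset_leq_card; apply/fintype.subsetP => z' /cycleE[S ->].
apply/imsetP; exists ([set phi in Phi1 | (phi \in S) (+) (phi0 \in S)]).
  rewrite powersetE; apply/fintype.subsetP => phi; rewrite !inE => /andP[->].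
  by have [->|] := eqVneq phi phi0; rewrite ?addbb.
apply/setP => E; rewrite [LHS]inE [RHS]inE; case EG: (E \in edges G) => //=.
have [->|lr] := eqVneq (l E) (r E); first by rewrite !addbb.
have /andP[l1 r1] := two_sided EG lr.
rewrite [X in _ = X (+) _]inE [X in _ = _ (+) X]inE l1 r1 /=.
by case: (l E \in S); case: (r E \in S); case: (phi0 \in S).
Qed.

(** Each face in [Phi1] is bounded by a nonempty even set, and an edge borders at most two faces. *)
Lemma faces_lengths (g : nat) :
  (forall z, z \in cycles -> z != finset.set0 -> (g <= #|z|)%N) ->
  (g * #|Phi1| <= 2 * #|edges G|)%N.
Proof.
move=> gz; rewrite mulnC -sum_nat_const.
apply: (@leq_trans (\sum_(phi in Phi1) #|fbd [set phi]|)).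
  by apply: leq_sum => phi; rewrite inE => p0; apply: gz p0; exact: fbd_cycle.
apply: (@leq_trans (\sum_phi #|fbd [set phi]|)).
  by rewrite [X in (X <= _)%N]big_mkcond; apply: leq_sum => phi _; case: ifP.
under eq_bigr do rewrite -sum1_card big_mkcond.
rewrite exchange_big /= mulnC -sum_nat_const [X in (_ <= X)%N]big_mkcond /=.
apply: leq_sum => E _; have [EG|EG] := boolP (E \in edges G); last first.
  by rewrite big1 // => phi _; rewrite inE (negbTE EG).
apply: (@leq_trans (\sum_phi ((l E == phi) + (r E == phi)))).
  apply: leq_sum => phi _; rewrite !inE EG /=.
  by case: (l E == phi); case: (r E == phi).
by rewrite big_split /= !sum_eq1.
Qed.

End Faces.

(** Euler's inequality for girth [g]: comparing both counts of the cycle space bounds the number of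
    edges by [#|V| + #|Phi1| - 2], and [g * #|Phi1|] is at most twice that number. The first
    alternative is the case of a forest. *)
Lemma planar_girth (R : realType) (V : {set T}) x0 (g : nat) : planar R G -> x0 \in V ->
  (forall E, E \in edges G -> E \subset V) ->
  (forall z, z \in cycles -> z != finset.set0 -> (g <= #|z|)%N) ->
  (#|edges G| < #|V|)%N \/ (g * (#|edges G| + 2) <= 2 * #|edges G| + g * #|V|)%N.
Proof.
move=> pl xV EV gz; have low := cycles_lower xV EV.
have V0 : (0 < #|V|)%N by apply/card_gt0P; exists x0.
have [Phi [l [r [Vt fs]]]] := planar_faces x0 pl.
have [/existsP[z /andP[zc z0]]|no] := boolP [exists z in cycles, z != finset.set0].
  right; have [P0 up] := cycles_upper fs (ex_intro2 _ _ z zc z0).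
  have := leq_trans low (leq_mul up (leqnn _)); rewrite -expnD leq_exp2l // => H.
  have := faces_lengths fs gz; nia.
left; have c1 : (#|cycles| <= 1)%N.
  rewrite -(cards1 (finset.set0 : {set {set T}})); apply: subset_leq_card.
  apply/fintype.subsetP => z zc; rewrite inE; move/existsPn: no => /(_ z).
  by rewrite zc /= negbK.
have := leq_trans low (leq_mul c1 (leqnn _)); rewrite mul1n leq_exp2l //.
by move=> H; apply: leq_ltn_trans H _; rewrite prednK.
Qed.

End CycleSpace.

(** * Complete and bipartite planar graphs *)

Section Consequences.
Variable R : realType.

Lemma planar_sub (T : finType) (G G' : sgraph T) :
  edges G' \subset edges G -> planar R G -> planar R G'.
Proof.
move=> sub /planar_rplanar pl; apply: rplanar_planar.
apply: rplanar_sub pl; first exact: adj_sym.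
by move=> x y; exact: (fintype.subsetP sub).
Qed.

Section Complete.
Variables (T : finType) (A : {set T}).

Lemma complete_card2 : [forall e in [set E : {set T} | E \subset A & #|E| == 2], #|e| == 2].
Proof. by apply/forallP => E; apply/implyP; rewrite inE => /andP[]. Qed.

Definition complete := SGraph complete_card2.

Lemma complete_adj x y : adj complete x y = [&& x \in A, y \in A & x != y].
Proof.
by rewrite /adj inE finset.subUset !finset.sub1set cards2 -andbA eqSS eqb1.
Qed.

End Complete.

(** With 10 edges, 5 vertices and girth 3, Euler's inequality would read [36 <= 35]. *)
Lemma no_K5 (T : finType) (V : {set T}) (e : rel T) (A : {set T}) :
  rplanar R V e -> #|A| = 5%N ->
  (forall x y, x \in A -> y \in A -> x != y -> e x y) -> False.
Proof.
move=> pl A5 cl; have pK : planar R (complete A).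
  apply: rplanar_planar; apply: (@rplanar_dom _ _ V); first by move=> x y _; rewrite inE.
  apply: rplanar_sub pl; first exact: adj_sym.
  by move=> x y; rewrite complete_adj => /and3P[*]; exact: cl.
have [x xA] : exists x, x \in A by apply/card_gt0P; rewrite A5.
have m10 : #|edges (complete A)| = 10%N by rewrite /= cards_draws A5.
have := @planar_girth _ _ R A x 3 pK xA.
case.
- by move=> E; rewrite inE => /andP[].
- exact: cycles_ge3.
- by rewrite m10 A5.
- by rewrite m10 A5.
Qed.

(** An edge of [z] is continued at both ends, and one of the new edges once more at its far end; the
    bipartition keeps the four edges distinct. *)
Lemma bipartite_cycles (T : finType) (G : sgraph T) (L U : {set T}) :
  [disjoint L & U] ->
  (forall E, E \in edges G -> exists v u, [/\ v \in L, u \in U & E = [set v; u]]) ->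
  forall z, z \in cycles G -> z != finset.set0 -> (4 <= #|z|)%N.
Proof.
move=> dis bip z zc /set0Pn[E Ez].
have zE : z \subset edges G by move: zc; rewrite inE => /andP[].
have [v [u [vL uU EE]]] := bip _ (fintype.subsetP zE _ Ez).
have LU x y : x \in L -> y \in U -> x != y.
  by move=> xL yU; apply: contraTneq yU => <-; rewrite (disjointFr dis xL).
have [vE uE] : v \in E /\ u \in E by rewrite EE set21 set22.
have [F Fz vF] := cycle_deg zc Ez vE.
have [FE Fz'] : F != E /\ F \in z by move: Fz; rewrite !inE => /andP[].
have [v' [u' [vL' uU' FF]]] := bip _ (fintype.subsetP zE _ Fz').
have vv : v = v'.
  by move: vF; rewrite FF !inE => /orP[]/eqP // E1; have := LU _ _ vL uU'; rewrite E1 eqxx.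
have uu : u != u' by apply: contraNneq FE => uu; rewrite FF EE vv uu.
have [H Hz uH] := cycle_deg zc Ez uE.
have [HE Hz'] : H != E /\ H \in z by move: Hz; rewrite !inE => /andP[].
have u'F : u' \in F by rewrite FF set22.
have [J Jz u'J] := cycle_deg zc Fz' u'F.
have [JF Jz'] : J != F /\ J \in z by move: Jz; rewrite !inE => /andP[].
have one D a b : D \in z -> a \in D -> b \in D -> a \in U -> b \in U -> a = b.
  move=> Dz; have [c [d [cL dU ->]]] := bip _ (fintype.subsetP zE _ Dz).
  have no x : x \in U -> (x == c) = false by move=> xU; rewrite eq_sym; apply/negbTE/LU.
  by rewrite !inE => + + aU bU; rewrite !no // => /eqP-> /eqP->.
have JH : J != H.
  by apply: contraNneq uu => JH; apply/eqP; apply: (one J); rewrite // JH.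
have JE : J != E.
  by apply: contraNneq uu => JE; apply/eqP; apply: (one J); rewrite // JE.
have HF : H != F.
  by apply: contraNneq uu => HF; apply/eqP; apply: (one F); rewrite // -HF.
rewrite (cardsD1 E) Ez (cardsD1 F) Fz (cardsD1 H) !inE HF HE Hz'.
by rewrite (cardsD1 J) !inE JH JF JE Jz'.
Qed.

(** The edges at [L] form a bipartite graph with at least [3 * #|L|] edges, while girth 4 allows
    fewer than [2 * (#|L| + #|U|)]. *)
Lemma bipartite_bound (T : finType) (G : sgraph T) (L U : {set T}) : planar R G ->
  [disjoint L & U] ->
  (forall E v, E \in edges G -> v \in L -> v \in E -> exists2 u, u \in U & E = [set v; u]) ->
  (forall v, v \in L -> 3 <= #|[set E in edges G | v \in E]|)%N ->
  (#|L| <= 2 * #|U|)%N.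
Proof.
move=> pl dis LU deg3; have [->|[v0 v0L]] := set_0Vmem L; first by rewrite cards0.
have c2 : [forall e in [set E in edges G | [exists v in L, v \in E]], #|e| == 2].
  by apply/forallP => E; apply/implyP; rewrite inE => /andP[/edge_card->].
pose G' := SGraph c2.
have bip E : E \in edges G' -> exists v u, [/\ v \in L, u \in U & E = [set v; u]].
  rewrite inE => /andP[EG /existsP[v /andP[vL vE]]].
  by have [u uU EE] := LU _ _ EG vL vE; exists v, u.
have m3 : (3 * #|L| <= #|edges G'|)%N.
  rewrite mulnC -sum_nat_const.
  apply: (@leq_trans (\sum_(v in L) #|[set E in edges G | v \in E]|)); first exact: leq_sum.
  under eq_bigr do rewrite -sum1_card big_mkcond.
  rewrite exchange_big /= -sum1_card [X in (_ <= X)%N]big_mkcond /=.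
  apply: leq_sum => E _; case: ifP => [/bip[v [u [vL uU EE]]]|nE].
    rewrite (bigD1 v) //= big1 ?addn0 => [|w /andP[wL wv]]; first by case: ifP.
    rewrite inE EE !inE (negbTE wv) /=.
    have -> : (w == u) = false; last by rewrite andbF.
    by apply/negbTE; apply: contraTneq uU => <-; rewrite (disjointFr dis wL).
  rewrite big1 // => v vL; rewrite inE; case: ifP => // /andP[EG vE].
  by move: nE; rewrite inE EG /= => /existsPn/(_ v); rewrite vL vE.
have pl' : planar R G'.
  by apply: planar_sub pl; apply/fintype.subsetP => E; rewrite inE => /andP[].
have cLU : #|L :|: U| = (#|L| + #|U|)%N.
  by rewrite cardsU (disjoint_setI0 dis) cards0 subn0.
have := @planar_girth _ _ R (L :|: U) v0 4 pl'.
rewrite inE v0L cLU; case => //.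
- move=> E /bip[v [u [vL uU ->]]].
  by rewrite finset.subUset !finset.sub1set !inE vL uU orbT.
- exact: bipartite_cycles dis bip.
- lia.
- lia.
Qed.

End Consequences.

(** * Edge-maximal planar graphs *)

Section MakeGraph.
Variables (T : finType) (E : {set {set T}}).

Lemma mkgraph_card2 : [forall e in [set e in E | #|e| == 2], #|e| == 2].
Proof. by apply/forallP => e; apply/implyP; rewrite inE => /andP[]. Qed.

Definition mkgraph := SGraph mkgraph_card2.

Lemma in_mkgraph e : (e \in edges mkgraph) = (e \in E) && (#|e| == 2).
Proof. by rewrite inE. Qed.

End MakeGraph.

Section Maximal.
Variables (R : realType) (T : finType) (G : sgraph T).
Hypothesis pl : planar R G.
Hypothesis T3 : (2 < #|T|)%N.
Hypothesis mx : forall x y, x != y ->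
  planar R (mkgraph ([set x; y] |: edges G)) -> adj G x y.

Section Faces.
Variables (Phi : finType) (l r : {set T} -> Phi) (Vt : Phi -> {set T}).
Hypothesis fs : face_structure R G l r Vt.

(** Contracting the apex of the cone into [x] draws the edge from [x] to [y], which by maximality is
    already there. *)
Lemma face_clique phi x y : x \in Vt phi -> y \in Vt phi -> x != y -> adj G x y.
Proof.
move=> xV yV xy; apply: mx => //; apply: rplanar_planar.
have cx : cone_rel G (Vt phi) (Some x) None by [].
apply: (@rplanar_map R _ _ Some _ [set: T] _ _ _ _ _ _ _
   (rplanar_contract (fc_cone fs phi) cx)) => //.
- by move=> ? ? _ _ [].
- by move=> a _; rewrite !inE.
- exact: adj_sym.
- move=> a b ab; have nab : a != b by apply: contraTneq ab => ->; rewrite adj_irr.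
  have main c : c != x -> (adj (mkgraph ([set x; y] |: edges G)) x c) ->
      [exists s in [set Some x; None], cone_rel G (Vt phi) s (Some c)].
    move=> cx'; rewrite /adj in_mkgraph !inE => /andP[/orP[/eqP E|E] _]; apply/existsP.
      exists None; rewrite !inE eqxx orbT /=.
      have := set22 x c; rewrite E !inE (negbTE cx') /= => /eqP->.
      exact: yV.
    by exists (Some x); rewrite !inE eqxx.
  rewrite /hub_rel !inE !(inj_eq Some_inj) /=.
  have [ax|ax] := eqVneq a x.
    rewrite ax in ab nab; have bx : (b == x) = false by rewrite eq_sym (negbTE nab).
    by rewrite bx /= main // bx.
  have [bx|bx] := eqVneq b x.
    by rewrite bx adj_sym in ab; rewrite /= main.
  rewrite /=; move: ab; rewrite /adj in_mkgraph !inE => /andP[/orP[/eqP E|//] _].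
  have := set21 x y; rewrite -E !inE => /orP[]/eqP E1.
    by rewrite E1 eqxx in ax.
  by rewrite E1 eqxx in bx.
Qed.

(** Four vertices on one face would form a complete graph on five vertices with the apex. *)
Lemma face_card phi : (#|Vt phi| <= 3)%N.
Proof.
rewrite leqNgt; apply/negP => c4.
have [A] : exists A, A \in [set A : {set T} | A \subset Vt phi & #|A| == 4].
  by apply/card_gt0P; rewrite cards_draws bin_gt0.
rewrite inE => /andP[AV /eqP A4].
apply: (@no_K5 R _ _ _ (None |: [set Some a | a in A]) (fc_cone fs phi)).
  rewrite cardsU1 card_imset; last exact: Some_inj.
  by rewrite A4; case: imsetP => // -[].
move=> u w; rewrite !inE => /orP[/eqP->|/imsetP[a aA ->]] /orP[/eqP->|/imsetP[b bA ->]] //=.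
- by move=> _; exact: (fintype.subsetP AV).
- by move=> _; exact: (fintype.subsetP AV).
- by rewrite (inj_eq Some_inj); apply: (@face_clique phi); exact: (fintype.subsetP AV).
Qed.

(** The vertices of a face are pairwise adjacent, so each face lies in one component; faces on the
    two sides of an edge share its ends, and the dual graph is connected. *)
Lemma maximal_connected x y : connect (adj G) x y.
Proof.
have csym : connect_sym (adj G) by exact/sym_connect_sym/adj_sym.
pose S := [set phi | [exists z in Vt phi, connect (adj G) x z]].
have all_in phi z w : z \in Vt phi -> w \in Vt phi -> connect (adj G) x z ->
    connect (adj G) x w.
  move=> zV wV xz; have [<-//|zw] := eqVneq z w.
  by apply: connect_trans xz (connect1 _); exact: face_clique zV wV zw.
have SE phi z : z \in Vt phi -> (phi \in S) = connect (adj G) x z.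
  move=> zV; rewrite inE; apply/existsP/idP => [[w /andP[wV xw]]|xz].
    exact: all_in wV zV xw.
  by exists z; rewrite zV.
have [phi xphi] := fc_vert fs x; have [psi ypsi] := fc_vert fs y.
have [|S0|ST] := fc_conn fs (S := S).
- move=> E EG; have [a [b [_ EE]]] := edge_ends EG.
  have aE : a \in E by rewrite EE set21.
  by have /andP[al ar] := fc_ends fs EG aE; rewrite (SE _ _ al) (SE _ _ ar).
- by have := SE _ _ xphi; rewrite S0 inE connect0.
- by have := SE _ _ ypsi; rewrite ST inE.
Qed.

(** An edge with the same face on both sides lies in no even set. A third vertex on that face would
    give a triangle through the edge, so the face has only the two ends as vertices; then no other
    edge borders it, it is the only face, and [T] has two vertices. *)
Lemma maximal_two_sided E : E \in edges G -> l E != r E.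
Proof.
move=> EG; apply/negP => /eqP lr.
have noc z : z \in cycles G -> E \notin z.
  move=> /(cycleE fs)[S ->]; by rewrite inE lr addbb andbF.
have [u [v [uv EE]]] := edge_ends EG.
have VE : Vt (l E) \subset E.
  apply/fintype.subsetP => w wV; apply: contraT => wE.
  have [wu wv] : w != u /\ w != v by move: wE; rewrite EE !inE negb_or => /andP[].
  have uE : u \in E by rewrite EE set21.
  have vE : v \in E by rewrite EE set22.
  have /andP[uV _] := fc_ends fs EG uE; have /andP[vV _] := fc_ends fs EG vE.
  have uw : adj G u w by apply: face_clique uV wV _; rewrite eq_sym.
  have vw : adj G v w by apply: face_clique vV wV _; rewrite eq_sym.
  have Eu : E != [set u; w] by apply: contraNneq wE => ->; rewrite set22.
  have Ev : E != [set v; w] by apply: contraNneq wE => ->; rewrite set22.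
  have zc : symd [set E] (symd [set [set u; w]] [set [set v; w]]) \in cycles G.
    rewrite inE; apply/andP; split.
      by apply: symd_sub; rewrite ?finset.sub1set //; apply: symd_sub; rewrite ?finset.sub1set.
    rewrite !odds_symd !odds1 EE (set2_symd uv) (@set2_symd _ u w) 1?eq_sym //.
    rewrite (@set2_symd _ v w) 1?eq_sym //.
    by apply/eqP/setP => t; rewrite !inE; case: (t == u); case: (t == v); case: (t == w).
  by have := noc _ zc; rewrite !inE eqxx (negbTE Eu) (negbTE Ev).
have [|S0|ST] := fc_conn fs (S := [set l E]).
- have only E' : E' \in edges G -> E' \subset Vt (l E) -> E' = E.
    move=> EG' sub; apply/eqP; rewrite eqEcard (fintype.subset_trans sub VE).
    by rewrite (edge_card EG) (edge_card EG').
  move=> E' EG'; rewrite !finset.in_set1; apply/idP/idP => /eqP H; apply/eqP.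
    rewrite (only E') //.
    by apply/fintype.subsetP => x xE; rewrite -H; case/andP: (fc_ends fs EG' xE).
  rewrite (only E') //.
  by apply/fintype.subsetP => x xE; rewrite -H; case/andP: (fc_ends fs EG' xE).
- by have /setP/(_ (l E)) := S0; rewrite !inE eqxx.
have : [set: T] \subset E.
  apply/fintype.subsetP => x _; apply: (fintype.subsetP VE).
  have [phi xphi] := fc_vert fs x.
  by have /setP/(_ phi) := ST; rewrite !inE => /eqP <-.
move/subset_leq_card; rewrite cardsT (edge_card EG); by rewrite leqNgt T3.
Qed.

Lemma maximal_lengths : (2 * #|edges G| <= 3 * #|Phi|)%N.
Proof.
pose inc E phi := (l E == phi) || (r E == phi).
have two E : E \in edges G -> (\sum_phi (inc E phi : nat) = 2)%N.
  move=> /maximal_two_sided lr; under eq_bigr => phi _.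
    have -> : (inc E phi : nat) = ((l E == phi) + (r E == phi))%N.
      rewrite /inc; case: (eqVneq (l E) phi) => [<-|] //.
      by rewrite eq_sym (negbTE lr).
    over.
  by rewrite big_split /= !sum_eq1.
rewrite mulnC -sum_nat_const.
have -> : (\sum_(E in edges G) 2 = \sum_(E in edges G) \sum_phi (inc E phi : nat))%N.
  by apply: eq_bigr => E EG; rewrite two.
rewrite exchange_big /= mulnC -sum_nat_const; apply: leq_sum => phi _.
rewrite -big_mkcondr sum1_card /=.
apply: (@leq_trans #|[set E : {set T} | E \subset Vt phi & #|E| == 2]|).
  apply: subset_leq_card; apply/fintype.subsetP => E; rewrite !inE => /andP[EG H].
  rewrite (edge_card EG) eqxx andbT; apply/fintype.subsetP => x xE.
  by case/andP: (fc_ends fs EG xE) => xl xr; case/orP: H => /eqP <-.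
by rewrite cards_draws; have := face_card phi; case: #|Vt phi| => [|[|[|[|]]]].
Qed.

(** The counts behind Euler's inequality, reversed: sets of faces avoiding [phi0] have distinct
    boundaries as the dual graph is connected, and every boundary away from [x0] is attained as [G]
    is connected. *)
Lemma maximal_faces : (#|Phi| + #|T| <= #|edges G| + 2)%N.
Proof.
have [x0 _] : exists x0 : T, x0 \in T by apply/card_gt0P; exact: leq_ltn_trans (leq0n 2) T3.
have [phi0 _] := fc_vert fs x0.
have up : (2 ^ #|Phi|.-1 <= #|cycles G|)%N.
  have -> : #|Phi|.-1 = #|[set: Phi] :\ phi0|.
    by rewrite -cardsT [#|[set: Phi]|](cardsD1 phi0) inE.
  rewrite -card_powerset -(@card_in_imset _ _ (fbd G l r)).
    apply: subset_leq_card; apply/fintype.subsetP => z /imsetP[S _ ->].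
    exact: fbd_cycle fs S.
  move=> S S'; rewrite !powersetE => S0 S0' /setP E.
  have nS (D : {set Phi}) : D \subset [set: Phi] :\ phi0 -> phi0 \in D = false.
    by move=> sub; apply/negbTE/negP => /(fintype.subsetP sub); rewrite !inE eqxx.
  have [|D0|DT] := fc_conn fs (S := symd S S').
  - move=> F FG; have := E F; rewrite !inE FG /=.
    by case: (_ \in S); case: (_ \in S); case: (_ \in S'); case: (_ \in S').
  - exact: symd_eq0.
  - by have /setP/(_ phi0) := DT; rewrite in_symd (nS S S0) (nS S' S0') inE.
have low : (#|cycles G| * 2 ^ #|T|.-1 <= 2 ^ #|edges G|)%N.
  have rK u w : adj G u w -> exists2 E, E \in edges G & id E = symd [set u] [set w].
    move=> uw; exists [set u; w] => //; apply: set2_symd.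
    by apply: contraTneq uw => ->; rewrite adj_irr.
  have /choice[J JP] : forall A : {set T}, exists J : {set {set T}},
      J \subset edges G /\ odds id J :\ x0 = A :\ x0.
    move=> A; have [w _|J JE JA] := root_join rK (rt := fun=> x0) (A := A).
      exact: maximal_connected.
    exists J; split => //; apply/setP => x; rewrite !in_setD1 JA.
    have [//|xx] := eqVneq x x0; by rewrite big1 ?addbF.
  have -> : #|T|.-1 = #|[set: T] :\ x0|.
    by rewrite -cardsT [#|[set: T]|](cardsD1 x0) inE.
  rewrite -!card_powerset -cardsX.
  pose f (p : {set {set T}} * {set T}) := symd p.1 (J p.2).
  rewrite -(@card_in_imset _ _ f).
    apply: subset_leq_card; apply/fintype.subsetP => z /imsetP[[z' A]].
    rewrite finset.in_setX /= => /andP[]; rewrite inE => /andP[zE _] _ ->.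
    by rewrite powersetE symd_sub //; case: (JP A).
  move=> [z A] [z' A']; rewrite !finset.in_setX !powersetE /= !inE.
  move=> /andP[/andP[_ /eqP z0] Ax] /andP[/andP[_ /eqP z0'] Ax'] fE.
  have D (B : {set T}) : B \subset [set: T] :\ x0 -> B :\ x0 = B.
    by move=> sub; apply/finset.setDidPl; rewrite disjoint_sym disjoints1;
      apply/negP => /(fintype.subsetP sub); rewrite !inE eqxx.
  have s0d (B : {set T}) : symd finset.set0 B = B by rewrite symdC symd0.
  have AA : A = A'.
    have := congr1 (fun z => odds id z :\ x0) fE; rewrite /f /= !odds_symd z0 z0'.
    rewrite !s0d; case: (JP A) => _ ->; case: (JP A') => _ ->.
    by rewrite (D A Ax) (D A' Ax').
  move: fE; rewrite /f /= AA => /(congr1 (fun z => symd z (J A'))).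
  by rewrite !symdK => ->.
have := leq_trans (leq_mul up (leqnn _)) low.
rewrite -expnD leq_exp2l //; have P0 : (0 < #|Phi|)%N by apply/card_gt0P; exists phi0.
lia.
Qed.

End Faces.

Lemma maximal_edges : (3 * #|T| <= #|edges G| + 6)%N.
Proof.
have [x0 _] : exists x0 : T, x0 \in T by apply/card_gt0P; exact: leq_ltn_trans (leq0n 2) T3.
have [Phi [l [r [Vt fs]]]] := planar_faces x0 pl.
have := maximal_lengths fs; have := maximal_faces fs; lia.
Qed.

End Maximal.

Lemma planar_extend (R : realType) (T : finType) (G : sgraph T) : planar R G ->
  (2 < #|T|)%N -> exists G' : sgraph T,
  [/\ edges G \subset edges G', planar R G' & (3 * #|T| <= #|edges G'| + 6)%N].
Proof.
move=> pl T3; pose P (G' : sgraph T) := `[< planar R G' >] && (edges G \subset edges G').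
have PG : P G by rewrite /P subxx andbT; apply/asboolP.
have [G' /andP[/asboolP pl' sub] max] := @arg_maxnP _ G P (fun G => #|edges G|) PG.
exists G'; split => //; apply: maximal_edges pl' T3 _ => x y xy pxy.
set H := mkgraph _ in pxy.
have subH : edges G' \subset edges H.
  by apply/fintype.subsetP => E EG; rewrite in_mkgraph !inE EG orbT (edge_card EG).
have := max H; rewrite /P (fintype.subset_trans sub subH) andbT.
rewrite (introT (asboolP _) pxy) => /(_ isT) le.
have /eqP EH : edges G' == edges H by rewrite eqEcard subH.
by rewrite /adj EH in_mkgraph !inE eqxx cards2 xy.
Qed.

(** * Components and edge modifications *)

Section Counting.

Lemma card_cover2 (T : finType) (D : {set {set T}}) :
  (forall E, E \in D -> #|E| <= 2)%N -> (#|finset.cover D| <= 2 * #|D|)%N.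
Proof.
move=> D2; rewrite /finset.cover; apply: (@leq_trans (\sum_(E in D) #|E|)).
  exact: leq_card_cover.
by rewrite mulnC -sum_nat_const; apply: leq_sum.
Qed.

End Counting.

Section Components.
Variables (n h : nat) (H : sgraph 'I_h).
Implicit Types (G : sgraph 'I_n) (W C : {set 'I_n}).

Lemma componentsP G C :
  reflect (exists x, C = [set y | connect (adj G) x y]) (C \in components G).
Proof.
apply: (iffP imsetP) => -[x].
  by move=> _ ->; exists x; apply/setP => y; rewrite !inE.
by move=> ->; exists x; rewrite ?inE //; apply/setP => y; rewrite !inE.
Qed.

(* Vertices of [W] are held in reserve: their components are not counted. *)
Definition copies G W : {set {set 'I_n}} :=
  [set C in components G | order_preserving_iso G H C & [disjoint C & W]].

Lemma copies0 G : #|copies G finset.set0| = num_components G H.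
Proof.
apply: eq_card => C; rewrite !inE; congr (_ && _).
have -> : [disjoint C & finset.set0] by rewrite disjoint_sym finset.disjoints_subset finset.sub0set.
by rewrite andbT.
Qed.

Lemma component_untouched G G' (C : {set 'I_n}) :
  (forall E, E \in symd (edges G) (edges G') -> [disjoint E & C]) ->
  C \in components G -> C \in components G'.
Proof.
move=> unt /componentsP[x CE]; apply/componentsP; exists x.
have same u w : u \in C -> adj G u w = adj G' u w.
  move=> uC; rewrite /adj; have := unt [set u; w]; rewrite in_symd.
  case: (_ \in edges G); case: (_ \in edges G') => //= /(_ isT) d;
    by move: (disjointFr d (set21 u w)); rewrite uC.
rewrite CE; apply/setP => y; rewrite !inE; apply/idP/idP => xy.
  suff : (y \in C) && connect (adj G') x y by case/andP.
  apply: (connect_closed (P := fun y => (y \in C) && connect (adj G') x y) _ xy).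
    move=> u w uw /andP[uC xu]; have uw' : adj G' u w by rewrite -same.
    rewrite (connect_trans xu (connect1 uw')) andbT.
    by move: uC; rewrite CE !inE => /connect_trans; apply; exact: connect1.
  by rewrite CE inE !connect0.
suff : y \in C by rewrite CE inE.
apply: (connect_closed (P := fun y => y \in C) _ xy); last by rewrite CE inE connect0.
move=> u w uw uC; have uw' : adj G u w by rewrite same.
by move: uC; rewrite CE !inE => /connect_trans; apply; exact: connect1.
Qed.

Lemma iso_untouched G G' (C : {set 'I_n}) :
  (forall E, E \in symd (edges G) (edges G') -> [disjoint E & C]) ->
  order_preserving_iso G H C -> order_preserving_iso G' H C.
Proof.
move=> unt /existsP[f /and3P[mono /eqP CE iso]]; apply/existsP; exists f.
rewrite mono CE eqxx /=; apply/forallP => i; apply/forallP => j.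
have /forallP/(_ i)/forallP/(_ j)/eqP <- := iso; apply/eqP; rewrite /adj.
have iC : f i \in C by rewrite CE imset_f.
have := unt [set f i; f j]; rewrite in_symd.
case: (_ \in edges G); case: (_ \in edges G') => //= /(_ isT) d;
  by move: (disjointFr d (set21 (f i) (f j))); rewrite iC.
Qed.

(** A copy that is lost contains an end of a changed edge or a newly reserved vertex, and different
    copies are disjoint. *)
Lemma copies_change G G' W W' :
  (#|copies G W| <= #|copies G' W'| +
     (2 * #|symd (edges G) (edges G')| + #|W' :\: W|))%N.
Proof.
set D := symd _ _; pose X := finset.cover D :|: (W' :\: W).
have XB : (#|X| <= 2 * #|D| + #|W' :\: W|)%N.
  apply: leq_trans (leq_card_setU _ _) _; rewrite leq_add2r card_cover2 // => E.
  rewrite in_symd; case EG: (E \in edges G); first by rewrite (edge_card EG).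
  by move=> EG'; rewrite (edge_card EG').
apply: leq_trans (leq_add (leqnn _) XB).
pose Bad := copies G W :\: copies G' W'.
have -> : #|copies G W| = (#|copies G W :&: copies G' W'| + #|Bad|)%N by rewrite cardsID.
apply: leq_add; first by apply: subset_leq_card; exact: subsetIr.
have meet C : C \in Bad -> C :&: X != finset.set0.
  move=> /setDP[]; rewrite inE => /and3P[Cc Ci CW] nC; apply: contraNneq nC => CX.
  have noX x : x \in C -> x \notin X.
    by move=> xC; apply: contraTN isT => xX; have /setP/(_ x) := CX; rewrite finset.in_setI xC xX inE.
  have unt E : E \in D -> [disjoint E & C].
    move=> ED; rewrite disjoint_sym finset.disjoints_subset; apply/fintype.subsetP => x xC.
    rewrite inE; apply: contra (noX x xC) => xE.
    by rewrite inE; apply/orP; left; apply/bigcupP; exists E.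
  rewrite inE (component_untouched unt Cc) (iso_untouched unt Ci) /=.
  rewrite finset.disjoints_subset; apply/fintype.subsetP => x xC; rewrite inE.
  apply: contra (noX x xC) => xW; rewrite !inE xW andbT; apply/orP; right.
  by rewrite (disjointFr CW xC).
pose rep (C : {set 'I_n}) : option 'I_n := [pick x in C :&: X].
have repP C : C \in Bad -> exists2 x, rep C = Some x & x \in C :&: X.
  move=> /meet/set0Pn[x xCX]; rewrite /rep; case: pickP => [y yCX|/(_ x)].
    by exists y.
  by rewrite xCX.
have inj : {in Bad &, injective rep}.
  move=> C C' CB CB'; have [x -> xC] := repP _ CB; have [y -> yC'] := repP _ CB'.
  move=> [xy]; rewrite -xy in yC'.
  move: xC yC' CB CB'; rewrite !finset.in_setI => /andP[xC _] /andP[xC' _].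
  move=> /setDP[+ _] /setDP[+ _]; rewrite !inE => /andP[/componentsP[a aE] _] /andP[/componentsP[b bE] _].
  have cs : connect_sym (adj G) by exact/sym_connect_sym/adj_sym.
  move: xC xC'; rewrite aE bE !inE => ax bx; apply/setP => u; rewrite !inE.
  by rewrite (same_connect cs ax) (same_connect cs bx).
have sinj : injective (@Some 'I_n) by move=> ? ? [].
rewrite -(card_in_imset inj) -(card_imset (mem X) sinj).
apply: subset_leq_card; apply/fintype.subsetP => o /imsetP[C CB ->].
have [x -> xCX] := repP _ CB; apply: imset_f; by move: xCX; rewrite finset.in_setI => /andP[].
Qed.

End Components.

(** * Adding edges and contracting low-degree vertices *)

Section Away.
Variables (R : realType) (T : finType).
Implicit Types (G : sgraph T) (W : {set T}).

Definition isolated G W := [forall E in edges G, [disjoint E & W]].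

Lemma isolatedP G W :
  reflect (forall E, E \in edges G -> [disjoint E & W]) (isolated G W).
Proof. exact: 'forall_in_idP. Qed.

Lemma isolated_adj G W x y : isolated G W -> adj G x y -> x \notin W.
Proof. by move=> /isolatedP H /H d; rewrite (disjointFr d (set21 x y)). Qed.

(** No edge may touch the reserve, so the extension is made in the subgraph induced on its
    complement. *)
Lemma planar_extend_away G W : planar R G -> isolated G W ->
  (#|W| + 2 < #|T|)%N -> exists G' : sgraph T, [/\ edges G \subset edges G',
    planar R G', isolated G' W & (3 * (#|T| - #|W|) <= #|edges G'| + 6)%N].
Proof.
move=> pl iso W2; pose T' : finType := {x : T | x \notin W}.
have cT' : #|T'| = (#|T| - #|W|)%N.
  by rewrite card_sig -(cardC (mem W)) addKn; apply: eq_card => x; rewrite !inE.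
pose im (E : {set T'}) : {set T} := [set val x | x in E].
pose G1 : sgraph T' := mkgraph [set E | im E \in edges G].
have imc (E : {set T'}) : #|im E| = #|E| by rewrite card_imset //; exact: val_inj.
have im2 (x y : T') : im [set x; y] = [set val x; val y].
  by rewrite /im imsetU1 imset_set1.
have pl1 : planar R G1.
  apply: rplanar_planar.
  apply: (@rplanar_map R _ _ (val : T' -> T) [set: T] [set: T'] (adj G) (adj G1)).
  - by move=> x y _ _; exact: val_inj.
  - by move=> x _; rewrite inE.
  - exact: adj_sym.
  - by move=> x y _; rewrite inE.
  - by move=> x y; rewrite /adj in_mkgraph inE im2 => /andP[].
  - exact: planar_rplanar.
have [|G2 [sub pl2 e2]] := planar_extend pl1; first by rewrite cT'; lia.
pose G' : sgraph T := mkgraph [set im E | E in edges G2].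
have inj : injective im by apply: imset_inj; exact: val_inj.
have G'E E : E \in edges G' -> exists2 F, F \in edges G2 & E = im F.
  by rewrite in_mkgraph => /andP[/imsetP[F ? ->] _]; exists F.
have imG' F : F \in edges G2 -> im F \in edges G'.
  by move=> FG; rewrite in_mkgraph imset_f //= imc (edge_card FG).
exists G'; split.
- apply/fintype.subsetP => E EG; have d := isolatedP _ _ iso E EG.
  pose F : {set T'} := [set x | val x \in E].
  have EF : E = im F.
    apply/setP => x; apply/idP/imsetP => [xE|[y]]; last by rewrite inE => yE ->.
    have xW : x \notin W by rewrite (disjointFr d xE).
    by exists (Sub x xW : T'); rewrite ?inE.
  rewrite EF; apply: imG'; apply: (fintype.subsetP sub).
  by rewrite in_mkgraph inE -EF EG -imc -EF (edge_card EG).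
- apply: rplanar_planar; have [E0|[E1 E1G]] := set_0Vmem (edges G').
    apply: (@rplanar_sub R _ _ (fun _ _ => false)); first exact: adj_sym.
      by move=> x y; rewrite /adj E0 inE.
    exact: rplanar_discrete.
  have [F1 F1G _] := G'E _ E1G; have [t0 [_ [_ _]]] := edge_ends F1G.
  apply: (@rplanar_dom R _ (~: W)); first by move=> x y _; rewrite inE.
  apply: (@rplanar_map R _ _ (insubd t0) [set: T'] (~: W) (adj G2) (adj G')).
  - move=> x y; rewrite !inE => xW yW /(congr1 val).
    by rewrite !insubdK // unfold_in.
  - by move=> x _; rewrite inE.
  - exact: adj_sym.
  - move=> x y /G'E[F _ E]; rewrite inE; have := set21 x y; rewrite E => /imsetP[z _ ->].
    exact: (valP z).
  - move=> x y /G'E[F FG E]; rewrite /adj.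
    suff -> : [set insubd t0 x; insubd t0 y] = F by [].
    apply: inj; rewrite im2 -E.
    have nW u : u \in [set x; y] -> val (insubd t0 u : T') = u.
      by rewrite E => /imsetP[z _ ->]; rewrite valKd.
    by rewrite !nW ?set21 ?set22.
  - exact: planar_rplanar.
- apply/isolatedP => E /G'E[F _ ->]; rewrite finset.disjoints_subset.
  by apply/fintype.subsetP => x /imsetP[z _ ->]; rewrite inE; exact: (valP z).
- rewrite -cT'; apply: leq_trans e2 _; rewrite leq_add2r -(card_imset _ inj).
  by apply: subset_leq_card; apply/fintype.subsetP => E /imsetP[F FG ->]; exact: imG'.
Qed.

(* [contr G a v] contracts the edge [av] into [a] and leaves [v] isolated. *)
Definition contr G a v : sgraph T := mkgraph ([set E in edges G | v \notin E] :|: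
  [set [set a; u] | u in [set u | adj G v u && (u != a)]]).

Lemma contr_adj G a v x y : adj G a v -> adj (contr G a v) x y =
  hub_rel (adj G) [set a; v] a x y.
Proof.
move=> av; have nav : a != v by apply: contraTneq av => ->; rewrite adj_irr.
have exE u : [exists s in [set a; v], adj G s u] = adj G a u || adj G v u.
  apply/existsP/orP => [[s]|[au|vu]].
  - by rewrite !inE => /andP[/orP[]/eqP-> ?]; [left|right].
  - by exists a; rewrite !inE eqxx.
  - by exists v; rewrite !inE eqxx orbT.
have half u : (u \notin [set a; v]) && (adj G a u || adj G v u) = adj (contr G a v) a u.
  rewrite /adj in_mkgraph !inE negb_or; apply/idP/idP.
    move=> /andP[/andP[ua uv] H]; rewrite cards2 (eq_sym a u) ua andbT.
    case/orP: H => H; apply/orP; [left|right]; first by rewrite H ?negb_or (eq_sym v a) nav (eq_sym v u) uv.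
    by apply/imsetP; exists u; rewrite // inE /adj H ua.
  move=> /andP[/orP[/andP[au]|/imsetP[w]]].
    rewrite negb_or => /andP[_ vu] c2; rewrite au /= andbT (eq_sym u v) vu andbT.
    by apply: contraTneq au => ->; have := adj_irr G a; rewrite /adj => ->.
  rewrite inE => /andP[vw wa] E _; have uw : u = w.
    have := set22 a w; rewrite -E !inE (negbTE wa) => /eqP ->.
    by [].
  rewrite /adj in vw; rewrite uw wa vw orbT andbT /=; apply: contraTneq vw => ->.
  by have := adj_irr G v; rewrite /adj => ->.
rewrite /hub_rel !exE; case: (eqVneq x a) => [->|xa]; first by rewrite half.
case: (eqVneq y a) => [->|ya]; first by rewrite half adj_sym.
rewrite !inE (negbTE xa) (negbTE ya) /= {1}/adj in_mkgraph !inE.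
apply/idP/idP.
  move=> /andP[/orP[/andP[xy]|/imsetP[w]]].
    by rewrite negb_or (eq_sym v) (eq_sym v) /adj xy => /andP[-> ->].
  rewrite inE => _ E _; have := set21 a w; rewrite -E !inE eq_sym (negbTE xa).
  by rewrite eq_sym (negbTE ya).
move=> /and3P[xv yv xy]; rewrite (edge_card xy) eqxx andbT.
by apply/orP; left; rewrite [_ \in _]xy (eq_sym v) (negbTE xv) (eq_sym v) (negbTE yv).
Qed.

Lemma contr_planar G a v : planar R G -> adj G a v -> planar R (contr G a v).
Proof.
move=> /planar_rplanar pl av; apply: rplanar_planar.
apply: (@rplanar_dom R _ ([set: T] :\ v)); first by move=> x y _; rewrite inE.
apply: rplanar_sub (rplanar_contract pl av); first exact: adj_sym.
by move=> x y; rewrite contr_adj.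
Qed.

Definition deg G v := #|[set E in edges G | v \in E]|.
Definition nbrs G v := [set u | adj G v u].

Lemma card_nbrs G v : #|nbrs G v| = deg G v.
Proof.
have inj : {in nbrs G v &, injective (fun u => [set v; u])}.
  move=> x y; rewrite !inE => vx vy E; have := set22 v x; rewrite E !inE.
  case/orP => /eqP // xv; move: vx; by rewrite xv adj_irr.
rewrite -(card_in_imset inj); apply: eq_card => E; rewrite inE.
apply/imsetP/andP => [[u]|[EG vE]]; first by rewrite inE => vu ->; rewrite set21.
have [x [y [xy EE]]] := edge_ends EG; move: vE; rewrite EE !inE => /orP[]/eqP E1.
  by exists y; rewrite ?inE E1 /adj -EE.
by exists x; rewrite ?inE E1 /adj (finset.setUC [set y]) -EE.
Qed.

Lemma sum_deg G : (\sum_v deg G v = 2 * #|edges G|)%N.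
Proof.
under eq_bigr do rewrite /deg -sum1_card big_mkcond.
rewrite exchange_big /= mulnC -sum_nat_const [RHS]big_mkcond; apply: eq_bigr => E _.
case EG: (E \in edges G); last by rewrite big1 // => v _; rewrite inE EG.
rewrite -(edge_card EG) -sum1_card [RHS]big_mkcond; apply: eq_bigr => v _.
by rewrite inE EG.
Qed.

(* An edge set splits into the edges at [v], those at [a] and the others, and
   contraction leaves the others unchanged. *)
Definition uncontr (G' : sgraph T) a v (A1 A2 : {set T}) : sgraph T :=
  mkgraph ([set E in edges G' | a \notin E] :|: [set [set a; v]] :|:
    [set [set v; x] | x in A1] :|: [set [set a; x] | x in A2]).

Lemma contrK G a v : adj G a v ->
  uncontr (contr G a v) a v (nbrs G v :\ a) (nbrs G a :\ v) = G.
Proof.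
move=> av; have nav : a != v by apply: contraTneq av => ->; rewrite adj_irr.
apply: val_inj; apply/setP => E /=; rewrite inE; apply/idP/idP.
  move=> /andP[]; rewrite !inE -!orbA => /or4P[/andP[]|/eqP->|/imsetP[x]|/imsetP[x]] //.
  - move=> /andP[/orP[/andP[//]|/imsetP[u _ ->]] _].
    by rewrite set21.
  - by rewrite !inE => /andP[_ vx] ->.
  - by rewrite !inE => /andP[_ vx] ->.
move=> EG; rewrite (edge_card EG) eqxx andbT !inE -!orbA.
have [aE|aE] := boolP (a \in E).
  have [x [y [xy EE]]] := edge_ends EG.
  have {xy EE}[u EE] : exists u, E = [set a; u].
    move: aE; rewrite EE !inE => /orP[]/eqP->; [by exists y | exists x].
    by rewrite finset.setUC.
  have [uv|uv] := eqVneq u v; first by rewrite EE uv eqxx orbT.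
  apply/or4P; constructor 4; apply/imsetP; exists u => //.
  by rewrite !inE uv /adj -EE.
have [vE|vE] := boolP (v \in E); last first.
  by rewrite (edge_card EG) EG /=.
have [x [y [xy EE]]] := edge_ends EG.
have {xy EE}[u EE] : exists u, E = [set v; u].
  move: vE; rewrite EE !inE => /orP[]/eqP->; [by exists y | exists x].
  by rewrite finset.setUC.
apply/or4P; constructor 3; apply/imsetP; exists u => //.
rewrite !inE /adj -EE EG andbT; apply: contraNneq aE => <-; by rewrite EE set22.
Qed.

End Away.

(** * Counting by switchings *)

Section Bounds.

Lemma double_count (X Y : finType) (A : {set X}) (B : {set Y}) (r : X -> Y -> bool)
    (Q a b : nat) :
  (forall x, x \in A -> a <= Q * #|[set y in B | r x y]|)%N ->
  (forall y, y \in B -> #|[set x in A | r x y]| <= b)%N ->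
  (a * #|A| <= Q * b * #|B|)%N.
Proof.
move=> Ha Hb; rewrite mulnC -sum_nat_const.
apply: (@leq_trans (\sum_(x in A) Q * \sum_(y in B) (r x y : nat))).
  apply: leq_sum => x xA; apply: leq_trans (Ha x xA) _; rewrite leq_mul2l; apply/orP; right.
  rewrite -sum1_card -big_mkcondr /=; apply: eq_leq; apply: eq_bigl => y.
  by rewrite inE.
rewrite -big_distrr /= -mulnA leq_mul2l; apply/orP; right.
rewrite exchange_big /= mulnC -sum_nat_const; apply: leq_sum => y yB; apply: leq_trans (Hb y yB).
rewrite -sum1_card -big_mkcondr /=; apply: eq_leq; apply: eq_bigl => x.
by rewrite inE.
Qed.

Lemma card_inj_le (X Y : finType) (D : {set X}) (f : X -> Y) (B : {set Y}) :
  {in D &, injective f} -> (forall x, x \in D -> f x \in B) -> (#|D| <= #|B|)%N.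
Proof.
move=> fI fB; rewrite -(card_in_imset fI); apply: subset_leq_card.
by apply/fintype.subsetP => y /imsetP[x xD ->]; exact: fB.
Qed.

Lemma card_code_le (X Y : finType) (A : {set X}) (D : {set Y}) (f : Y -> X) :
  (forall x, x \in A -> exists2 y, y \in D & x = f y) -> (#|A| <= #|D|)%N.
Proof.
move=> H; apply: leq_trans (leq_imset_card f D); apply: subset_leq_card.
by apply/fintype.subsetP => x /H[y yD ->]; exact: imset_f.
Qed.

Lemma card_dep (X Y : finType) (P : {set X}) (Q : X -> {set Y}) :
  #|[set p : X * Y | (p.1 \in P) && (p.2 \in Q p.1)]| = (\sum_(x in P) #|Q x|)%N.
Proof.
rewrite -sum1dep_card -(pair_big_dep (mem P) (fun x => mem (Q x)) (fun _ _ => 1%N)) /=.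
by apply: eq_bigr => x _; rewrite sum1_card.
Qed.

(** Markov's inequality for the counting measure. *)
Lemma card_large (X : finType) (f : X -> nat) c :
  (c * #|[set x | c <= f x]| <= \sum_x f x)%N.
Proof.
rewrite mulnC -sum_nat_const.
apply: leq_trans (_ : \sum_(x in [set x | c <= f x]) f x <= _)%N.
  by apply: leq_sum => x; rewrite inE.
by rewrite [leqRHS](bigID (mem [set x | (c <= f x)%N])) leq_addr.
Qed.

Lemma many_addable q m n k X : (12 * q * k + 12 * q + k + 3 <= n)%N ->
  (q * m + n <= 3 * q * n)%N -> (3 * n <= X + m + 3 * k + 6)%N -> (n <= 2 * q * X)%N.
Proof.
move=> nb qm lb; have := leq_mul (leqnn q) lb; lia.
Qed.

End Bounds.

Section Switch.
Variables (R : realType) (n : nat) (lev : nat -> sgraph 'I_n -> {set 'I_n} -> bool).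
Hypothesis lev_step : forall s G W G' W', lev s G W ->
  (#|symd (edges G) (edges G')| <= 12)%N -> (#|symd W W'| <= 1)%N -> lev s.+1 G' W'.
Implicit Types (G : sgraph 'I_n) (W : {set 'I_n}).

(** Graphs with a reserve of [k] isolated vertices. [lev] stays abstract; its index counts the steps
    made so far, each changing at most 12 edges and one reserved vertex. A contraction of a vertex
    of degree at most 5 changes at most 10 edges. *)
Definition states s k m : {set sgraph 'I_n * {set 'I_n}} :=
  [set X | [&& `[< planar R X.1 >], #|edges X.1| == m, isolated X.1 X.2, #|X.2| == k
     & lev s X.1 X.2]].

Lemma statesP s k m G W : reflect [/\ planar R G, #|edges G| = m, isolated G W, #|W| = k
  & lev s G W] ((G, W) \in states s k m).
Proof.
by rewrite inE /=; apply: (iffP and5P) => [[/asboolP ? /eqP ? ? /eqP]|[? /eqP ? ? /eqP ?]];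
  split => //; apply/asboolP.
Qed.

Lemma states_mono s s' k m : (s <= s')%N -> states s k m \subset states s' k m.
Proof.
move=> /subnK <-; elim: (s' - s)%N => // j IH; apply: fintype.subset_trans IH _.
apply/fintype.subsetP => -[G W] /statesP[pl e i w lv]; apply/statesP; split => //.
by apply: lev_step lv _ _; rewrite symdd cards0.
Qed.

Variables q k : nat.
Hypothesis q0 : (0 < q)%N.
Hypothesis n_big : (12 * q * k + 12 * q + k + 3 <= n)%N.

(** At least [n / (2 * q)] edges can be added, and a result arises from at most [m + 1 <= 3 * n]
    graphs, by the choice of the edge to delete. *)
Lemma states_add s m : (q * m + n <= 3 * q * n)%N ->
  (#|states s k m| <= 6 * q * #|states s.+1 k m.+1|)%N.
Proof.
move=> qm; have n0 : (0 < n)%N by lia.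
pose r (X Y : sgraph 'I_n * {set 'I_n}) := (X.2 == Y.2) && [exists E in edges Y.1,
  edges X.1 == edges Y.1 :\ E].
suff H : (n * #|states s k m| <= 2 * q * (3 * n) * #|states s.+1 k m.+1|)%N.
  by rewrite -(leq_pmul2l n0); apply: leq_trans H _; apply: eq_leq; lia.
apply: (double_count (r := r)).
- move=> [G W] /statesP[pl em iso Wk lv].
  have [|G' [sub pl' iso' eG']] := planar_extend_away pl iso; first by rewrite card_ord; lia.
  pose f E : sgraph 'I_n * {set 'I_n} := (mkgraph (E |: edges G), W).
  have fE E : E \in edges G' :\: edges G -> edges (f E).1 = E |: edges G.
    move=> /setDP[EG' _]; apply/setP => F; rewrite in_mkgraph !inE.
    by case: eqVneq => [->|_] /=; [rewrite (edge_card EG') | case FG: (F \in _); rewrite ?(edge_card FG)].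
  have cD : (#|edges G' :\: edges G| + m = #|edges G'|)%N.
    by rewrite -em -[#|edges G'|](cardsID (edges G)) addnC (finset.setIidPr sub).
  have le : (#|edges G' :\: edges G| <= #|[set Y in states s.+1 k m.+1 | r (G, W) Y]|)%N.
    apply: (card_inj_le (f := f)).
      move=> E F ED FD /(congr1 (fun Y => edges Y.1)); rewrite !fE // => /setP/(_ E).
      rewrite !inE eqxx /=; move/setDP: ED => [_ /negbTE ->]; rewrite orbF.
      by move=> /esym/eqP.
    move=> E ED; have := fE E ED; have /setDP[EG' nE] := ED.
    rewrite inE; have -> : f E = ((f E).1, W) by []; move: (f E).1 => H HE.
    apply/andP; split; last first.
      rewrite /r eqxx /=; apply/existsP; exists E; rewrite HE !inE eqxx /=.
      by rewrite setU1K.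
    apply/statesP; split => //.
    + apply: planar_sub pl'; rewrite HE finset.subUset finset.sub1set EG'.
      exact: sub.
    + by rewrite HE cardsU1 nE em.
    + apply/isolatedP => F; rewrite HE !inE => /orP[/eqP->|FG].
        exact: isolatedP iso' _ EG'.
      exact: isolatedP iso _ FG.
    + apply: lev_step lv _ _; last by rewrite symdd cards0.
      have -> : symd (edges G) (edges H) = [set E].
        apply/setP => F; rewrite HE !inE; case: eqVneq => [->|_] /=.
          by rewrite (negbTE nE).
        by rewrite addbb.
      by rewrite cards1.
  rewrite card_ord Wk in eG'.
  have lb : (3 * n <= #|[set Y in states s.+1 k m.+1 | r (G, W) Y]| + m + 3 * k + 6)%N by lia.
  exact: many_addable n_big qm lb.
- move=> [G' W'] /statesP[_ em _ _ _].
  have m3 : (m.+1 <= 3 * n)%N by rewrite -(ltn_pmul2l q0); move: qm n0; lia.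
  apply: leq_trans m3; rewrite -em.
  apply: (card_code_le (f := fun E => (mkgraph (edges G' :\ E), W'))).
  move=> [G W]; rewrite inE => /andP[_ /andP[/= /eqP-> /existsP[E /andP[EG' /eqP GE]]]].
  exists E => //; congr (_, _); apply: val_inj; apply/setP => F.
  rewrite /= in_mkgraph -GE; case FG: (F \in edges G) => //=; by rewrite (edge_card FG).
Qed.

Lemma states_lift s m j : (q * (m + j) + n <= 3 * q * n)%N ->
  (#|states s k m| <= (6 * q) ^ j * #|states (s + j) k (m + j)|)%N.
Proof.
elim: j => [|j IH] H; first by rewrite !addn0 mul1n.
apply: leq_trans (IH _) _; first by apply: leq_trans H; rewrite leq_add2r leq_mul2l leq_add2l leqnSn orbT.
rewrite expnSr -mulnA leq_mul2l; apply/orP; right.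
by rewrite !addnS; apply: states_add; apply: leq_trans H; rewrite leq_add2r leq_mul2l leq_add2l leqnSn orbT.
Qed.

End Switch.

(** * Contraction of a vertex and its inverse *)

Section Contraction.
Variables (T : finType).
Implicit Types (G : sgraph T) (W : {set T}).

Let at_v G v := [set E in edges G | v \in E].

Lemma contr_edges G a v : adj G a v -> edges (contr G a v) =
  (edges G :\: at_v G v) :|: [set [set a; u] | u in nbrs G v :\ a].
Proof.
move=> av; apply/setP => E; rewrite in_mkgraph !inE.
have -> : [set u | adj G v u && (u != a)] = nbrs G v :\ a.
  by apply/setP => u; rewrite !inE andbC.
case EG: (E \in edges G) => /=; first by rewrite (edge_card EG) !andbT.
rewrite andb_idr // => /imsetP[u].
by rewrite !inE => /andP[ua _] ->; rewrite cards2 (eq_sym a u) ua.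
Qed.

Lemma card_moved G a v : adj G a v ->
  (#|[set [set a; u] | u in nbrs G v :\ a]| < deg G v)%N.
Proof.
move=> av; apply: leq_ltn_trans (leq_imset_card _ _) _.
have := cardsD1 a (nbrs G v); rewrite inE [adj G v a]adj_sym av card_nbrs => ->.
exact: leqnn.
Qed.

Lemma contr_lower G a v : adj G a v ->
  (#|edges G| <= #|edges (contr G a v)| + deg G v)%N.
Proof.
move=> av; rewrite -(cardsID (at_v G v) (edges G)) contr_edges // addnC leq_add //.
  by apply: subset_leq_card; exact: finset.subsetUl.
by apply: subset_leq_card; exact: finset.subsetIr.
Qed.

Lemma contr_upper G a v : adj G a v -> (#|edges (contr G a v)| < #|edges G|)%N.
Proof.
move=> av; rewrite contr_edges //.
apply: leq_ltn_trans (leq_card_setU _ _) _.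
rewrite -(cardsID (at_v G v) (edges G)) addnC ltn_add2r.
apply: leq_trans (card_moved av) _; apply: subset_leq_card.
by apply/fintype.subsetP => E; rewrite !inE => /andP[-> ->].
Qed.

Lemma contr_symd G a v : adj G a v ->
  (#|symd (edges G) (edges (contr G a v))| <= 2 * deg G v)%N.
Proof.
move=> av; pose Ad := [set [set a; u] | u in nbrs G v :\ a].
apply: (@leq_trans #|at_v G v :|: Ad|).
  apply: subset_leq_card; apply/fintype.subsetP => E; rewrite in_symd contr_edges //.
  rewrite !(finset.in_setU, finset.in_setD) -/Ad; case AdE: (E \in Ad); first by rewrite !orbT.
  by rewrite inE; case: (E \in edges G); case: (v \in E).
apply: leq_trans (leq_card_setU _ _) _; rewrite mul2n -addnn leq_add2l.
exact: ltnW (card_moved av).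
Qed.

Lemma contr_isolated G W a v : adj G a v -> isolated G W -> isolated (contr G a v) (v |: W).
Proof.
move=> av iso; have nav : a != v by apply: contraTneq av => ->; rewrite adj_irr.
have out x E : E \in edges G -> x \in E -> x \notin W.
  by move=> EG xE; rewrite (disjointFr (isolatedP _ _ iso _ EG) xE).
have aW : a \notin W by exact: isolated_adj iso av.
apply/isolatedP => E; rewrite contr_edges // !inE => H.
rewrite finset.disjoints_subset; apply/fintype.subsetP => x xE; rewrite !inE negb_or.
case/orP: H => [/andP[+ EG]|/imsetP[u]].
  rewrite EG /= => vE; rewrite (out x E) // andbT; by apply: contraNneq vE => <-.
rewrite !inE => /andP[ua vu] EE; move: xE; rewrite EE !inE => /orP[]/eqP->.
  by rewrite nav aW.
rewrite (isolated_adj iso (y := v)) 1?adj_sym // andbT.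
by apply: contraTneq vu => ->; rewrite adj_irr.
Qed.

Lemma nbrs_contr G a v : adj G a v ->
  nbrs (contr G a v) a = (nbrs G v :\ a) :|: (nbrs G a :\ v).
Proof.
move=> av; have nav : a != v by apply: contraTneq av => ->; rewrite adj_irr.
apply/setP => u; rewrite [LHS]inE /adj contr_edges // [LHS]finset.in_setU.
apply/idP/idP => [/orP[H|H]|/finset.setUP[H|H]];
  [apply/finset.setUP; right|apply/finset.setUP; left|apply/orP; right|apply/orP; left].
- move: H; rewrite !inE => /andP[+ EG]; rewrite EG negb_or /= => /andP[_ vu].
  by rewrite eq_sym vu /adj.
- case/imsetP: H => w wN E; suff -> : u = w by [].
  move: wN; rewrite !inE => /andP[wa _]; have := set22 a w.
  by rewrite -E !inE (negbTE wa) => /eqP.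
- exact: imset_f.
- move: H; rewrite !inE => /andP[uv au]; rewrite /adj in au.
  by rewrite au /= negb_or (eq_sym v a) nav (eq_sym v u) uv.
Qed.

(* The pairs [(nbrs G v :\ a, nbrs G a :\ v)] that may have been merged into the
   neighbourhood of [a] when [a] or [v] had small degree. *)
Definition codes G D a : {set {set T} * {set T}} :=
  (if (#|nbrs G a| <= D + 4)%N
   then finset.setX (powerset (nbrs G a)) (powerset (nbrs G a)) else finset.set0) :|:
  [set (c.1, if c.2 then nbrs G a else nbrs G a :\: c.1) |
    c : {set T} * bool in
      finset.setX (finset.set0 |: [set [set u] | u in nbrs G a]) [set: bool]].

(** The bound is linear in the degree of [a], so that its sum over all [a] is linear in [n]. *)
Lemma card_codes G D a :
  (#|codes G D a| <= 2 ^ (D + 4) * 2 ^ (D + 4) + 2 * (1 + deg G a))%N.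
Proof.
apply: leq_trans (leq_card_setU _ _) _; apply: leq_add.
  case: ifP => [le|_]; last by rewrite cards0.
  by rewrite cardsX card_powerset leq_mul // leq_exp2l.
apply: leq_trans (leq_imset_card _ _) _; rewrite cardsX cardsT card_bool mulnC leq_mul2l /=.
apply: leq_trans (leq_card_setU _ _) _; rewrite cards1 leq_add2l -card_nbrs.
exact: leq_imset_card.
Qed.

(** If [a] has degree at most [D], both sets are subsets of a merged neighbourhood of at most
    [D + 4] vertices. If [v] has degree at most 2, it has at most one neighbour besides [a], and one
    bit tells whether that is also a neighbour of [a]. *)
Lemma contr_codes G D a v : adj G a v -> (deg G v <= 5)%N ->
  (deg G a <= D)%N || (deg G v <= 2)%N ->
  (nbrs G v :\ a, nbrs G a :\ v) \in codes (contr G a v) D a.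
Proof.
move=> av d5 dd; have N := nbrs_contr av.
have cv : (#|nbrs G v :\ a|.+1 = deg G v)%N.
  by have := cardsD1 a (nbrs G v); rewrite inE [adj G v a]adj_sym av card_nbrs.
rewrite /codes; apply/finset.setUP; case/orP: dd => dd; [left|right].
  have -> : (#|nbrs (contr G a v) a| <= D + 4)%N.
    rewrite N; apply: leq_trans (leq_card_setU _ _) _; rewrite addnC leq_add //.
      apply: leq_trans dd; rewrite -card_nbrs; apply: subset_leq_card; exact: subD1set.
    by rewrite -ltnS cv.
  by rewrite finset.in_setX !powersetE N finset.subsetUl finset.subsetUr.
have c1 : (#|nbrs G v :\ a| <= 1)%N by rewrite -ltnS cv.
have S1 : nbrs G v :\ a \in finset.set0 |: [set [set u] | u in nbrs (contr G a v) a].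
  rewrite finset.in_setU finset.in_set1; move: c1.
  rewrite leq_eqVlt ltnS leqn0 cards_eq0 => /orP[/cards1P[u E]|/eqP->].
    apply/orP; right; apply/imsetP; exists u => //.
    by rewrite N; apply/finset.setUP; left; rewrite E finset.in_set1.
  by rewrite eqxx.
case sub : (nbrs G v :\ a \subset nbrs G a :\ v).
  apply/imsetP; exists (nbrs G v :\ a, true); first by rewrite finset.in_setX S1 inE.
  by rewrite N /= (finset.setUidPr sub).
apply/imsetP; exists (nbrs G v :\ a, false); first by rewrite finset.in_setX S1 inE.
congr (_, _); rewrite N /= finset.setDUl finset.setDv finset.set0U; apply/esym/finset.setDidPl.
rewrite disjoint_sym; move: c1; rewrite leq_eqVlt ltnS leqn0 cards_eq0 => /orP[/cards1P[u E]|/eqP E].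
  by move: sub; rewrite E finset.sub1set disjoints1 => ->.
by move: sub; rewrite E finset.sub0set.
Qed.

End Contraction.

Lemma few_low q m n k L L' X Y Z :
  (12 * q * L <= 12 * q * (k + (Z + (Y + X))))%N -> (q * (6 * L') <= q * (2 * m))%N ->
  (q * L + q * L' = q * n)%N -> (12 * q * Z < n)%N -> (12 * q * Y < n)%N ->
  (12 * q * X <= n)%N -> (q * m + n <= 3 * q * n)%N -> (12 * q * k <= n)%N -> False.
Proof. lia. Qed.

Section LowDegree.
Variables (R : realType) (n : nat).
Implicit Types (G : sgraph 'I_n) (W : {set 'I_n}).

Definition contractible D G W v a :=
  [&& v \notin W, (deg G v <= 5)%N, adj G a v & (deg G a <= D)%N || (deg G v <= 2)%N].

(** At least [n / (3 * q)] vertices have degree at most 5, which is four times [n / (12 * q)]. The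
    reserve and the bad vertices [X] account for at most one such share each, so [Z] or [Y] fills
    one. *)
Lemma low_degree q m k G W : (0 < q)%N -> planar R G -> #|edges G| = m -> #|W| = k ->
  (q * m + n <= 3 * q * n)%N -> (12 * q * k <= n)%N ->
  (n <= 12 * q * #|[set v | (v \notin W) && (deg G v == 0%N)]|)%N \/
  (n <= 12 * q * #|[set v | [exists a, contractible (144 * q) G W v a]]|)%N.
Proof.
move=> q0 pl em Wk qm kn; set Z := [set v | _ && _]; set Y := [set v | _].
(* With this [D], [#|X| <= 2 * #|U|] and [144 * q * #|U| <= 2 * m <= 6 * n] give
   [12 * q * #|X| <= n]. *)
pose D := (144 * q)%N; pose L := [set v | (deg G v <= 5)%N].
pose U := [set v | (D.+1 <= deg G v)%N].
pose X := [set v | (3 <= deg G v <= 5)%N && [forall a, adj G v a ==> (D < deg G a)%N]].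
have LL : (6 * #|~: L| <= 2 * m)%N.
  rewrite -em -sum_deg; apply: leq_trans (card_large (deg G) 6); rewrite leq_mul2l /=.
  by apply: subset_leq_card; apply/fintype.subsetP => v; rewrite !inE -ltnNge.
have cL : (#|L| + #|~: L| = n)%N by rewrite cardsC card_ord.
have cU : (D.+1 * #|U| <= 2 * m)%N by rewrite -em -sum_deg; exact: card_large.
(* The edges at [X] form a bipartite graph: their other ends have degree above [D], so they lie in
   [U] and not in [X]. *)
have XU : (#|X| <= 2 * #|U|)%N.
  pose GX : sgraph 'I_n := mkgraph [set E in edges G | [exists v in X, v \in E]].
  have GXE E : (E \in edges GX) = (E \in edges G) && [exists v in X, v \in E].
    rewrite in_mkgraph inE; case EG: (E \in edges G) => //=.
    by rewrite (edge_card EG) andbT.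
  have D5 : (5 < D.+1)%N by rewrite /D; lia.
  apply: (@bipartite_bound R _ GX).
  - apply: planar_sub pl; apply/fintype.subsetP => E; by rewrite GXE => /andP[].
  - rewrite finset.disjoints_subset; apply/fintype.subsetP => v; rewrite !inE.
    by move=> /andP[/andP[_ d5] _]; rewrite -ltnNge ltnS (leq_trans d5).
  - move=> E v; rewrite GXE => /andP[EG _] vX vE; have [x [y [_ EE]]] := edge_ends EG.
    have {EE}[u EE] : exists u, E = [set v; u].
      move: vE; rewrite EE !inE => /orP[]/eqP->; [by exists y | exists x].
      by rewrite finset.setUC.
    exists u => //; move: vX; rewrite !inE => /andP[_ /forallP/(_ u)/implyP]; apply.
    by rewrite /adj -EE.
  - move=> v vX; have := vX; rewrite inE => /andP[/andP[d3 _] _]; apply: leq_trans d3 _.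
    apply: subset_leq_card; apply/fintype.subsetP => E /setIdP[EG vE]; apply/setIdP.
    by split => //; rewrite GXE EG; apply/existsP; exists v; rewrite vX.
have Lsub : (#|L| <= k + (#|Z| + (#|Y| + #|X|)))%N.
  rewrite -Wk; apply: (@leq_trans #|W :|: (Z :|: (Y :|: X))|); last first.
    apply: leq_trans (leq_card_setU _ _) _; rewrite leq_add2l.
    apply: leq_trans (leq_card_setU _ _) _; rewrite leq_add2l.
    exact: leq_card_setU.
  apply: subset_leq_card; apply/fintype.subsetP => v; rewrite inE => d5.
  rewrite !finset.in_setU; case vW: (v \in W) => //=.
  case d0: (deg G v == 0%N); first by rewrite inE vW d0.
  have [b] : exists b, b \in nbrs G v.
    by apply/card_gt0P; rewrite card_nbrs lt0n d0.
  rewrite inE => vb; apply/orP; right.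
  case d2: (deg G v <= 2)%N.
    apply/orP; left; rewrite inE; apply/existsP; exists b.
    by rewrite /contractible vW d5 adj_sym vb d2 orbT.
  case hi: [forall a, adj G v a ==> (D < deg G a)%N].
    by apply/orP; right; rewrite inE hi d5 ltnNge d2.
  apply/orP; left; rewrite inE; apply/existsP; have [a] := forallPn (negbT hi).
  rewrite negb_imply -leqNgt => /andP[va lo]; exists a.
  by rewrite /contractible vW d5 adj_sym va lo.
have qX : (12 * q * #|X| <= n)%N.
  have H1 : (144 * q * #|U| <= 2 * m)%N by apply: leq_trans cU; rewrite leq_mul2r leqnSn orbT.
  have H2 : (m <= 3 * n)%N by rewrite -(leq_pmul2l q0); move: qm; lia.
  have H3 := leq_mul (leqnn (12 * q)) XU; move: H1 H2 H3; lia.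
have HL := leq_mul (leqnn (12 * q)) Lsub.
have H4 := leq_mul (leqnn q) LL.
have H5 : (q * #|L| + q * #|~: L| = q * n)%N by rewrite -mulnDr cL.
case: (leqP n (12 * q * #|Z|)) => [|HZ]; first by left.
right; rewrite leqNgt; apply/negP => HY; exfalso.
exact: few_low HL H4 H5 HZ HY qX qm kn.
Qed.

End LowDegree.

(** * Enlarging the reserve by one vertex *)

Section Reserve.
Variables (R : realType) (n : nat) (lev : nat -> sgraph 'I_n -> {set 'I_n} -> bool).
Hypothesis lev_step : forall s G W G' W', lev s G W ->
  (#|symd (edges G) (edges G')| <= 12)%N -> (#|symd W W'| <= 1)%N -> lev s.+1 G' W'.
Implicit Types (G : sgraph 'I_n) (W : {set 'I_n}).
Local Notation states := (states R lev).
Local Notation state := (sgraph 'I_n * {set 'I_n})%type.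

Variables q p k : nat.
Hypotheses (q0 : (0 < q)%N) (p0 : (0 < p)%N).
Hypothesis n_big : (12 * q * k.+1 + 12 * q + k.+1 + 3 <= n)%N.

Lemma symd_setU1 (T : finType) (W : {set T}) v : (#|symd W (v |: W)| <= 1)%N.
Proof.
rewrite -(cards1 v); apply: subset_leq_card; apply/fintype.subsetP => x.
by rewrite !inE; case: (x == v) => //=; rewrite addbb.
Qed.

Lemma setU1_inj (T : finType) (W : {set T}) u v : u \notin W -> v |: W = u |: W -> u = v.
Proof.
move=> uW /setP/(_ u); rewrite !inE eqxx (negbTE uW) orbF => /eqP; exact.
Qed.

(** The exact number of edges after a contraction is unknown, but between one and five are lost. *)
Let below s m : {set state} := [set X | [&& `[< planar R X.1 >],
  (m <= #|edges X.1| + 5)%N && (#|edges X.1| < m)%N, isolated X.1 X.2, #|X.2| == k.+1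
  & lev s X.1 X.2]].

Let belowP s m G W : reflect [/\ planar R G,
    (m <= #|edges G| + 5)%N && (#|edges G| < m)%N, isolated G W, #|W| = k.+1
  & lev s G W] ((G, W) \in below s m).
Proof.
by rewrite inE /=; apply: (iffP and5P) => [[/asboolP ? ? ? /eqP]|[? ? ? /eqP ?]];
  split => //; apply/asboolP.
Qed.

(** The factor 5 counts the possible deficits [j <= 4] from [m - 1] edges, each made up by [j] added
    edges. *)
Lemma below_lift s m : (q * m + n <= 3 * q * n)%N ->
  (#|below s m| <= 5 * (6 * q) ^ 5 * #|states (s + 4) k.+1 m.-1|)%N.
Proof.
move=> qm; pose P : {set 'I_5} := [set j : 'I_5 | (j < m)%N].
pose Q (j : 'I_5) := states s k.+1 (m.-1 - nat_of_ord j)%N.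
apply: (@leq_trans #|[set x : 'I_5 * state | (x.1 \in P) && (x.2 \in Q x.1)]|).
  apply: (card_code_le (f := snd)) => -[G W] /belowP[pl /andP[e1 e2] iso Wk lv].
  have j5 : (m.-1 - #|edges G| < 5)%N by lia.
  have Ee : (#|edges G| = m.-1 - (m.-1 - #|edges G|))%N by lia.
  have jP : Ordinal j5 \in P by rewrite inE /=; lia.
  have jQ : (G, W) \in Q (Ordinal j5) by apply/statesP; split => //; exact: Ee.
  by exists (Ordinal j5, (G, W)) => //; rewrite inE /= jP jQ.
rewrite card_dep.
apply: (@leq_trans (\sum_(j in P) (6 * q) ^ 5 * #|states (s + 4) k.+1 m.-1|)); last first.
  rewrite sum_nat_const -mulnA leq_mul2r; apply/orP; right.
  by rewrite -[X in (_ <= X)%N](card_ord 5); exact: max_card.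
apply: leq_sum => j; rewrite inE => jm; have j5 := ltn_ord j.
have E : (m.-1 - j + j = m.-1)%N by lia.
have := @states_lift R n lev lev_step q k.+1 q0 n_big s (m.-1 - j)%N j; rewrite E => lift.
apply: leq_trans (lift _) _.
  by apply: leq_trans qm; rewrite leq_add2r leq_mul2l leq_pred orbT.
apply: leq_mul; first by rewrite leq_exp2l //; lia.
by apply: subset_leq_card; apply: states_mono => //; rewrite leq_add2l; lia.
Qed.

Let D := (144 * q)%N.
Let isolates (X : state) := [set v | (v \notin X.2) && (deg X.1 v == 0%N)].
Let goods (X : state) := [set v | [exists a, contractible D X.1 X.2 v a]].

Let sparse s m : {set state} := [set X in states s k m | (n <= 12 * q * #|isolates X|)%N].
Let dense s m : {set state} := [set X in states s k m | (n <= 12 * q * #|goods X|)%N].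

(** An isolated vertex is reserved and any edge deleted, so that the number of edges drops here too:
    at least [n / (12 * q)] times [n / p] choices, undone by naming the vertex in the reserve and
    the ends of the edge. *)
Lemma sparse_bound s m : (n <= p * m)%N ->
  (#|sparse s m| <= 12 * q * p * k.+1 * #|below s.+1 m|)%N.
Proof.
move=> pm; have n0 : (0 < n)%N by lia.
have m0 : (0 < m)%N by move: pm n0; case: (m) => //; rewrite muln0; lia.
pose f (X : state) (c : 'I_n * {set 'I_n}) : state := (mkgraph (edges X.1 :\ c.2), c.1 |: X.2).
pose r (X Y : state) := [exists v in isolates X, exists E in edges X.1, Y == f X (v, E)].
have fE X c : edges (f X c).1 = edges X.1 :\ c.2.
  apply/setP => E; rewrite in_mkgraph andb_idr // => /setD1P[_ EX].
  by rewrite (edge_card EX).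
suff H : (n * n * #|sparse s m| <= 12 * q * p * (k.+1 * (n * n)) * #|below s.+1 m|)%N.
  have nn : (0 < n * n)%N by rewrite muln_gt0 n0.
  rewrite -(leq_pmul2l nn); apply: leq_trans H _; apply: eq_leq.
  move: (#|below _ _|) (n * n)%N => b a; lia.
apply: (double_count (r := r)).
- move=> X; rewrite inE => /andP[]; case: X => G W /statesP[pl em iso Wk lv] H.
  have le : (#|isolates (G, W)| * m <= #|[set Y in below s.+1 m | r (G, W) Y]|)%N.
    rewrite -em -cardsX; apply: (card_inj_le (f := f (G, W))).
      move=> [v E] [u F]; rewrite !finset.in_setX /= => /andP[vI EG] /andP[uI FG] EE.
      move: (EE) => /(congr1 (fun Y : state => edges Y.1)); rewrite !fE /= => /setP/(_ E).
      rewrite !inE eqxx EG andbT /= => EF.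
      have {EF} -> : E = F by apply/eqP; move: EF; case: (E == F).
      have := congr1 (fun Y : state => Y.2) EE; rewrite /= => /setU1_inj -> //.
      by move: uI; rewrite inE => /andP[].
    move=> [v E]; rewrite finset.in_setX => /andP[/= vI EG]; rewrite inE; apply/andP; split.
      have HE := fE (G, W) (v, E).
      have -> : f (G, W) (v, E) = ((f (G, W) (v, E)).1, v |: W) by [].
      move: (f _ _).1 HE => G' /= HE.
      have vW : v \notin W by move: vI; rewrite inE => /andP[].
      have vd : deg G v = 0%N by move: vI; rewrite inE => /andP[_ /eqP].
      apply/belowP; split.
      + by apply: planar_sub pl; rewrite HE; exact: subD1set.
      + by rewrite HE [#|edges G|](cardsD1 E) EG add1n ltnSn andbT -addn1 leq_add2l.
      + apply/isolatedP => F; rewrite HE !inE => /andP[_ FG].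
        rewrite finset.disjoints_subset; apply/fintype.subsetP => x xF; rewrite !inE negb_or.
        rewrite (disjointFr (isolatedP _ _ iso _ FG) xF) andbT.
        apply/eqP => xv; move/eqP: vd; rewrite cards_eq0 => /eqP/setP/(_ F).
        by rewrite !inE FG -xv xF.
      + by rewrite cardsU1 vW Wk.
      + apply: lev_step lv _ _; last exact: symd_setU1.
        have -> : symd (edges G) (edges G') = [set E].
          apply/setP => F; rewrite HE !inE; case: eqVneq => [->|_] /=; first by rewrite EG.
          by rewrite addbb.
        by rewrite cards1.
    by apply/existsP; exists v; rewrite vI; apply/existsP; exists E; rewrite EG eqxx.
  apply: leq_trans (leq_mul H pm) _.
  rewrite mulnACA; exact: leq_mul (leqnn _) le.
- move=> [G' W'] /belowP[_ _ _ Wk _].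
  pose g (c : 'I_n * ('I_n * 'I_n)) : state :=
    (mkgraph ([set c.2.1; c.2.2] |: edges G'), W' :\ c.1).
  have -> : (k.+1 * (n * n) = #|[set c : 'I_n * ('I_n * 'I_n) |
      (c.1 \in W') && (c.2 \in [set: 'I_n * 'I_n])]|)%N.
    by rewrite (card_dep _ (fun=> [set: 'I_n * 'I_n])) sum_nat_const Wk cardsT card_prod card_ord.
  apply: (card_code_le (f := g)) => -[G W]; rewrite inE => /andP[XS].
  move=> /existsP[v /andP[vI /existsP[E /andP[/= EG /eqP EE]]]].
  have [x [y [_ Exy]]] := edge_ends EG; exists (v, (x, y)).
    by rewrite !inE andbT /=; case: EE => _ ->; rewrite !inE eqxx.
  rewrite /g /= -Exy; have := congr1 (fun Y : state => edges Y.1) EE; rewrite fE /= => ->.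
  have vW : v \notin W by move: vI; rewrite inE => /andP[].
  case: EE => _ ->; rewrite setU1K //; congr (_, _); apply: val_inj; apply/setP => F.
  rewrite /= in_mkgraph finset.setD1K //; case FG: (F \in edges G) => //=.
  by rewrite (edge_card FG).
Qed.

(** The 14 comes from the term [2 * (1 + deg G a)] of [card_codes]: summed over all [a] it is at
    most [14 * n], as there are at most [3 * n] edges. *)
Let Cd := (2 ^ (D + 4) * 2 ^ (D + 4) + 14)%N.

(** The new element of the reserve shows which [v] was contracted, so distinct [v] give distinct
    results. Undoing takes [v] in the reserve, a vertex [a] and a code at [a]. *)
Lemma dense_bound s m : (q * m + n <= 3 * q * n)%N ->
  (#|dense s m| <= 12 * q * (k.+1 * Cd) * #|below s.+1 m|)%N.
Proof.
move=> qm; have n0 : (0 < n)%N by lia.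
have m3 : (m <= 3 * n)%N by rewrite -(leq_pmul2l q0); move: qm; lia.
pose f (X : state) (v a : 'I_n) : state := (contr X.1 a v, v |: X.2).
pose r (X Y : state) := [exists v, exists a, contractible D X.1 X.2 v a && (Y == f X v a)].
suff H : (n * #|dense s m| <= 12 * q * (k.+1 * (n * Cd)) * #|below s.+1 m|)%N.
  rewrite -(leq_pmul2l n0); apply: leq_trans H _; apply: eq_leq.
  move: (#|below _ _|) Cd => b a; lia.
apply: (double_count (r := r)).
- move=> X; rewrite inE => /andP[]; case: X => G W /statesP[pl em iso Wk lv] H.
  apply: leq_trans H _; rewrite leq_mul2l; apply/orP; right.
  pose ch v := odflt v [pick a | contractible D G W v a].
  have chP v : v \in goods (G, W) -> contractible D G W v (ch v).
    rewrite inE => /existsP[a va]; rewrite /ch; case: pickP => [//|/(_ a)].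
    by move: va => /= ->.
  apply: (card_inj_le (f := fun v => f (G, W) v (ch v))).
    move=> v u _ /chP/and4P[uW _ _ _] /(congr1 (fun Y : state => Y.2)) /= /setU1_inj -> //.
  move=> v vg; have ok := chP v vg; have /and4P[vW d5 av _] := ok.
  rewrite inE; apply/andP; split; last first.
    by apply/existsP; exists v; apply/existsP; exists (ch v); rewrite ok eqxx.
  apply/belowP; split.
  + exact: contr_planar.
  + have := contr_lower av; have := contr_upper av; rewrite em /=; lia.
  + exact: contr_isolated.
  + by rewrite cardsU1 vW Wk.
  + apply: lev_step lv _ _; last exact: symd_setU1.
    by apply: leq_trans (contr_symd av) _; lia.
- move=> [G' W'] /belowP[_ /andP[_ eG'] _ Wk _].
  pose K (a : 'I_n) := codes G' D a.
  pose Q : {set 'I_n * ({set 'I_n} * {set 'I_n})} :=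
    [set d | (d.1 \in [set: 'I_n]) && (d.2 \in K d.1)].
  pose g (c : 'I_n * ('I_n * ({set 'I_n} * {set 'I_n}))) : state :=
    (uncontr G' c.2.1 c.1 c.2.2.1 c.2.2.2, W' :\ c.1).
  have cQ : (#|Q| <= n * Cd)%N.
    rewrite card_dep; apply: (@leq_trans (\sum_(a in [set: 'I_n])
      (2 ^ (D + 4) * 2 ^ (D + 4) + 2 + 2 * deg G' a))%N).
      by apply: leq_sum => a _; apply: leq_trans (card_codes G' D a) _; rewrite mulnDr addnA.
    rewrite big_split /= sum_nat_const cardsT card_ord -big_distrr /=.
    rewrite (eq_bigl (fun=> true)) => [|a]; last by rewrite inE.
    rewrite sum_deg /Cd; move: (2 ^ _)%N eG' m3 => e; move: (#|edges G'|) => x; nia.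
  apply: (@leq_trans #|[set c : 'I_n * ('I_n * ({set 'I_n} * {set 'I_n})) |
      (c.1 \in W') && (c.2 \in Q)]|); last first.
    by rewrite (card_dep _ (fun=> Q)) sum_nat_const Wk leq_mul2l cQ orbT.
  apply: (card_code_le (f := g)) => -[G W]; rewrite inE => /andP[XS].
  move=> /existsP[v /existsP[a /andP[/and4P[/= vW d5 av dd] /eqP[G'E W'E]]]].
  exists (v, (a, (nbrs G v :\ a, nbrs G a :\ v))).
    rewrite inE; apply/andP; split; first by rewrite /= W'E !inE eqxx.
    rewrite /Q inE; apply/andP; split; first by rewrite inE.
    by rewrite /K G'E; exact: contr_codes.
  by rewrite /g /= G'E W'E contrK // setU1K.
Qed.

Lemma states_reserve s m : (q * m + n <= 3 * q * n)%N -> (n <= p * m)%N ->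
  (#|states s k m| <= (12 * q * p * k.+1 + 12 * q * (k.+1 * Cd)) * (5 * (6 * q) ^ 5) *
    #|states (s + 5) k.+1 m.-1|)%N.
Proof.
move=> qm pm.
have sub : states s k m \subset sparse s m :|: dense s m.
  apply/fintype.subsetP => -[G W] GW; rewrite !inE /= -/(is_true _).
  have := GW; rewrite inE => -> /=; have /statesP[pl em _ Wk _] := GW.
  have kn : (12 * q * k <= n)%N by move: n_big; lia.
  by have [H|H] := low_degree q0 pl em Wk qm kn; apply/orP; [left|right].
apply: leq_trans (subset_leq_card sub) _; apply: leq_trans (leq_card_setU _ _) _.
apply: leq_trans (leq_add (sparse_bound s pm) (dense_bound s qm)) _.
have := below_lift s.+1 qm; rewrite addSnnS => bl.
rewrite -[leqRHS]mulnA; apply: leq_trans (leq_mul (leqnn _) bl).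
by rewrite mulnDl.
Qed.

End Reserve.

(** * Adding copies of a graph *)

Section Unicyclic.
Variables (T : finType).
Implicit Types (G : sgraph T).

(** Without one of its edges an even set has just the two ends of that edge as odd vertices, so a
    path in the rest joins them and closes up to a cycle. *)
Lemma even_cycle G (z : {set {set T}}) : z \in cycles G -> z != finset.set0 ->
  exists s, graph_cycle G s.
Proof.
rewrite inE => /andP[zG /eqP z0] /set0Pn[E Ez].
have EG := fintype.subsetP zG _ Ez; have [x [y [xy EE]]] := edge_ends EG.
pose r : rel T := fun u w => [set u; w] \in z :\ E.
have rsym : connect_sym r by apply: sym_connect_sym => u w; rewrite /r finset.setUC.
have rG u w : r u w -> adj G u w by rewrite /r !inE => /andP[_ /(fintype.subsetP zG)].
have con : connect r x y.
  apply: contraT => nxy; pose C := [set w | connect r x w].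
  have P0 : \big[addb/false]_(w in C) (w \in odds id z) = false.
    by rewrite big1 // => w _; rewrite z0 inE.
  have swap : \big[addb/false]_(w in C) (w \in odds id z) =
      \big[addb/false]_(e in z) \big[addb/false]_(w in C) (w \in e).
    by rewrite exchange_big /=; apply: eq_bigr => w _; rewrite in_odds.
  have two u w : u != w -> \big[addb/false]_(v in C) (v \in [set u; w]) = (u \in C) (+) (w \in C).
    move=> uw; rewrite big_mkcond /= (bigD1 u) //= (bigD1 w) 1?eq_sym //= big1 ?addbF.
      by rewrite !inE !eqxx orbT; do 2 case: (connect r x _).
    by move=> v /andP[vu vw]; rewrite !inE (negbTE vu) (negbTE vw); case: ifP.
  move: P0; rewrite swap (big_setD1 E) //= [X in _ (+) X]big1 ?addbF.
    by rewrite EE two // !inE connect0 (negbTE nxy).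
  move=> e /setD1P[eE ez]; have [u [w [uw ee]]] := edge_ends (fintype.subsetP zG _ ez).
  rewrite ee two // !inE; suff -> : connect r x u = connect r x w by rewrite addbb.
  have ruw : r u w by rewrite /r -ee !inE eE.
  apply/idP/idP => H; first exact: connect_trans H (connect1 ruw).
  by apply: connect_trans H (connect1 _); rewrite /r finset.setUC.
case/connectP: con => p0 pp0 py; case/shortenP: pp0 py => p pp up _ py.
exists (x :: p); rewrite /graph_cycle /ucycleb up andbT /cycle rcons_path.
have -> : path (adj G) x p by apply: sub_path pp => u w; exact: rG.
rewrite -py [adj G y x]/adj finset.setUC -EE EG andbT.
(* A path of one edge would be [E] itself, which was removed, so the cycle has more than two
   vertices. *)
case: p pp py {up} => [_ /= E1|w [|//]]; first by rewrite E1 eqxx in xy.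
by rewrite /= andbT /r => + E1; rewrite -E1 -EE !inE eqxx.
Qed.

Lemma many_edges_cycle G : (0 < #|T|)%N -> (#|T| <= #|edges G|)%N ->
  exists s, graph_cycle G s.
Proof.
move=> T0 le; have [x0 _] : exists x0, x0 \in T by apply/card_gt0P.
have := cycles_lower (G := G) (finset.in_setT x0) (fun E _ => finset.subsetT E).
rewrite cardsT => low.
have c1 : (1 < #|cycles G|)%N.
  rewrite ltnNge; apply/negP => c1; have := leq_trans low (leq_mul c1 (leqnn _)).
  by rewrite mul1n leq_exp2l //; lia.
have [z zc z0] : exists2 z, z \in cycles G & z != finset.set0.
  apply/exists_inP; apply: contraLR c1; rewrite negb_exists_in -leqNgt => /forall_inP H.
  rewrite -(cards1 (finset.set0 : {set {set T}})); apply: subset_leq_card.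
  by apply/fintype.subsetP => z /H; rewrite negbK finset.in_set1.
exact: even_cycle zc z0.
Qed.

(** With more edges than vertices a cycle survives the deletion of an edge of a first cycle; it
    avoids that edge, so it is a second one. *)
Lemma unicyclic_edges G : (0 < #|T|)%N -> at_most_one_cycle G -> (#|edges G| <= #|T|)%N.
Proof.
move=> T0 one; rewrite leqNgt; apply/negP => lt.
have [s1 c1] := many_edges_cycle T0 (ltnW lt).
case: s1 c1 => [//|x s1] c1; have c1' := c1.
have xs : x \in x :: s1 by rewrite inE eqxx.
pose E := [set x; next (x :: s1) x].
have E1 : E \in cycle_edges (x :: s1) by exact: imset_f.
have EG : E \in edges G.
  by case/andP: c1 => _ /andP[cy _]; exact: (next_cycle cy xs).
pose G' : sgraph T := mkgraph (edges G :\ E).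
have G'E : edges G' = edges G :\ E.
  apply/setP => F; rewrite in_mkgraph andb_idr // => /setD1P[_ FG].
  by rewrite (edge_card FG).
have [|s2 c2] := many_edges_cycle (G := G') T0.
  by rewrite G'E; move: lt; rewrite [#|edges G|](cardsD1 E) EG.
have c2' : graph_cycle G s2.
  case/andP: c2 => sz /andP[cy us]; rewrite /graph_cycle sz /ucycleb us andbT /=.
  by apply: sub_cycle cy => u w; rewrite /adj G'E => /setD1P[].
move: E1; rewrite (one _ _ c1' c2') => /imsetP[u us2 EE].
case/andP: c2 => _ /andP[cy _]; have := next_cycle cy us2.
by rewrite /adj -EE G'E !inE eqxx.
Qed.

End Unicyclic.

Section AddCopy.
Variables (R : realType) (n h : nat) (H : sgraph 'I_h).
Hypotheses (Hpl : planar R H) (Hco : connected_graph H).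
Implicit Types (G : sgraph 'I_n) (W : {set 'I_n}).

Lemma increasing_in W : (h <= #|W|)%N -> exists2 f : 'I_h -> 'I_n,
  (forall i j : 'I_h, (i < j)%N -> (f i < f j)%N) & forall i, f i \in W.
Proof.
move=> hW; have h0 : (0 < h)%N by case/andP: Hco; rewrite card_ord.
have [x0 _] : exists x, x \in W by apply/card_gt0P; exact: leq_trans h0 hW.
pose r (x y : 'I_n) := (x < y)%N.
have rtr : transitive r by move=> a b c; exact: ltn_trans.
have srt : sorted r (enum W).
  have -> : enum W = [seq x <- enum 'I_n | x \in W] by rewrite enumT.
  apply: sorted_filter => //; have := iota_ltn_sorted 0 n.
  by rewrite -val_enum_ord sorted_map.
have sz (i : 'I_h) : (i < size (enum W))%N by rewrite -cardE (leq_trans (ltn_ord i)).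
exists (fun i => nth x0 (enum W) i) => [i j ij|i].
  by have := sorted_ltn_nth rtr x0 srt; apply => //; exact: sz.
by rewrite -mem_enum mem_nth.
Qed.

Section Embed.
Variables (G : sgraph 'I_n) (W : {set 'I_n}) (f : 'I_h -> 'I_n).
Hypotheses (pl : planar R G) (iso : isolated G W).
Hypotheses (fmono : forall i j : 'I_h, (i < j)%N -> (f i < f j)%N).
Hypothesis fW : forall i, f i \in W.

Let C := [set f i | i : 'I_h].
Let Hf := [set [set f i | i in E] | E : {set 'I_h} in edges H].

Definition add_copy : sgraph 'I_n := mkgraph (edges G :|: Hf).

Let h0 : (0 < h)%N.
Proof. by case/andP: Hco; rewrite card_ord. Qed.

Let fI : injective f.
Proof.
move=> i j E; apply: val_inj; case: (ltngtP i j) => [/fmono|/fmono|//];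
  by rewrite E ltnn.
Qed.

Let CW : C \subset W.
Proof. by apply/fintype.subsetP => x /imsetP[i _ ->]. Qed.

Let edge_out E x : E \in edges G -> x \in E -> x \notin W.
Proof. by move=> EG xE; rewrite (disjointFr (isolatedP _ _ iso _ EG) xE). Qed.

Let HfC E : E \in Hf -> E \subset C.
Proof.
by move=> /imsetP[F _ ->]; apply/fintype.subsetP => x /imsetP[i _ ->]; exact: imset_f.
Qed.

Let Hf2 E : E \in Hf -> #|E| = 2%N.
Proof. by move=> /imsetP[F FH ->]; rewrite card_imset // (edge_card FH). Qed.

Let GHf E : E \in Hf -> E \notin edges G.
Proof.
move=> EH; apply/negP => EG; have [x xE] : exists x, x \in E.
  by apply/card_gt0P; rewrite (Hf2 EH).
by have := edge_out EG xE; rewrite (fintype.subsetP CW) // (fintype.subsetP (HfC EH)).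
Qed.

Lemma add_copy_edges : edges add_copy = edges G :|: Hf.
Proof.
apply/setP => E; rewrite in_mkgraph andb_idr // => /finset.setUP[EG|EH].
  by rewrite (edge_card EG).
by rewrite (Hf2 EH).
Qed.

Lemma add_copy_adj i j : adj add_copy (f i) (f j) = adj H i j.
Proof.
rewrite /adj add_copy_edges finset.in_setU.
have -> : ([set f i; f j] \in edges G) = false.
  by apply/negP => /edge_out/(_ (set21 _ _)); rewrite fW.
have -> : [set f i; f j] = [set f k | k in [set i; j]] by rewrite imsetU1 imset_set1.
by rewrite /= mem_imset //; exact: imset_inj.
Qed.

Lemma add_copy_card : #|edges add_copy| = (#|edges G| + #|edges H|)%N.
Proof.
rewrite add_copy_edges cardsU (_ : _ :&: _ = finset.set0) ?cards0 ?subn0.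
  by rewrite card_imset //; exact: imset_inj.
apply/setP => E; rewrite !finset.in_setI finset.in_set0; apply/negP => /andP[EG EH].
by have := GHf EH; rewrite EG.
Qed.

Lemma add_copy_isolated : isolated add_copy (W :\: C).
Proof.
apply/isolatedP => E; rewrite add_copy_edges finset.disjoints_subset.
move=> H'; apply/fintype.subsetP => x xE; rewrite finset.in_setC finset.in_setD negb_and negbK.
case/finset.setUP: H' => [EG|EH]; first by rewrite (edge_out EG xE) orbT.
by rewrite (fintype.subsetP (HfC EH)).
Qed.

Lemma add_copy_planar : planar R add_copy.
Proof.
apply: rplanar_planar; pose i0 := Ordinal h0.
pose g x := odflt i0 [pick i | f i == x].
have gf i : g (f i) = i.
  rewrite /g; case: pickP => [j /eqP/fI //|/(_ i)]; by rewrite eqxx.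
pose e x y := [set x; y] \in Hf.
have eC x y : e x y -> x \in C by move=> /HfC/fintype.subsetP; apply; exact: set21.
have esym : symmetric e by move=> x y; rewrite /e finset.setUC.
have plG : rplanar R (~: C) (adj G).
  apply: (@rplanar_map R _ _ id [set: 'I_n] (~: C) (adj G) (adj G)) => //.
  - exact: adj_sym.
  - move=> x y xy; rewrite inE; apply: contra (edge_out xy (set21 x y)).
    exact: (fintype.subsetP CW).
  - exact: planar_rplanar.
have plH : rplanar R C e.
  apply: (@rplanar_map R _ _ g [set: 'I_h] C (adj H) e) => //.
  - by move=> x y /imsetP[i _ ->] /imsetP[j _ ->]; rewrite !gf => ->.
  - move=> x y xy; have := eC _ _ xy; rewrite esym in xy; have := eC _ _ xy.
    move=> /imsetP[j _ yE] /imsetP[i _ xE]; move: xy; rewrite yE xE !gf.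
    rewrite /e -add_copy_adj /adj add_copy_edges finset.in_setU finset.setUC => ->.
    by rewrite orbT.
  - exact: planar_rplanar.
have dis : [disjoint ~: C & C] by rewrite disjoint_sym finset.disjoints_subset finset.setCK.
apply: (@rplanar_dom R _ (~: C :|: C)); first by move=> x y _; rewrite inE.
apply: rplanar_sub (rplanar_union dis plG plH); first exact: adj_sym.
by move=> x y; rewrite /adj add_copy_edges finset.in_setU.
Qed.

Lemma add_copy_component : C \in components add_copy.
Proof.
apply/componentsP; exists (f (Ordinal h0)); apply/setP => y; rewrite inE.
apply/imsetP/idP => [[i _ ->]|].
  apply: (connect_map (r := adj H)).
    by move=> u w uw; apply: connect1; rewrite add_copy_adj.
  by case/andP: Hco => _ /forallP/(_ (Ordinal h0))/forallP/(_ i).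
move=> xy; suff : y \in C by move=> /imsetP[i _ ->]; exists i.
apply: (connect_closed (P := fun y => y \in C) _ xy); last exact: imset_f.
move=> u w; rewrite /adj add_copy_edges => /finset.setUP[EG|EH] uC.
  by have := edge_out EG (set21 u w); rewrite (fintype.subsetP CW).
by rewrite (fintype.subsetP (HfC EH)) // set22.
Qed.

Lemma add_copy_iso : order_preserving_iso add_copy H C.
Proof.
apply/existsP; exists (finfun f); apply/and3P; split.
- by apply/forallP => i; apply/forallP => j; apply/implyP; rewrite !ffunE; exact: fmono.
- by apply/eqP; apply: eq_imset => i; rewrite ffunE.
- by apply/forallP => i; apply/forallP => j; rewrite !ffunE add_copy_adj.
Qed.

Let symdHf E : E \in symd (edges G) (edges add_copy) -> E \subset C.
Proof.
rewrite in_symd add_copy_edges finset.in_setU; case EH: (E \in Hf); first by rewrite HfC.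
by rewrite orbF addbb.
Qed.

Let untouched (D : {set 'I_n}) : [disjoint D & C] ->
  forall E, E \in symd (edges G) (edges add_copy) -> [disjoint E & D].
Proof.
move=> dis E /symdHf EC; apply: disjointWl EC _; by rewrite disjoint_sym.
Qed.

Lemma add_copy_kept h' (H' : sgraph 'I_h') : copies H' G W \subset copies H' add_copy (W :\: C).
Proof.
apply/fintype.subsetP => D; rewrite !inE => /and3P[Dc Di DW].
have un := untouched (disjointWr CW DW).
rewrite (component_untouched un Dc) (iso_untouched un Di) /=.
by apply: disjointWr DW; exact: finset.subsetDl.
Qed.

Lemma add_copy_new h' (H' : sgraph 'I_h') :
  copies H' add_copy (W :\: C) \subset C |: copies H' G W.
Proof.
apply/fintype.subsetP => D; rewrite !inE => /and3P[Dc Di DW].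
have [//|DC] := eqVneq D C; rewrite /=.
have dis : [disjoint D & C].
  rewrite -setI_eq0; apply: contraNT DC => /set0Pn[x /finset.setIP[xD xC]].
  have cs : connect_sym (adj add_copy) by exact/sym_connect_sym/adj_sym.
  have /componentsP[a Ea] := Dc; have /componentsP[b Eb] := add_copy_component.
  move: xD xC; rewrite Ea Eb !inE => ax bx; apply/eqP/setP => u.
  by rewrite !inE (same_connect cs ax) (same_connect cs bx).
have un E : E \in symd (edges add_copy) (edges G) -> [disjoint E & D].
  by rewrite symdC; exact: untouched.
rewrite (component_untouched un Dc) (iso_untouched un Di) /=.
rewrite finset.disjoints_subset; apply/fintype.subsetP => x xD; rewrite inE.
apply/negP => xW; have := disjointFr DW xD.
by rewrite finset.in_setD xW andbT => /negbT; rewrite negbK (disjointFr dis xD).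
Qed.

Lemma add_copy_fresh h' (H' : sgraph 'I_h') : C \notin copies H' G W.
Proof.
rewrite inE; apply/negP => /and3P[_ _ dis].
have fC : f (Ordinal h0) \in C by exact: imset_f.
by have := disjointFr dis fC; rewrite fW.
Qed.

(** The edges of [G] avoid the reserve, so those inside [C] are exactly the new ones, and [C] is all
    one needs to know to undo the step. *)
Lemma add_copyK : mkgraph [set E in edges add_copy | ~~ (E \subset C)] = G.
Proof.
apply: val_inj.
change (edges (mkgraph [set E in edges add_copy | ~~ (E \subset C)]) = edges G).
apply/setP => E; rewrite in_mkgraph inE add_copy_edges finset.in_setU.
case EG: (E \in edges G) => /=.
  rewrite (edge_card EG) eqxx andbT; apply/negP => /fintype.subsetP EC.
  have [x [y [_ EE]]] := edge_ends EG.
  have xE : x \in E by rewrite EE set21.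
  by have := edge_out EG xE; rewrite (fintype.subsetP CW) // EC.
by case EH: (E \in Hf); rewrite //= HfC.
Qed.

Lemma add_copy_size : #|W| = (#|W :\: C| + h)%N.
Proof.
rewrite -(cardsID C W) addnC (finset.setIidPr CW); congr (_ + _)%N.
by rewrite card_imset // card_ord.
Qed.

Lemma add_copyW : (W :\: C) :|: C = W.
Proof.
apply/setP => x; rewrite !(finset.in_setU, finset.in_setD).
by case xC: (x \in C); rewrite ?orbF ?orbT //= (fintype.subsetP CW).
Qed.

End Embed.

End AddCopy.

(** * Conclusion *)

Section Stages.
Variables (R : realType) (l : nat) (h : 'I_l -> nat) (H : forall i : 'I_l, sgraph 'I_(h i)).
Hypothesis Hconn : forall i : 'I_l, connected_graph (H i).
Hypothesis Hplanar : forall i : 'I_l, planar R (H i).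
Variables (n m b t : nat) (S : {set 'I_l}).
Implicit Types (G : sgraph 'I_n) (W : {set 'I_n}) (L done : seq 'I_l).
Local Notation state := (sgraph 'I_n * {set 'I_n})%type.
Local Notation num i G W := #|copies (H i) G W|.

(* In a stage, copies of the [H i] for [i] in [done] have been added, and those
   for [i] in [L] are still to be added on the reserved vertices. *)
Definition stage done L : {set state} := [set X | [&& `[< planar R X.1 >],
  (#|edges X.1| + \sum_(i <- L) #|edges (H i)| == m)%N, isolated X.1 X.2,
  (#|X.2| == \sum_(i <- L) h i)%N &
  [forall i, if i \in S then (count_mem i done <= num i X.1 X.2 <= b + size done)%N
    else (t <= num i X.1 X.2)%N]]].

Lemma stageP done L G W : reflect [/\ planar R G,
    (#|edges G| + \sum_(i <- L) #|edges (H i)| = m)%N, isolated G W,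
    (#|W| = \sum_(i <- L) h i)%N &
    forall i, if i \in S then (count_mem i done <= num i G W <= b + size done)%N
      else (t <= num i G W)%N] ((G, W) \in stage done L).
Proof.
rewrite inE /=; apply: (iffP and5P) => [[/asboolP ? /eqP ? ? /eqP ? /forallP ?]|] //.
by move=> [? /eqP ? ? /eqP ? ?]; split => //; [exact/asboolP | exact/forallP].
Qed.

(** The added copy is one of the at most [b + size done + 1] copies of [H i] present afterwards, a
    bound that is available as [i] is in [S]; naming it undoes the step. *)
Lemma stage_step done i L : i \in S ->
  (#|stage done (i :: L)| <= (b + (size done).+1) * #|stage (i :: done) L|)%N.
Proof.
move=> iS; pose g (Y : state) (C : {set 'I_n}) : state :=
  (mkgraph [set E in edges Y.1 | ~~ (E \subset C)], Y.2 :|: C).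
pose r (X Y : state) := [exists C in copies (H i) Y.1 Y.2, X == g Y C].
have := @double_count _ _ (stage done (i :: L)) (stage (i :: done) L) r 1 1
  (b + (size done).+1).
rewrite !mul1n; apply.
- move=> -[G W] /stageP[pl em iso Wk cnt].
  have hW : (h i <= #|W|)%N by rewrite Wk big_cons leq_addr.
  have Hi := Hconn i; have Hp := Hplanar i; have [f fm fW] := increasing_in Hi hW.
  set C := [set f j | j : 'I_(h i)].
  pose G' := add_copy (H i) G f.
  have new j : (num j G' (W :\: C) <= (num j G W).+1)%N.
    apply: leq_trans (subset_leq_card (add_copy_new (Hconn i) iso fm fW (H j))) _.
    by rewrite cardsU1; case: (_ \notin _); rewrite ?add1n ?add0n.
  have kept j : (num j G W <= num j G' (W :\: C))%N.
    by apply: subset_leq_card; apply: add_copy_kept.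
  have CN : C \in copies (H i) G' (W :\: C).
    rewrite inE (add_copy_component (Hconn i) iso fm fW) (add_copy_iso (H i) iso fm fW) /=.
    rewrite finset.disjoints_subset; apply/fintype.subsetP => x xC.
    by rewrite finset.in_setC finset.in_setD xC.
  have more : (num i G W < num i G' (W :\: C))%N.
    have nC : C \notin copies (H i) G W by apply: add_copy_fresh.
    apply: (@leq_trans #|C |: copies (H i) G W|); first by rewrite cardsU1 nC.
    apply: subset_leq_card; rewrite finset.subUset finset.sub1set CN.
    by apply: add_copy_kept.
  rewrite mul1n; apply/card_gt0P; exists (G', W :\: C); rewrite inE; apply/andP; split; last first.
    apply/existsP; exists C; rewrite CN /g /=.
    by rewrite (add_copyK (H i) iso fm fW) (add_copyW fW).
  apply/stageP; split.
  + exact: (add_copy_planar Hp Hi pl iso fm fW).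
  + by rewrite (add_copy_card (H i) iso fm fW) -em big_cons addnA.
  + by apply: add_copy_isolated.
  + by have := add_copy_size fm fW; rewrite Wk big_cons -/C; lia.
  + move=> j; have := cnt j; have := new j; have := kept j.
    case: ifP => [jS|_]; last by lia.
    move=> kj nj /andP[c1 c2]; rewrite /= addnS; apply/andP; split; last by apply: leq_trans nj _; rewrite ltnS.
    case: eqVneq => [ij|_] /=; last by rewrite add0n; exact: leq_trans c1 kj.
    by move: c1; rewrite -ij add1n => c1; exact: leq_ltn_trans c1 more.
- move=> [G' W'] /stageP[_ _ _ _ /(_ i)]; rewrite iS /= => /andP[_ le].
  apply: leq_trans le; apply: (card_code_le (f := g (G', W'))) => X.
  by rewrite inE => /andP[_ /existsP[C /andP[CN /eqP ->]]]; exists C.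
Qed.

Lemma stage_all M L done : {subset L <= S} -> (size done + size L <= M)%N ->
  (#|stage done L| <= (b + M) ^ size L * #|stage (catrev L done) [::]|)%N.
Proof.
elim: L done => [|i L IH] done LS sM; first by rewrite mul1n.
have iS : i \in S by rewrite LS // inE eqxx.
apply: leq_trans (stage_step done L iS) _; rewrite expnS -mulnA; apply: leq_mul.
  by rewrite leq_add2l; move: sM => /=; lia.
apply: IH; last by move: sM => /=; lia.
by move=> j jL; rewrite LS // inE jL orbT.
Qed.

Lemma stage_good L : (forall i, i \in S -> t <= count_mem i L)%N ->
  (#|stage L [::]| <= #|[set G in planar_graphs R n m |
     [forall i : 'I_l, (t <= num_components G (H i))%N]]|)%N.
Proof.
move=> Lt; have W0 G W : (G, W) \in stage L [::] -> W = finset.set0.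
  by move=> /stageP[_ _ _ + _]; rewrite big_nil => /eqP; rewrite cards_eq0 => /eqP.
apply: (card_inj_le (f := fst)).
  by move=> [G W] [G' W'] /W0 -> /W0 -> /= ->.
move=> [G W] GW; have WE := W0 _ _ GW; subst W.
have /stageP[pl em _ _ cnt] := GW; rewrite inE /=; apply/andP; split.
  by rewrite inE; apply/andP; split; [exact/asboolP | rewrite -em big_nil addn0].
apply/forallP => i; rewrite -copies0; have := cnt i; case: ifP => [iS|_ //].
by move=> /andP[le _]; exact: leq_trans (Lt i iS) le.
Qed.

End Stages.

Section Levels.
Variables (l : nat) (h : 'I_l -> nat) (H : forall i : 'I_l, sgraph 'I_(h i)).
Variables (n t0 : nat) (S : {set 'I_l}).

(** By [copies_change] a step alters a number of copies by at most 25, twice the 12 changed edges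
    plus one reserved vertex. *)
Definition level s (G : sgraph 'I_n) (W : {set 'I_n}) : bool :=
  [forall i, if i \in S then (#|copies (H i) G W| <= t0 + 25 * s)%N
    else (t0 <= #|copies (H i) G W| + 25 * s)%N].

Lemma level_step s G W G' W' : level s G W ->
  (#|symd (edges G) (edges G')| <= 12)%N -> (#|symd W W'| <= 1)%N -> level s.+1 G' W'.
Proof.
move=> /forallP lv dG dW; apply/forallP => i.
have c1 : (#|W' :\: W| <= 1)%N.
  apply: leq_trans dW; apply: subset_leq_card; apply/fintype.subsetP => x.
  by rewrite !inE => /andP[/negbTE -> ->].
have c2 : (#|W :\: W'| <= 1)%N.
  apply: leq_trans dW; apply: subset_leq_card; apply/fintype.subsetP => x.
  by rewrite !inE => /andP[/negbTE -> ->].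
have := lv i; have := copies_change (H i) G G' W W'.
have := copies_change (H i) G' G W' W; rewrite (symdC (edges G')).
by case: ifP => _; lia.
Qed.

End Levels.

(** Each round costs one edge, which weakens the lower bound on [m]; for [n >= 2 * p * k] it still
    holds with [2 * p] in place of [p]. *)
Lemma reserve_iter (R : realType) (q p k : nat) : (0 < q)%N -> (0 < p)%N ->
  exists C N : nat, forall n (lev : nat -> sgraph 'I_n -> {set 'I_n} -> bool) m,
    (forall s G W G' W', lev s G W -> (#|symd (edges G) (edges G')| <= 12)%N ->
       (#|symd W W'| <= 1)%N -> lev s.+1 G' W') ->
    (N <= n)%N -> (q * m + n <= 3 * q * n)%N -> (n <= p * m)%N ->
    (#|states R lev 0 0 m| <= C * #|states R lev (5 * k) k (m - k)|)%N.
Proof.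
move=> q0 p0; elim: k => [|k [C [N IH]]].
  by exists 1%N, 0%N => n lev m _ _ _ _; rewrite muln0 subn0 mul1n.
pose D := (144 * q)%N; pose p2 := (2 * p)%N.
exists (C * ((12 * q * p2 * k.+1 + 12 * q * (k.+1 * (2 ^ (D + 4) * 2 ^ (D + 4) + 14))) *
  (5 * (6 * q) ^ 5)))%N, (N + (12 * q * k.+1 + 12 * q + k.+1 + 3) + p2 * k)%N.
move=> n lev m step nN qm pm; apply: leq_trans (IH n lev m step _ qm pm) _; first by lia.
rewrite -[leqRHS]mulnA; apply: leq_mul => //.
have -> : (5 * k.+1 = 5 * k + 5)%N by lia.
have -> : (m - k.+1 = (m - k).-1)%N by lia.
apply: states_reserve => //; rewrite ?muln_gt0 //.
- by lia.
- by apply: leq_trans qm; rewrite leq_add2r leq_mul2l leq_subr orbT.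
- rewrite mulnBr /p2; have := leq_mul (leqnn 2) pm; rewrite mulnA.
  by move: nN; rewrite /p2; lia.
Qed.

Section Types.
Variables (R : realType) (l : nat) (h : 'I_l -> nat) (H : forall i : 'I_l, sgraph 'I_(h i)).
Hypothesis Hconn : forall i : 'I_l, connected_graph (H i).
Hypothesis Hplanar : forall i : 'I_l, planar R (H i).
Hypothesis Hcycle : forall i : 'I_l, at_most_one_cycle (H i).
Variables (t q p : nat).
Hypotheses (q0 : (0 < q)%N) (p0 : (0 < p)%N).

Definition to_add (S : {set 'I_l}) : seq 'I_l := flatten (nseq t (enum S)).

Lemma to_add_sub (S : {set 'I_l}) : {subset to_add S <= S}.
Proof.
by move=> i /flattenP[s]; rewrite mem_nseq => /andP[_ /eqP ->]; rewrite mem_enum.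
Qed.

Lemma count_to_add (S : {set 'I_l}) i : i \in S -> count_mem i (to_add S) = t.
Proof.
move=> iS; rewrite /to_add; elim: t => //= t' IH; rewrite count_cat IH.
by rewrite count_uniq_mem ?enum_uniq // mem_enum iS.
Qed.

(** Reserving [k] vertices costs [k] edges. Then [k - e] edges are put back, so that the copies,
    with [e <= k] edges in all, restore [m]. This takes [5 * k] steps and at most [k] further ones,
    whence the factor 6. *)
Lemma type_bound (S : {set 'I_l}) t0 :
  (t + 25 * (6 * \sum_(i <- to_add S) h i) <= t0)%N ->
  exists C N : nat, forall n m, (N <= n)%N -> (q * m + n <= 3 * q * n)%N -> (n <= p * m)%N ->
    (#|states R (@level l h H n t0 S) 0 0 m| <= C * #|[set G in planar_graphs R n m |
     [forall i : 'I_l, (t <= num_components G (H i))%N]]|)%N.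
Proof.
set k := (\sum_(i <- _) _)%N => t0k; set L := to_add S in k t0k *.
pose e := (\sum_(i <- L) #|edges (H i)|)%N.
have ek : (e <= k)%N.
  apply: leq_sum => i _; have := Hconn i => /andP[h0 _].
  by have := unicyclic_edges h0 (@Hcycle i); rewrite card_ord.
have [C [N HC]] := @reserve_iter R q p k q0 p0.
pose b := (t0 + 25 * (6 * k))%N.
exists (C * ((6 * q) ^ (k - e) * (b + size L) ^ size L))%N,
  (N + (12 * q * k + 12 * q + k + 3) + p * k)%N => n m nN qm pm.
have step := @level_step l h H n t0 S.
have km : (k <= m)%N by rewrite -(leq_pmul2l p0); lia.
apply: leq_trans (HC n _ m step _ qm pm) _; first by lia.
rewrite -!mulnA; apply: leq_mul => //.
have nb : (12 * q * k + 12 * q + k + 3 <= n)%N by lia.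
have me : (m - k + (k - e) = m - e)%N by lia.
have lift := @states_lift R n _ step q k q0 nb (5 * k) (m - k) (k - e).
apply: leq_trans (lift _) _; first by rewrite me; apply: leq_trans qm; rewrite leq_add2r leq_mul2l leq_subr orbT.
apply: leq_mul => //; rewrite me.
have sub : states R (@level l h H n t0 S) (5 * k + (k - e))%N k (m - e)%N \subset
    stage R H n m b t S [::] L.
  apply/fintype.subsetP => -[G W] /statesP[pl em iso Wk /forallP lv].
  apply/stageP; split => //; first by rewrite em -/e; lia.
  by move=> i; have := lv i; rewrite /b /=; case: ifP => _; lia.
apply: leq_trans (subset_leq_card sub) _.
have grow : (#|stage R H n m b t S [::] L| <=
    (b + size L) ^ size L * #|stage R H n m b t S (catrev L [::]) [::]|)%N.
  by apply: stage_all => //; exact: to_add_sub.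
apply: leq_trans grow _.
apply: leq_mul => //; apply: stage_good => i iS.
by rewrite -[catrev _ _]/(rev L) count_rev count_to_add.
Qed.

(** With an empty reserve a state is just a graph, and every graph has a type [S], so summing over
    the types covers all graphs. The sum over all [S] in [t0] makes one threshold fit every type. *)
Lemma good_bound : exists C N : nat, forall n m, (N <= n)%N ->
  (q * m + n <= 3 * q * n)%N -> (n <= p * m)%N ->
  (#|planar_graphs R n m| <= C * #|[set G in planar_graphs R n m |
     [forall i : 'I_l, (t <= num_components G (H i))%N]]|)%N.
Proof.
pose t0 := (t + 25 * (6 * \sum_(S : {set 'I_l}) \sum_(i <- to_add S) h i))%N.
have t0S S : (t + 25 * (6 * \sum_(i <- to_add S) h i) <= t0)%N.
  by rewrite /t0 (bigD1 S) //=; lia.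
have /choice[CN HCN] : forall S : {set 'I_l}, exists CN : nat * nat,
    forall n m, (CN.2 <= n)%N -> (q * m + n <= 3 * q * n)%N -> (n <= p * m)%N ->
    (#|states R (@level l h H n t0 S) 0 0 m| <= CN.1 * #|[set G in planar_graphs R n m |
     [forall i : 'I_l, (t <= num_components G (H i))%N]]|)%N.
  by move=> S; have [C [N HC]] := type_bound (t0S S); exists (C, N).
exists (\sum_S (CN S).1)%N, (\sum_S (CN S).2)%N => n m nN qm pm.
pose D := [set x : {set 'I_l} * (sgraph 'I_n * {set 'I_n}) |
  (x.1 \in [set: {set 'I_l}]) && (x.2 \in states R (@level l h H n t0 x.1) 0 0 m)].
apply: (@leq_trans #|D|).
  apply: (card_code_le (f := fun x => x.2.1)) => G; rewrite inE => /andP[/asboolP pl /eqP em].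
  pose S := [set i : 'I_l | (num_components G (H i) < t0)%N].
  exists (S, (G, finset.set0)) => //; rewrite inE finset.in_setT /=; apply/statesP; split => //.
  - apply/isolatedP => E _; rewrite disjoint_sym finset.disjoints_subset.
    exact: finset.sub0set.
  - exact: cards0.
  - apply/forallP => i; rewrite copies0 muln0 !addn0; case: ifP; rewrite inE.
      exact: ltnW.
    by move=> /negbT; rewrite -leqNgt.
rewrite (card_dep [set: {set 'I_l}] (fun S => states R (@level l h H n t0 S) 0 0 m)).
rewrite big_distrl /= [leqLHS](eq_bigl (fun=> true)) => [|S]; last by rewrite inE.
apply: leq_sum => S _; apply: HCN => //; apply: leq_trans nN.
by rewrite (bigD1 S) //= leq_addr.
Qed.

End Types.

(** The empty graph extends to a planar graph with at least [3 * n - 6] edges, any [m] of which form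
    a planar graph. *)
Lemma planar_graphs_gt0 (R : realType) n m : (m + 6 <= 3 * n)%N -> (2 < n)%N ->
  (0 < #|planar_graphs R n m|)%N.
Proof.
move=> mn n2; pose G0 : sgraph 'I_n := mkgraph finset.set0.
have pl0 : planar R G0.
  apply: rplanar_planar; apply: (@rplanar_sub R _ _ (fun _ _ => false)).
  - exact: adj_sym.
  - by move=> x y; rewrite /adj in_mkgraph inE.
  - exact: rplanar_discrete.
have [|G [_ pl le]] := planar_extend pl0; first by rewrite card_ord.
rewrite card_ord in le.
have [A] : exists A, A \in [set A : {set {set 'I_n}} | A \subset edges G & #|A| == m].
  by apply/card_gt0P; rewrite cards_draws bin_gt0; lia.
rewrite inE => /andP[AG /eqP Am]; apply/card_gt0P; exists (mkgraph A).
have EA : edges (mkgraph A) = A.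
  apply/setP => E; rewrite in_mkgraph andb_idr // => /(fintype.subsetP AG) EG.
  by rewrite (edge_card EG).
rewrite inE EA Am eqxx andbT; apply/asboolP; apply: planar_sub pl.
by rewrite EA.
Qed.

Theorem theorem6p3 (R : realType) (c B : R) (m : nat -> nat)
    (l : nat) (h : 'I_l -> nat) (H : forall i : 'I_l, sgraph 'I_(h i)) (t : nat)
    (hc : 0 < c) (hB : B < 3)
    (hm : exists n0 : nat, forall n : nat, (n0 <= n)%N ->
       c * n%:R <= (m n)%:R /\ (m n)%:R <= B * n%:R)
    (Hconn : forall i : 'I_l, connected_graph (H i))
    (Hplanar : forall i : 'I_l, planar R (H i))
    (Hcycle : forall i : 'I_l, at_most_one_cycle (H i)) :
  exists (eps : R) (N : nat), 0 < eps /\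
    forall n : nat, (N <= n)%N ->
      eps <= planar_prob R n (m n)
        (fun G : sgraph 'I_n =>
           [forall i : 'I_l, (t <= num_components G (H i))%N]).
Proof.
have [n0 hn] := hm.
have large (x : R) : 0 < x -> exists2 q : nat, (0 < q)%N & 1 <= q%:R * x.
  move=> x0; exists (Num.truncn x^-1).+1 => //.
  by rewrite -ler_pdivrMr // div1r ltW // truncnS_gt.
(* Integers with [1 / q <= 3 - B] and [1 / p <= c]. *)
have [q q0 qB] : exists2 q : nat, (0 < q)%N & 1 <= q%:R * (3 - B).
  by apply: large; rewrite subr_gt0.
have [p p0 pc] := large _ hc.
have [C [N HC]] := good_bound Hconn Hplanar Hcycle t q0 p0.
(* [C] may be 0, hence the successor. The term [6 * q] makes [m + 6 <= 3 * n] follow from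
   [q * m + n <= 3 * q * n], so that the denominator is positive. *)
exists (C.+1%:R^-1), (n0 + N + 6 * q + 3)%N; split; first by rewrite invr_gt0 ltr0n.
move=> n nN; have nn0 : (n0 <= n)%N by lia.
have [cm mB] := hn n nn0.
have qm : (q * m n + n <= 3 * q * n)%N.
  rewrite -(ler_nat R) natrD !natrM.
  have n_ge0 : 0 <= n%:R :> R by [].
  have q_ge0 : 0 <= q%:R :> R by [].
  have H1 := ler_wpM2l q_ge0 mB.
  have H2 := ler_wpM2r n_ge0 qB; lra.
have pm : (n <= p * m n)%N.
  rewrite -(ler_nat R) natrM; have n_ge0 : 0 <= n%:R :> R by [].
  have p_ge0 : 0 <= p%:R :> R by [].
  have H1 := ler_wpM2l p_ge0 cm; have H2 := ler_wpM2r n_ge0 pc; lra.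
have pos : (0 < #|planar_graphs R n (m n)|)%N.
  apply: planar_graphs_gt0; last by lia.
  by rewrite -(leq_pmul2l q0); lia.
have nNN : (N <= n)%N by lia.
have le := HC n (m n) nNN qm pm.
rewrite /planar_prob ler_pdivlMr ?ltr0n // mulrC ler_pdivrMr ?ltr0n // -natrM ler_nat.
rewrite mulnC; apply: leq_trans le _.
by rewrite leq_mul2r leqnSn orbT.
Qed.
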